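(* Let $d,d_1\in\mathbb{N}$ and let $(x_n)_{n=1}^\infty\subseteq[0,1]^d$. (i) If $(x_n)_{n=1}^\infty$ is a sL-sequence and $(n_k)_{k=1}^\infty\subseteq\mathbb{N}$ is a spectrally singular sequence of natural numbers, then $(x_{n_k})_{k=1}^\infty$ is uniformly distributed in $[0,1]^d$. Likewise, if $(x_n)_{n=1}^\infty$ is a wm-sequence and $(n_k)_{k=1}^\infty\subseteq\mathbb{N}$ is a compact sequence of natural numbers, then $(x_{n_k})_{k=1}^\infty$ is uniformly distributed in $[0,1]^d$. (ii) If for every compact sequence of natural numbers $(n_k)_{k=1}^\infty\subseteq\mathbb{N}$ the sequence $(x_{n_k})_{k=1}^\infty$ is uniformly distributed in $[0,1]^d$, then $(x_n)_{n=1}^\infty$ is a wm-sequence. (iii) If $(x_n)_{n=1}^\infty$ is a sL-sequence and $(y_n)_{n=1}^\infty\subseteq[0,1]^{d_1}$ is a uniformly distributed ss-sequence, then $(x_n,y_n)_{n=1}^\infty$ is uniformly distributed in $[0,1]^{d+d_1}$. Likewise, if $(x_n)_{n=1}^\infty$ is a wm-sequence and $(y_n)_{n=1}^\infty\subseteq[0,1]^{d_1}$ is a uniformly distributed c-sequence, then $(x_n,y_n)_{n=1}^\infty$ is uniformly distributed in $[0,1]^{d+d_1}$. (iv) If $(x_n+y_n)_{n=1}^\infty$ is uniformly distributed in $[0,1]^d$ (addition being coordinatewise modulo $1$) for all c-sequences $(y_n)_{n=1}^\infty\subseteq[0,1]^d$, then $(x_n)_{n=1}^\infty$ is a wm-s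equence.
   Context: Notation: $\mathbb{N}=\{1,2,3,\dots\}$; $m$ is Lebesgue measure on $[0,1]$ and $m^d$ is Lebesgue measure on $[0,1]^d$. Sums of elements of $[0,1]^d$ are taken coordinatewise modulo $1$. A sequence in $[0,1]^d$ is uniformly distributed if for every axis-parallel box $B\subseteq[0,1]^d$ the proportion of the first $N$ terms lying in $B$ tends to $m^d(B)$ as $N\to\infty$. Permissible triple: for bounded complex sequences $(x_n)_{n=1}^\infty$, $(y_n)_{n=1}^\infty$ and an increasing sequence $(N_q)_{q=1}^\infty\subseteq\mathbb{N}$, the triple $((x_n),(y_n),(N_q))$ is permissible if $\lim_{q\to\infty}\frac1{N_q}\sum_{n=1}^{N_q}c_{n+h}\overline{d_n}$ exists for all integers $h\ge 0$ and all choices $(c_n),(d_n)\in\{(x_n),(y_n)\}$. Let $(x_n)_{n=1}^\infty$ be a bounded sequence of complex numbers. - It is nearly weakly mixing if for every permissible triple $((x_n),(y_n),(N_q))$ (with $(y_n)$ any bounded sequence) one has $\lim_{H\to\infty}\frac1H\sum_{h=1}^H\lim_{q\to\infty}\left|\frac1{N_q}\sum_{n=1}^{N_q}x_{n+h}\overline{y_n}\right|=0$. - It is spectrally Lebesgue if for every permissible triple $((x_n),(x_n),(N_q))$ there is $f\in L^1([0,1],m)$ with $\lim_{q\to\infty}\frac1{N_q}\sum_{n=1}^{N_q}x_{n+h}\overline{x_n}=\int_0^1 f(x)e^{2\pi i hx}\,dx$ for all integers $h\ge0$. - It is compact if for every permissible triple $((x_n),(x_n),(N_q))$ and every $\epsilon>0$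 there is $K\in\mathbb{N}$ with $\sup_{l\in\mathbb{N}}\min_{1\le k\le K}\lim_{q\to\infty}\frac1{N_q}\sum_{n=1}^{N_q}|x_{n+l}-x_{n+k}|^2<\epsilon$. - It is spectrally singular if for every permissible triple $((x_n),(x_n),(N_q))$ there is a finite positive Borel measure $\mu$ on $[0,1]$ with $\mu\perp m$ and $\lim_{q\to\infty}\frac1{N_q}\sum_{n=1}^{N_q}x_{n+h}\overline{x_n}=\int_0^1 e^{2\pi i hx}\,d\mu(x)$ for all integers $h\ge0$. Let $\mathcal{C}_d=\{f\in C([0,1]^d): \int_{[0,1]^d}f\,dm^d=0\}$ (complex-valued functions). A sequence $(x_n)_{n=1}^\infty\subseteq[0,1]^d$ is a wm-sequence (resp. sL-sequence) if for every $f\in\mathcal{C}_d$ the sequence $(f(x_n))_{n=1}^\infty$ is nearly weakly mixing (resp. spectrally Lebesgue). It is a c-sequence (resp. ss-sequence) if for every $f\in C([0,1]^d)$ the sequence $(f(x_n))_{n=1}^\infty$ is compact (resp. spectrally singular). A strictly increasing sequence $A=(n_k)_{k=1}^\infty\subseteq\mathbb{N}$ with positive lower density, $\liminf_{N\to\infty}\frac1N|A\cap[1,N]|>0$, is called compact (resp. spectrally singular) as a sequence of natural numbers if $(\mathbb{1}_A(n))_{n=1}^\infty$ is compact (resp. spectrally singular) as a bounded sequence of complex numbers. *)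

(* Defs.v *)
From HB Require Import structures.
From mathcomp Require Import all_boot all_order all_algebra.
From mathcomp Require Import all_classical all_reals all_analysis.
From mathcomp Require Import complex.

Set Implicit Arguments.
Unset Strict Implicit.
Unset Printing Implicit Defensive.

Import Order.TTheory GRing.Theory Num.Theory.
Import numFieldNormedType.Exports.

Local Open Scope classical_set_scope.
Local Open Scope ring_scope.

(* A sequence indexed by {1, 2, 3, ...} is represented by a function on [nat]
   whose value at 0 plays no role. *)

Definition pos_increasing (u : nat -> nat) : Prop :=
  (forall k, (0 < k)%N -> (0 < u k)%N) /\
  (forall j k, (0 < j)%N -> (j < k)%N -> (u j < u k)%N).

Definition average (F : fieldType) (N : nat) (u : nat -> F) : F :=
  (\sum_(1 <= n < N.+1) u n) / N%:R.

Section ComplexSequences.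
Context {R : realType}.
Implicit Types (x y : nat -> R[i]) (Nq : nat -> nat).

(* [R[i]^o] is [R[i]] with the topology of its norm; the modulus of [z] as an
   element of [R] is [ComplexField.Normc.normc z]. *)
Local Notation normc := ComplexField.Normc.normc.

Definition bounded_cseq x : Prop :=
  exists M : R, forall n, (0 < n)%N -> normc (x n) <= M.

Definition correlation x y (h N : nat) : R[i] :=
  average N (fun n => x (n + h)%N * conjc (y n)).

Definition permissible x y Nq : Prop :=
  [/\ bounded_cseq x, bounded_cseq y, pos_increasing Nq &
      forall (h : nat) (c d : nat -> R[i]), [set x; y] c -> [set x; y] d ->
        cvgn (fun q => correlation c d h (Nq q) : R[i]^o)].

Definition nearly_weakly_mixing x : Prop :=
  bounded_cseq x /\
  forall y Nq, permissible x y Nq ->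
    (fun H : nat => average H (fun h =>
       limn (fun q => normc (correlation x y h (Nq q))))) @ \oo --> (0 : R).

Definition compact_cseq x : Prop :=
  bounded_cseq x /\
  forall Nq, permissible x x Nq -> forall e : R, 0 < e ->
    exists2 K : nat, (0 < K)%N &
    (ereal_sup [set \big[Order.min/+oo]_(1 <= k < K.+1)
        (limn (fun q =>
           average (Nq q) (fun n => normc (x (n + l)%N - x (n + k)%N) ^+ 2)))%:E
      | l in [set l : nat | (0 < l)%N]] < e%:E)%E.

Definition unitI : set (measurableTypeR R) := `[0, 1]%classic.

Lemma measurable_unitI : measurable unitI.
Proof. exact: measurable_itv. Qed.

(* Lebesgue measure on [0, 1], seen as a measure on the line carried by
   [0, 1]. *)
Definition lebesgue01 : set (measurableTypeR R) -> \bar R :=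
  mrestr (@lebesgue_measure R) measurable_unitI.

HB.instance Definition _ := Measure.on lebesgue01.

Lemma lebesgue01_setT : lebesgue01 setT = 1%E.
Proof.
rewrite /lebesgue01 /mrestr setTI /unitI lebesgue_measure_itv /= lte_fin ltr01.
by rewrite oppr0 adde0.
Qed.

HB.instance Definition _ :=
  Measure_isProbability.Build _ _ _ lebesgue01 lebesgue01_setT.

Definition cintegrable d (T : measurableType d)
    (mu : {measure set T -> \bar R}) (D : set T) (f : T -> R[i]) : Prop :=
  mu.-integrable D (fun t => (complex.Re (f t))%:E) /\
  mu.-integrable D (fun t => (complex.Im (f t))%:E).

Definition cintegral d (T : measurableType d)
    (mu : {measure set T -> \bar R}) (D : set T) (f : T -> R[i]) : R[i] :=
  Complex (\int[mu]_(t in D) complex.Re (f t))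
          (\int[mu]_(t in D) complex.Im (f t)).

Definition expi (t : R) : R[i] := Complex (cos t) (sin t).

Definition spectrally_Lebesgue x : Prop :=
  bounded_cseq x /\
  forall Nq, permissible x x Nq ->
    exists2 f : measurableTypeR R -> R[i], cintegrable lebesgue01 unitI f &
    forall h : nat,
      (fun q => correlation x x h (Nq q) : R[i]^o) @ \oo -->
      (cintegral lebesgue01 unitI
         (fun t => f t * expi (2 * pi * h%:R * t)) : R[i]^o).

Definition mutually_singular d (T : measurableType d)
    (mu nu : {measure set T -> \bar R}) : Prop :=
  exists A : set T, [/\ measurable A, mu A = 0%E & nu (~` A) = 0%E].

(* A Borel measure on [0, 1] is a Borel measure on the line that vanishes
   outside [0, 1]. *)
Definition spectrally_singular x : Prop :=
  bounded_cseq x /\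
  forall Nq, permissible x x Nq ->
    exists mu : {finite_measure set (measurableTypeR R) -> \bar R},
    [/\ mu (~` unitI) = 0%E,
        mutually_singular mu lebesgue01 &
        forall h : nat,
          (fun q => correlation x x h (Nq q) : R[i]^o) @ \oo -->
          (cintegral mu unitI (fun t => expi (2 * pi * h%:R * t)) : R[i]^o)].

End ComplexSequences.

Section NaturalSequences.
Variable R : realType.
Implicit Types (A : set nat) (nk : nat -> nat).

Definition lower_density A : R :=
  limn_inf (fun N => average N (\1_A : nat -> R)).

Definition terms nk : set nat := nk @` [set k | (0 < k)%N].

Definition pos_density_seq nk : Prop :=
  pos_increasing nk /\ 0 < lower_density (terms nk).

Definition compact_natseq nk : Prop :=
  pos_density_seq nk /\ compact_cseq (\1_(terms nk) : nat -> R[i]).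

Definition spectrally_singular_natseq nk : Prop :=
  pos_density_seq nk /\ spectrally_singular (\1_(terms nk) : nat -> R[i]).

End NaturalSequences.

Section LebesgueCube.
Variable R : realType.
Local Notation RB := (measurableTypeR R).

Definition cons_pair n (p : RB * n.-tuple RB) : n.+1.-tuple RB :=
  [the n.+1.-tuple RB of p.1 :: p.2].

Lemma measurable_cons_pair n : measurable_fun setT (@cons_pair n).
Proof. exact: measurable_cons. Qed.

HB.instance Definition _ n :=
  isMeasurableFun.Build _ _ _ _ (@cons_pair n) (@measurable_cons_pair n).

(* The n-fold product of Lebesgue measure on [0, 1]; it lives on tuples, where
   the product sigma-algebra is available. *)
Fixpoint lebesgue_cube_tuple n : probability (n.-tuple RB) R :=
  match n return probability (n.-tuple RB) R with
  | 0 => \d_([tuple] : 0.-tuple RB)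
  | n'.+1 =>
      distribution (@lebesgue01 R \x lebesgue_cube_tuple n')%E (@cons_pair n')
  end.

End LebesgueCube.

Section CubeSequences.
Context {R : realType}.

Definition row_of_tuple n (t : n.-tuple R) : 'rV[R]_n := \row_i tnth t i.

Definition lebesgue_cube d (B : set 'rV[R]_d) : \bar R :=
  lebesgue_cube_tuple R d (@row_of_tuple d @^-1` B).

Definition cube d : set 'rV[R]_d := [set v | forall i, 0 <= v ord0 i <= 1].
Arguments cube : clear implicits.

Definition cube_integral d (f : 'rV[R]_d -> R[i]) : R[i] :=
  cintegral (lebesgue_cube_tuple R d) (@row_of_tuple d @^-1` cube d)
    (f \o @row_of_tuple d).

Definition box d (J : 'I_d -> interval R) : set 'rV[R]_d :=
  [set v | forall i, v ord0 i \in J i].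

Definition in_cube d (x : nat -> 'rV[R]_d) : Prop :=
  forall n, (0 < n)%N -> cube d (x n).

(* The sides of a box may be open, closed or half-open. *)
Definition uniformly_distributed d (x : nat -> 'rV[R]_d) : Prop :=
  forall J : 'I_d -> interval R, box J `<=` cube d ->
    (fun N : nat => average N (fun n => \1_(box J) (x n))) @ \oo -->
    fine (lebesgue_cube (box J)).

(* C([0,1]^d): only the restriction of [f] to the cube is relevant. *)
Definition continuous_on_cube d (f : 'rV[R]_d -> R[i]) : Prop :=
  {within cube d, continuous (f : 'rV[R]_d -> R[i]^o)}.

Definition wm_sequence d (x : nat -> 'rV[R]_d) : Prop :=
  forall f : 'rV[R]_d -> R[i], continuous_on_cube f -> cube_integral f = 0 ->
    nearly_weakly_mixing (f \o x).

Definition sL_sequence d (x : nat -> 'rV[R]_d) : Prop :=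
  forall f : 'rV[R]_d -> R[i], continuous_on_cube f -> cube_integral f = 0 ->
    spectrally_Lebesgue (f \o x).

Definition c_sequence d (x : nat -> 'rV[R]_d) : Prop :=
  forall f : 'rV[R]_d -> R[i], continuous_on_cube f -> compact_cseq (f \o x).

Definition ss_sequence d (x : nat -> 'rV[R]_d) : Prop :=
  forall f : 'rV[R]_d -> R[i], continuous_on_cube f ->
    spectrally_singular (f \o x).

Definition fract_part (t : R) : R := t - (Num.floor t)%:~R.

Definition add_mod1 d (u v : 'rV[R]_d) : 'rV[R]_d :=
  \row_i fract_part (u ord0 i + v ord0 i).

End CubeSequences.

(* Main.v *)
Require Import Defs.
From mathcomp Require Import all_boot all_order all_algebra.
From mathcomp Require Import all_classical all_reals all_analysis.
From mathcomp Require Import measurable_realfun complex ring lra zify.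
Set Implicit Arguments.
Unset Strict Implicit.
Unset Printing Implicit Defensive.
Import Order.TTheory GRing.Theory Num.Theory.
Import numFieldNormedType.Exports.
Import ComplexField.
Local Open Scope classical_set_scope.
Local Open Scope ring_scope.
Local Notation normc := Normc.normc.
Local Notation Re := complex.Re.
Local Notation Im := complex.Im.

(** Along a sequence [N_q], averages become a positive functional, for which the
    correlations of a sequence are the Fourier coefficients of a spectral
    measure.

    Orthogonality.  Let [u] be spectrally Lebesgue with density [f] and [w]
    spectrally singular with measure [mu].  A polynomial [p] of the shift can
    be chosen with [p] close to [0] in [L^2(f)] and close to [1] in [L^2(mu)],
    by approximating [F / (1 + F)], where [F] is small in [L^2(m)] and close to a
    large constant off a set of small [mu] measure; applying [p] to both
    sequences shows that [u] and [w] are asymptotically uncorrelated.  For a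
    nearly weakly mixing [u] and a compact [w], total boundedness of the
    translates of [w] replaces this.  Indicator functions of boxes are squeezed
    between continuous functions, and (i) and (iii) follow.

    Converses.  If [u] is not nearly weakly mixing, there is a frequency [al] for
    which the averages of [u n * expi (- 2 pi al n)] over long windows are large.
    Keeping the [n] for which [al n] modulo 1 lies in a fixed short arc and which
    belong to windows where the phase of the average is favourable gives an almost
    periodic set of integers along which [u] does not average to zero.  In
    (ii) the indicator function of such a set is written with those of sets of
    positive density.  In (iv) a sequence taking the values [t] on the set and [0]
    off it is added to [x]; varying [t] in a grid shows that [x] visits all the
    cells of the grid equally often along the set. *)

(** * Complex arithmetic and the characters of the circle *)

Section ComplexNumbers.
Context {R : realType}.
Implicit Types (z w : R[i]) (a t : R).

(** No spectral measure is built for a general sequence. Inequalities between trigonometric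
    polynomials on the circle pass to the shift through [toeplitz_ge0], which replaces the spectral
    theorem for a functional known on bounded sequences only.

    Only correlations with lag [h >= 0] are prescribed and [f] is merely a complex [L^1] function,
    so [\int f p] is accessible and [\int f |p|^2] is not. Hence the disc [|p|^2 <= Re p]: it bounds
    the squared norm of [p] applied to the sequence by a quantity linear in [p]. Control of the real
    part of [F] is enough: for a polynomial [F] with [F(0)] real, [\int F^2 = F(0)^2 >= 0], so the
    imaginary part is dominated in mean square by the real part.

    In the converses the frequency depends at first on the length of the window; near monotonicity
    of normalised window sums and compactness of [[0, 1]] give one frequency for all lengths. Blocks
    of bounded length would switch too often for the resulting set to vary slowly, so their length
    grows from stage to stage. *)

Lemma cplxP z w : Re z = Re w -> Im z = Im w -> z = w.
Proof. by case: z w => a b [c d] /= -> ->. Qed.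

Lemma cReD z w : Re (z + w) = Re z + Re w. Proof. by case: z w => ? ? []. Qed.
Lemma cImD z w : Im (z + w) = Im z + Im w. Proof. by case: z w => ? ? []. Qed.
Lemma cReN z : Re (- z) = - Re z. Proof. by case: z. Qed.
Lemma cImN z : Im (- z) = - Im z. Proof. by case: z. Qed.
Lemma cReB z w : Re (z - w) = Re z - Re w. Proof. by rewrite cReD cReN. Qed.
Lemma cImB z w : Im (z - w) = Im z - Im w. Proof. by rewrite cImD cImN. Qed.
Lemma cReM z w : Re (z * w) = Re z * Re w - Im z * Im w.
Proof. by case: z w => ? ? []. Qed.
Lemma cImM z w : Im (z * w) = Re z * Im w + Im z * Re w.
Proof. by case: z w => ? ? []. Qed.
Lemma cReJ z : Re (conjc z) = Re z. Proof. by case: z. Qed.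
Lemma cImJ z : Im (conjc z) = - Im z. Proof. by case: z. Qed.
Lemma cReC a : Re (a%:C)%C = a. Proof. by []. Qed.
Lemma cImC a : Im (a%:C)%C = 0. Proof. by []. Qed.

Lemma cReMC a z : Re ((a%:C)%C * z) = a * Re z.
Proof. by rewrite cReM cReC cImC mul0r subr0. Qed.
Lemma cImMC a z : Im ((a%:C)%C * z) = a * Im z.
Proof. by rewrite cImM cReC cImC mul0r addr0. Qed.

Lemma cRe_sum (I : Type) (r : seq I) (P : pred I) (F : I -> R[i]) :
  Re (\sum_(i <- r | P i) F i) = \sum_(i <- r | P i) Re (F i).
Proof. by apply: (big_morph (@complex.Re R)) => // z w; rewrite cReD. Qed.
Lemma cIm_sum (I : Type) (r : seq I) (P : pred I) (F : I -> R[i]) :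
  Im (\sum_(i <- r | P i) F i) = \sum_(i <- r | P i) Im (F i).
Proof. by apply: (big_morph (@complex.Im R)) => // z w; rewrite cImD. Qed.

Lemma nrm_ge0 z : 0 <= normc z. Proof. by case: z => a b /=; exact: sqrtr_ge0. Qed.
Lemma sqr_nrm z : normc z ^+ 2 = Re z ^+ 2 + Im z ^+ 2.
Proof. by case: z => a b /=; rewrite sqr_sqrtr// addr_ge0 ?sqr_ge0. Qed.
Lemma mulcJ z : z * conjc z = (normc z ^+ 2)%:C%C.
Proof. by apply: cplxP; rewrite ?cReM ?cImM cReJ cImJ ?cReC ?cImC ?sqr_nrm; ring. Qed.
Lemma nrmM z w : normc (z * w) = normc z * normc w. Proof. exact: Normc.normcM. Qed.
Lemma nrmD z w : normc (z + w) <= normc z + normc w. Proof. exact: le_normcD. Qed.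
Lemma nrmN z : normc (- z) = normc z. Proof. exact: normcN. Qed.
Lemma nrmB z w : normc (z - w) <= normc z + normc w.
Proof. by rewrite -(nrmN w) nrmD. Qed.
Lemma nrmBC z w : normc (z - w) = normc (w - z).
Proof. by rewrite -opprB nrmN. Qed.
Lemma nrmJ z : normc (conjc z) = normc z.
Proof. by case: z => a b /=; rewrite sqrrN. Qed.
Lemma nrmC a : normc (a%:C)%C = `|a|.
Proof. by rewrite /= expr0n /= addr0 sqrtr_sqr. Qed.
Lemma nrm0 : normc (0 : R[i]) = 0. Proof. exact: Normc.normc0. Qed.
Lemma nrm1 : normc (1 : R[i]) = 1. Proof. exact: Normc.normc1. Qed.
Lemma nrmX z n : normc (z ^+ n) = normc z ^+ n.
Proof. by elim: n => [|n IH]; rewrite ?expr0 ?nrm1// !exprS nrmM IH. Qed.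
Lemma nrm_nat n : normc (n%:R : R[i]) = n%:R.
Proof. by have := nrmC n%:R; rewrite rmorph_nat ger0_norm. Qed.
Lemma nrm_inv z : normc z^-1 = (normc z)^-1. Proof. exact: Normc.normcV. Qed.
Lemma nrm_sum (I : Type) (r : seq I) (P : pred I) (F : I -> R[i]) :
  normc (\sum_(i <- r | P i) F i) <= \sum_(i <- r | P i) normc (F i).
Proof.
elim/big_ind2 : _ => [|x y z w h1 h2|//]; first by rewrite nrm0.
by rewrite (le_trans (nrmD _ _)) // lerD.
Qed.
Lemma nrm_eq0 z : (normc z == 0) = (z == 0).
Proof. by apply/eqP/eqP => [/Normc.eq0_normc//|->]; rewrite nrm0. Qed.

Lemma cRe_nrm z : `|Re z| <= normc z.
Proof.
rewrite -(@ler_pXn2r _ 2)// ?nnegrE ?nrm_ge0// sqr_nrm real_normK ?num_real//.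
by rewrite lerDl sqr_ge0.
Qed.
Lemma cIm_nrm z : `|Im z| <= normc z.
Proof.
rewrite -(@ler_pXn2r _ 2)// ?nnegrE ?nrm_ge0// sqr_nrm real_normK ?num_real//.
by rewrite lerDr sqr_ge0.
Qed.
Lemma cRe_le_nrm z : Re z <= normc z.
Proof. exact: le_trans (ler_norm _) (cRe_nrm z). Qed.
Lemma nrm_ReIm z : normc z <= `|Re z| + `|Im z|.
Proof.
have -> : z = (Re z)%:C%C + 'i%C * (Im z)%:C%C by rewrite -complexE.
rewrite (le_trans (nrmD _ _))// nrmM !nrmC cReD cImD cReM cImM !cReC !cImC /=.
have -> : Num.sqrt ((0:R) ^+ 2 + 1 ^+ 2) = 1 by rewrite expr0n expr1n add0r sqrtr1.
by rewrite !(mul0r, mul1r, mulr0, addr0, subr0, add0r).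
Qed.

Lemma conjcM z w : conjc (z * w) = conjc z * conjc w. Proof. exact: rmorphM. Qed.
Lemma conjcD z w : conjc (z + w) = conjc z + conjc w. Proof. exact: rmorphD. Qed.
Lemma conjcB z w : conjc (z - w) = conjc z - conjc w. Proof. exact: rmorphB. Qed.
Lemma conjcX z n : conjc (z ^+ n) = conjc z ^+ n. Proof. exact: rmorphXn. Qed.
Lemma conjc_sum (I : Type) (r : seq I) (P : pred I) (F : I -> R[i]) :
  conjc (\sum_(i <- r | P i) F i) = \sum_(i <- r | P i) conjc (F i).
Proof. exact: rmorph_sum. Qed.

(** Rotating a value onto the positive axis reduces bounds on moduli to bounds on real parts, and
    lets the phases of several correlations be aligned. *)
Lemma rotate_Re z : exists2 w, normc w = 1 & Re (w * z) = normc z.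
Proof.
have [->|z0] := eqVneq z 0; first by exists 1; rewrite ?nrm1// mulr0 nrm0.
have nz : normc z != 0 by rewrite nrm_eq0.
exists ((normc z)^-1%:C%C * conjc z).
  by rewrite nrmM nrmC nrmJ ger0_norm ?invr_ge0 ?nrm_ge0// mulVf.
by rewrite -mulrA cReMC mulrC [conjc z * z]mulrC mulcJ cReC expr2 mulfK.
Qed.

Definition E t : R[i] := expi (2 * pi * t).

Lemma ReE t : Re (E t) = cos (2 * pi * t). Proof. by []. Qed.
Lemma ImE t : Im (E t) = sin (2 * pi * t). Proof. by []. Qed.
Lemma E0 : E 0 = 1. Proof. by apply: cplxP; rewrite ?ReE ?ImE mulr0 ?cos0 ?sin0. Qed.
Lemma ED t a : E (t + a) = E t * E a.
Proof.
apply: cplxP; rewrite ?cReM ?cImM !ReE !ImE mulrDr ?cosD ?sinD//.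
by rewrite addrC.
Qed.
Lemma EN t : E (- t) = conjc (E t).
Proof. by apply: cplxP; rewrite ?cReJ ?cImJ ?ReE ?ImE mulrN ?cosN ?sinN. Qed.
Lemma nrmE t : normc (E t) = 1.
Proof.
apply: (@pexpIrn _ 2); rewrite ?nnegrE ?nrm_ge0 ?ler01//.
by rewrite sqr_nrm ReE ImE cos2Dsin2 expr1n.
Qed.
Lemma EJ t : E t * conjc (E t) = 1. Proof. by rewrite mulcJ nrmE expr1n. Qed.
Lemma EX t n : E t ^+ n = E (t *+ n).
Proof. by elim: n => [|n IH]; rewrite ?expr0 ?mulr0n ?E0// exprS IH mulrS ED. Qed.
Lemma expi_nat n t : expi (2 * pi * n%:R * t) = E t ^+ n.
Proof. by rewrite EX /E -(mulr_natl t n) mulrA. Qed.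
Lemma E1 : E 1 = 1.
Proof. by apply: cplxP; rewrite ?ReE ?ImE mulr1 mulrC mulr_natr ?cos2pi ?sin2pi. Qed.
Lemma Enat n : E n%:R = 1. Proof. by rewrite -EX E1 expr1n. Qed.
Lemma Eint (k : int) : E k%:~R = 1.
Proof. by case: k => n; rewrite ?NegzE ?mulrNz ?EN Enat ?conjc1. Qed.

Lemma nrm_EB t a : normc (E t - E a) ^+ 2 = 2 - 2 * cos (2 * pi * (t - a)).
Proof.
rewrite sqr_nrm cReB cImB !ReE !ImE mulrBr cosB.
have h1 := cos2Dsin2 (2 * pi * t); have h2 := cos2Dsin2 (2 * pi * a).
rewrite !sqrrB.
move: h1 h2; set x := cos _; set y := sin _; set c := cos _; set s := sin _ => h1 h2.
have -> : x ^+ 2 - x * c *+ 2 + c ^+ 2 + (y ^+ 2 - y * s *+ 2 + s ^+ 2) =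
  (x ^+ 2 + y ^+ 2) + (c ^+ 2 + s ^+ 2) - 2 * (x * c + y * s) by ring.
by rewrite h1 h2; ring.
Qed.

Lemma sin_le t : `|sin t| <= `|t|.
Proof.
wlog t0 : t / 0 <= t.
  move=> H; case: (leP 0 t) => [t0|/ltW t0]; first exact: (H t t0).
  rewrite -normrN -sinN -(normrN t); apply: H; by rewrite oppr_ge0.
case: (leP t 1) => [t1|/ltW t1]; last first.
  by rewrite (ger0_norm t0) (le_trans (sin_max _)).
have [->|tn0] := eqVneq t 0; first by rewrite sin0.
have tp : 0 < t by rewrite lt_neqAle eq_sym tn0.
have [|c _] := @MVT R (@sin R) (@cos R) 0 t tp (fun x _ => is_derive_sin x).
  by apply: continuous_subspaceT => x; exact: continuous_sin.
rewrite sin0 !subr0 => ->.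
by rewrite normrM ler_piMl// cos_max.
Qed.

(** The chord has length [2 |sin (pi (t - a))|]. *)
Lemma E_lip t a : normc (E t - E a) <= 2 * pi * `|t - a|.
Proof.
have p0 : 0 <= pi :> R by exact: pi_ge0.
rewrite -(@ler_pXn2r _ 2)// ?nnegrE ?nrm_ge0 ?mulr_ge0//.
rewrite nrm_EB; set u := t - a.
have -> : 2 * pi * u = (pi * u) *+ 2 by rewrite -[RHS]mulr_natl mulrA.
rewrite cos_mulr2n cos2sin2.
have -> : 2 - 2 * ((1 - sin (pi * u) ^+ 2) *+ 2 - 1) = (2 * `|sin (pi * u)|) ^+ 2.
  by rewrite exprMn real_normK ?num_real//; ring.
rewrite ler_pXn2r ?nnegrE ?mulr_ge0//.
rewrite -mulrA ler_pM2l//.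
by have := sin_le (pi * u); rewrite normrM (ger0_norm p0).
Qed.

Lemma sum_unity_root n (a : nat) : (0 < a < n)%N ->
  \sum_(s < n) E (a%:R * s%:R / n%:R) = 0.
Proof.
move=> /andP[a0 an].
have n0 : n%:R != 0 :> R by rewrite pnatr_eq0; lia.
set z := E (a%:R / n%:R).
have zn : z ^+ n = 1 by rewrite EX -(mulr_natr (a%:R / n%:R) n) divfK// Enat.
(* The chord satisfies [|z - 1|^2 = 4 sin^2 (pi a / n)], which is positive because [0 < a < n]. *)
have z1 : z != 1.
  apply/eqP => /(congr1 (fun z : R[i] => normc (z - 1))).
  rewrite subrr nrm0 => /(congr1 (fun x => x ^+ 2)).
  rewrite -E0 nrm_EB subr0 expr0n /= => /eqP.
  set v := a%:R / n%:R.
  have v0 : 0 < v by rewrite divr_gt0// ltr0n//; lia.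
  have v1 : v < 1 by rewrite ltr_pdivrMr ?mul1r ?ltr_nat// ltr0n; lia.
  have -> : 2 * pi * v = (pi * v) *+ 2 by rewrite -[RHS]mulr_natl mulrA.
  rewrite cos_mulr2n cos2sin2.
  have -> : 2 - 2 * ((1 - sin (pi * v) ^+ 2) *+ 2 - 1) = 4 * sin (pi * v) ^+ 2 by ring.
  rewrite mulf_eq0 pnatr_eq0 /= sqrf_eq0; apply/negP; rewrite gt_eqF// sin_gt0_pi//.
  by rewrite mulr_gt0 ?pi_gt0//= -[X in _ < X]mulr1 ltr_pM2l ?pi_gt0.
have := subrX1 z n; rewrite zn subrr => /esym/eqP.
rewrite mulf_eq0 subr_eq0 (negbTE z1) /= => /eqP h; rewrite -[RHS]h.
apply: eq_bigr => s _; rewrite EX; congr E.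
by rewrite -(mulr_natr (a%:R / n%:R) s) mulrAC.
Qed.

(** Both exponents are below [n], so the sum detects equality of exponents and not only congruence
    modulo [n]. *)
Lemma unity_orth n (a b : nat) : (a < n)%N -> (b < n)%N ->
  \sum_(s < n) (E (s%:R / n%:R) ^+ a * conjc (E (s%:R / n%:R) ^+ b)) =
  ((a == b)%:R *+ n : R[i]).
Proof.
have aux (a' b' : nat) (t : R) : (a' < b')%N ->
    E t ^+ b' * conjc (E t ^+ a') = E ((b' - a')%:R * t).
  move=> lt; rewrite -{1}(subnK (ltnW lt)) exprD -mulrA mulcJ nrmX nrmE !expr1n mulr1.
  by rewrite EX -(mulr_natl t).
move=> an bn; have [<-|] := eqVneq a b.
  under eq_bigr do rewrite mulcJ nrmX nrmE !expr1n.
  by rewrite sumr_const card_ord.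
rewrite neq_ltn mul0rn => /orP[ab|ba].
  rewrite -[LHS]conjcK rmorph_sum /=.
  under eq_bigr do rewrite rmorphM /= conjcK mulrC aux// mulrA.
  by rewrite sum_unity_root ?conjc0//; lia.
under eq_bigr do rewrite aux// mulrA.
by rewrite sum_unity_root//; lia.
Qed.
End ComplexNumbers.

(** * Shift-invariant means and their semi-inner product *)

Section MeanFunctionals.
Context {R : realType}.
Implicit Types (u v : nat -> R) (x y : nat -> R[i]).

Definition bounded_rseq u : Prop :=
  exists M : R, forall n, (0 < n)%N -> `|u n| <= M.

Lemma bdrD u v : bounded_rseq u -> bounded_rseq v ->
  bounded_rseq (fun n => u n + v n).
Proof.
move=> [M Mu] [N Nv]; exists (M + N) => n n0.
by rewrite (le_trans (ler_normD _ _))// lerD ?Mu ?Nv.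
Qed.
Lemma bdrM u v : bounded_rseq u -> bounded_rseq v ->
  bounded_rseq (fun n => u n * v n).
Proof.
move=> [M Mu] [N Nv]; exists (M * N) => n n0.
by rewrite normrM ler_pM ?Mu ?Nv.
Qed.
Lemma bdr_cst a : bounded_rseq (fun=> a).
Proof. by exists `|a|. Qed.
Lemma bdrZ a u : bounded_rseq u -> bounded_rseq (fun n => a * u n).
Proof. exact: (bdrM (bdr_cst a)). Qed.
Lemma bdrN u : bounded_rseq u -> bounded_rseq (fun n => - u n).
Proof. by move=> [M Mu]; exists M => n n0; rewrite normrN Mu. Qed.
Lemma bdrS u : bounded_rseq u -> bounded_rseq (fun n => u n.+1).
Proof. by move=> [M Mu]; exists M => n n0; exact: Mu. Qed.
Lemma bdr_sum (I : Type) (r : seq I) (P : pred I) (F : I -> nat -> R) :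
  (forall i, P i -> bounded_rseq (F i)) ->
  bounded_rseq (fun n => \sum_(i <- r | P i) F i n).
Proof.
move=> bF; elim: r => [|i r IH]; first by exists 0 => n _; rewrite big_nil normr0.
have [Pi|Pi] := boolP (P i); last first.
  by have -> : (fun n => \sum_(i <- i :: r | P i) F i n) =
    (fun n => \sum_(i <- r | P i) F i n)
    by apply/funext => n; rewrite big_cons (negbTE Pi).
have -> : (fun n => \sum_(i <- i :: r | P i) F i n) =
    (fun n => F i n + \sum_(i <- r | P i) F i n)
    by apply/funext => n; rewrite big_cons Pi.
by apply: bdrD => //; exact: bF.
Qed.

Lemma bdcD x y : bounded_cseq x -> bounded_cseq y ->
  bounded_cseq (fun n => x n + y n).
Proof.
move=> [M Mx] [N Ny]; exists (M + N) => n n0.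
by rewrite (le_trans (nrmD _ _))// lerD ?Mx ?Ny.
Qed.
Lemma bdcM x y : bounded_cseq x -> bounded_cseq y ->
  bounded_cseq (fun n => x n * y n).
Proof.
move=> [M Mx] [N Ny]; exists (M * N) => n n0.
by rewrite nrmM ler_pM ?nrm_ge0 ?Mx ?Ny.
Qed.
Lemma bdc_cst (a : R[i]) : bounded_cseq (fun=> a).
Proof. by exists (normc a). Qed.
Lemma bdcZ (a : R[i]) x : bounded_cseq x -> bounded_cseq (fun n => a * x n).
Proof. exact: (bdcM (bdc_cst a)). Qed.
Lemma bdcN x : bounded_cseq x -> bounded_cseq (fun n => - x n).
Proof. by move=> [M Mu]; exists M => n n0; rewrite nrmN Mu. Qed.
Lemma bdcB x y : bounded_cseq x -> bounded_cseq y ->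
  bounded_cseq (fun n => x n - y n).
Proof. by move=> hx /bdcN; exact: bdcD. Qed.
Lemma bdcJ x : bounded_cseq x -> bounded_cseq (fun n => conjc (x n)).
Proof. by move=> [M Mu]; exists M => n n0; rewrite nrmJ Mu. Qed.
Lemma bdc_shift k x : bounded_cseq x -> bounded_cseq (fun n => x (n + k)%N).
Proof. by move=> [M Mu]; exists M => n n0; apply: Mu; rewrite ltn_addr. Qed.
Lemma bdc_sum (I : Type) (r : seq I) (P : pred I) (F : I -> nat -> R[i]) :
  (forall i, P i -> bounded_cseq (F i)) ->
  bounded_cseq (fun n => \sum_(i <- r | P i) F i n).
Proof.
move=> bF; elim: r => [|i r IH]; first by exists 0 => n _; rewrite big_nil nrm0.
have [Pi|Pi] := boolP (P i); last first.
  by have -> : (fun n => \sum_(i <- i :: r | P i) F i n) =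
    (fun n => \sum_(i <- r | P i) F i n)
    by apply/funext => n; rewrite big_cons (negbTE Pi).
have -> : (fun n => \sum_(i <- i :: r | P i) F i n) =
    (fun n => F i n + \sum_(i <- r | P i) F i n)
    by apply/funext => n; rewrite big_cons Pi.
by apply: bdcD => //; exact: bF.
Qed.
Lemma bdr_Re x : bounded_cseq x -> bounded_rseq (fun n => Re (x n)).
Proof. by move=> [M Mx]; exists M => n n0; rewrite (le_trans (cRe_nrm _)) ?Mx. Qed.
Lemma bdr_Im x : bounded_cseq x -> bounded_rseq (fun n => Im (x n)).
Proof. by move=> [M Mx]; exists M => n n0; rewrite (le_trans (cIm_nrm _)) ?Mx. Qed.
Lemma bdr_nrm x : bounded_cseq x -> bounded_rseq (fun n => normc (x n)).
Proof. by move=> [M Mx]; exists M => n n0; rewrite ger0_norm ?nrm_ge0 ?Mx. Qed.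

(** The axioms of a Banach limit, imposed on bounded sequences. *)
Record mean (L : (nat -> R) -> R) : Prop := Mean {
  meanD : forall u v, bounded_rseq u -> bounded_rseq v ->
    L (fun n => u n + v n) = L u + L v;
  meanZ : forall a u, bounded_rseq u -> L (fun n => a * u n) = a * L u;
  mean_ge0 : forall u, bounded_rseq u -> (forall n, (0 < n)%N -> 0 <= u n) ->
    0 <= L u;
  mean1 : L (fun=> 1) = 1;
  meanS : forall u, bounded_rseq u -> L (fun n => u n.+1) = L u }.

Variable L : (nat -> R) -> R.
Hypothesis mL : mean L.

Lemma meanN u : bounded_rseq u -> L (fun n => - u n) = - L u.
Proof.
move=> bu; have -> : (fun n => - u n) = (fun n => -1 * u n).
  by apply/funext => n; rewrite mulN1r.
by rewrite meanZ// mulN1r.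
Qed.
Lemma mean_le u v : bounded_rseq u -> bounded_rseq v ->
  (forall n, (0 < n)%N -> u n <= v n) -> L u <= L v.
Proof.
move=> bu bv uv; rewrite -subr_ge0 -meanN// -meanD//; last exact: bdrN.
apply: mean_ge0 => //; first exact: bdrD (bdrN _).
by move=> n n0; rewrite subr_ge0 uv.
Qed.
Lemma mean_cst a : L (fun=> a) = a.
Proof.
have -> : (fun=> a) = (fun _ : nat => a * 1) by apply/funext => n; rewrite mulr1.
by rewrite meanZ ?mean1 ?mulr1//; exact: bdr_cst.
Qed.
Lemma mean_sum (I : Type) (r : seq I) (P : pred I) (F : I -> nat -> R) :
  (forall i, P i -> bounded_rseq (F i)) ->
  L (fun n => \sum_(i <- r | P i) F i n) = \sum_(i <- r | P i) L (F i).
Proof.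
move=> bF; elim: r => [|i r IH].
  by rewrite big_nil -[RHS](mean_cst 0); congr L; apply/funext => n; rewrite big_nil.
rewrite big_cons; have [Pi|Pi] := boolP (P i); last first.
  by rewrite -IH; congr L; apply/funext => n; rewrite big_cons (negbTE Pi).
rewrite -IH -(meanD mL (bF _ Pi) (bdr_sum _ bF)).
by congr L; apply/funext => n; rewrite big_cons Pi.
Qed.
Lemma mean_shift k u : bounded_rseq u -> L (fun n => u (n + k)%N) = L u.
Proof.
elim: k u => [|k IH] u bu; first by congr L; apply/funext => n; rewrite addn0.
rewrite -(meanS mL bu) -(IH _ (bdrS bu)).
by congr L; apply/funext => n; rewrite addnS.
Qed.

Definition cmean x : R[i] := Complex (L (fun n => Re (x n))) (L (fun n => Im (x n))).

Lemma cmeanD x y : bounded_cseq x -> bounded_cseq y ->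
  cmean (fun n => x n + y n) = cmean x + cmean y.
Proof.
move=> bx bY; apply: cplxP; rewrite ?cReD ?cImD /=.
  by rewrite -(meanD mL (bdr_Re bx) (bdr_Re bY)); congr L; apply/funext => n; rewrite cReD.
by rewrite -(meanD mL (bdr_Im bx) (bdr_Im bY)); congr L; apply/funext => n; rewrite cImD.
Qed.
Lemma cmeanZ (a : R[i]) x : bounded_cseq x -> cmean (fun n => a * x n) = a * cmean x.
Proof.
move=> bx; have br := bdr_Re bx; have bi := bdr_Im bx.
apply: cplxP; [rewrite [RHS]cReM /=|rewrite [RHS]cImM /=].
  rewrite -(meanZ mL _ br) -(meanZ mL _ bi) -(meanN (bdrZ _ bi)).
  rewrite -(meanD mL (bdrZ _ br) (bdrN (bdrZ _ bi))).
  by congr L; apply/funext => n; rewrite cReM.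
rewrite -(meanZ mL _ br) -(meanZ mL _ bi) -(meanD mL (bdrZ _ bi) (bdrZ _ br)).
by congr L; apply/funext => n; rewrite cImM.
Qed.
Lemma cmeanN x : bounded_cseq x -> cmean (fun n => - x n) = - cmean x.
Proof.
move=> bx; have -> : (fun n => - x n) = (fun n => -1 * x n).
  by apply/funext => n; rewrite mulN1r.
by rewrite cmeanZ// mulN1r.
Qed.
Lemma cmeanB x y : bounded_cseq x -> bounded_cseq y ->
  cmean (fun n => x n - y n) = cmean x - cmean y.
Proof. by move=> bx bY; rewrite cmeanD ?cmeanN//; exact: bdcN. Qed.
Lemma cmeanJ x : bounded_cseq x -> cmean (fun n => conjc (x n)) = conjc (cmean x).
Proof.
move=> bx; apply: cplxP; rewrite ?cReJ ?cImJ /=.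
  by congr L; apply/funext => n; rewrite cReJ.
by rewrite -(meanN (bdr_Im bx)); congr L; apply/funext => n; rewrite cImJ.
Qed.
Lemma cmean_shift k x : bounded_cseq x -> cmean (fun n => x (n + k)%N) = cmean x.
Proof.
move=> bx; apply: cplxP => /=.
  by rewrite (mean_shift k (bdr_Re bx)).
by rewrite (mean_shift k (bdr_Im bx)).
Qed.
Lemma cmean_sum (I : Type) (r : seq I) (P : pred I) (F : I -> nat -> R[i]) :
  (forall i, P i -> bounded_cseq (F i)) ->
  cmean (fun n => \sum_(i <- r | P i) F i n) = \sum_(i <- r | P i) cmean (F i).
Proof.
move=> bF; apply: cplxP; rewrite ?cRe_sum ?cIm_sum /=.
  rewrite -mean_sum; last by move=> i Pi; exact/bdr_Re/bF.
  by congr L; apply/funext => n; rewrite cRe_sum.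
rewrite -mean_sum; last by move=> i Pi; exact/bdr_Im/bF.
by congr L; apply/funext => n; rewrite cIm_sum.
Qed.
Lemma cmean_real u : cmean (fun n => (u n)%:C%C) = (L u)%:C%C.
Proof. by apply: cplxP => //=; rewrite mean_cst. Qed.
Lemma nrm_cmean x : bounded_cseq x -> normc (cmean x) <= L (fun n => normc (x n)).
Proof.
move=> bx; have [w w1 <-] := rotate_Re (cmean x).
rewrite -cmeanZ//= mean_le//; first exact/bdr_Re/bdcZ.
  exact: bdr_nrm.
by move=> n n0; rewrite (le_trans (cRe_le_nrm _))// nrmM w1 mul1r.
Qed.

Arguments cmean : simpl never.

(** A semi-inner product for which the shift is an isometry ([ip_shift]), so that Hilbert space
    arguments apply without quotient or completion. *)
Definition ip x y : R[i] := cmean (fun n => x n * conjc (y n)).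

Arguments ip : simpl never.

Lemma bd_ip x y : bounded_cseq x -> bounded_cseq y ->
  bounded_cseq (fun n => x n * conjc (y n)).
Proof. by move=> bx /bdcJ; exact: bdcM. Qed.

Lemma ipC x y : bounded_cseq x -> bounded_cseq y -> ip y x = conjc (ip x y).
Proof.
move=> bx bY; rewrite /ip -cmeanJ; last exact: bd_ip.
by congr cmean; apply/funext => n; rewrite rmorphM /= conjcK mulrC.
Qed.
Lemma ip_shift k x y : bounded_cseq x -> bounded_cseq y ->
  ip (fun n => x (n + k)%N) (fun n => y (n + k)%N) = ip x y.
Proof.
by move=> bx bY; rewrite /ip (cmean_shift k (x := fun n => x n * conjc (y n)))//; exact: bd_ip.
Qed.
Lemma ip_suml (I : Type) (r : seq I) (a : I -> R[i]) (F : I -> nat -> R[i]) y :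
  (forall i, bounded_cseq (F i)) -> bounded_cseq y ->
  ip (fun n => \sum_(i <- r) a i * F i n) y = \sum_(i <- r) a i * ip (F i) y.
Proof.
move=> bF bY; rewrite /ip.
under [RHS]eq_bigr => i _ do rewrite -(cmeanZ _ (bd_ip (bF i) bY)).
rewrite -cmean_sum; last by move=> i _; exact/bdcZ/bd_ip.
by congr cmean; apply/funext => n; rewrite mulr_suml; apply: eq_bigr => i _; rewrite mulrA.
Qed.
Lemma ip_sumr (I : Type) (r : seq I) (a : I -> R[i]) (F : I -> nat -> R[i]) y :
  (forall i, bounded_cseq (F i)) -> bounded_cseq y ->
  ip y (fun n => \sum_(i <- r) a i * F i n) = \sum_(i <- r) conjc (a i) * ip y (F i).
Proof.
move=> bF bY; rewrite ipC//; last by apply: bdc_sum => i _; exact: bdcZ.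
rewrite ip_suml// rmorph_sum; apply: eq_bigr => i _.
by rewrite rmorphM; congr (_ * _); apply/esym/ipC.
Qed.
Definition sqn x : R := L (fun n => normc (x n) ^+ 2).
Lemma ip_sqn x : ip x x = (sqn x)%:C%C.
Proof. by rewrite -cmean_real; congr cmean; apply/funext => n; rewrite mulcJ. Qed.
Lemma bdr_sqn x : bounded_cseq x -> bounded_rseq (fun n => normc (x n) ^+ 2).
Proof.
move=> bx; have -> : (fun n => normc (x n) ^+ 2) = (fun n => normc (x n) * normc (x n)).
  by apply/funext => n; rewrite expr2.
by apply: bdrM; exact: bdr_nrm.
Qed.
Lemma sqn_ge0 x : bounded_cseq x -> 0 <= sqn x.
Proof. by move=> bx; apply: mean_ge0 => //; [exact: bdr_sqn|move=> n _; rewrite sqr_ge0]. Qed.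

Lemma sqn_shift k x : bounded_cseq x -> sqn (fun n => x (n + k)%N) = sqn x.
Proof. by move=> bx; exact: (mean_shift k (bdr_sqn bx)). Qed.

Lemma ipBr x y z : bounded_cseq x -> bounded_cseq y -> bounded_cseq z ->
  ip z (fun n => x n - y n) = ip z x - ip z y.
Proof.
move=> bx bY bz; rewrite /ip -cmeanB; [|exact: bd_ip..].
by congr cmean; apply/funext => n; rewrite conjcB mulrBr.
Qed.

(** With [c] the inner product, the squared norm of [x - s c y] is a nonnegative quadratic in the
    real number [s]; the generic choice is [s = 1 / sqn y]. *)
Lemma cauchy_schwarz x y : bounded_cseq x -> bounded_cseq y ->
  normc (ip x y) ^+ 2 <= sqn x * sqn y.
Proof.
move=> bx bY; set c := ip x y.
have key (s : R) : 0 <= sqn x - 2 * s * normc c ^+ 2 + s ^+ 2 * normc c ^+ 2 * sqn y.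
  set a := (s%:C%C * c : R[i]).
  have bz : bounded_cseq (fun n => x n - a * y n) by apply: bdcB => //; exact: bdcZ.
  have := sqn_ge0 bz; rewrite -[sqn _]cReC -ip_sqn.
  suff -> : ip (fun n => x n - a * y n) (fun n => x n - a * y n) =
     ip x x - conjc a * c - a * conjc c + a * conjc a * ip y y.
    have aa : a * conjc a = (s ^+ 2 * normc c ^+ 2)%:C%C.
      by rewrite mulcJ nrmM nrmC exprMn real_normK ?num_real.
    have ac : a * conjc c = (s * normc c ^+ 2)%:C%C.
      by rewrite -mulrA mulcJ -rmorphM.
    have ca : conjc a * c = (s * normc c ^+ 2)%:C%C.
      by rewrite -[LHS]conjcK conjcM conjcK ac conjc_real.
    rewrite !ip_sqn aa ac ca cReD !cReB cReMC !cReC.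
    by move=> h; apply: (le_trans h); rewrite le_eqVlt; apply/orP; left; apply/eqP; ring.
  have -> : ip (fun n => x n - a * y n) (fun n => x n - a * y n) =
     cmean (fun n => x n * conjc (x n) + - conjc a * (x n * conjc (y n))
      + - a * (y n * conjc (x n)) + a * conjc a * (y n * conjc (y n))).
    congr cmean; apply/funext => n; rewrite rmorphB rmorphM /=; ring.
  have bip := bd_ip.
  rewrite !cmeanD ?cmeanZ//; do ?[exact: bd_ip|apply: bdcZ|apply: bdcD].
  by rewrite -!/(ip _ _) (ipC bx bY) -/c !mulNr.
have [y0|yn0] := eqVneq (sqn y) 0.
  have [c0|cn0] := eqVneq (normc c ^+ 2) 0; first by rewrite c0 y0 mulr0.
  (* If [sqn y] vanishes, the quadratic is affine in [s], and this [s] would give it the value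
     [-1]. *)
  have := key ((sqn x + 1) / (2 * normc c ^+ 2)).
  rewrite y0 mulr0 addr0.
  move: cn0; move: (normc c ^+ 2) => n2 n20.
  have -> : 2 * ((sqn x + 1) / (2 * n2)) * n2 = sqn x + 1 by field.
  by rewrite opprD addrA subrr sub0r oppr_ge0 ler10.
have y0 : 0 < sqn y by rewrite lt_neqAle eq_sym yn0 sqn_ge0.
have := key (sqn y)^-1.
have -> : sqn x - 2 * (sqn y)^-1 * normc c ^+ 2 + (sqn y)^-1 ^+ 2 * normc c ^+ 2 * sqn y =
   sqn x - normc c ^+ 2 / sqn y by field; rewrite gt_eqF.
by rewrite subr_ge0 ler_pdivrMr.
Qed.

(* A Toeplitz form [sum A i j <U^i x, U^j x>] is nonnegative as soon as its
   symbol is: testing the symbol at the roots of unity of order [D + M] against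
   the squared modulus of a twisted sum of length [M] recovers the form up to
   boundary terms of relative size [D / M]. *)
Lemma toeplitz_ge0 (D : nat) (A : nat -> nat -> R[i]) x : bounded_cseq x ->
  (forall t, 0 <= Re (\sum_(i < D) \sum_(j < D) A i j * (E t ^+ i * conjc (E t ^+ j)))) ->
  0 <= Re (\sum_(i < D) \sum_(j < D)
     A i j * ip (fun n => x (n + i)%N) (fun n => x (n + j)%N)).
Proof.
move=> bx A0; set S := (X in 0 <= Re X).
pose g i j := ip (fun n => x (n + i)%N) (fun n => x (n + j)%N).
pose B := \sum_(i < D) \sum_(j < D) normc (A i j * g i j).
have bsh i : bounded_cseq (fun n => x (n + i)%N) by exact: bdc_shift.
have gsh (i j m m' : nat) : (i + m')%N = (j + m)%N -> g m m' = g i j.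
  move=> e; have shift a b k : g (a + k)%N (b + k)%N = g a b.
    rewrite /g -(ip_shift k (bsh a) (bsh b)); congr ip; apply/funext => n;
    by congr x; rewrite -!addnA [(_ + k)%N]addnC.
  rewrite -(shift m m' i) -(shift i j m) [(m + i)%N]addnC.
  by rewrite [(m' + i)%N]addnC e.
pose cnt (M i j : nat) := (\sum_(m < M) \sum_(m' < M) (i + m' == j + m)%N)%N.
have main M : 0 <= Re (\sum_(i < D) \sum_(j < D) (cnt M i j)%:R * (A i j * g i j)).
  (* [N] exceeds every [i + m'] and [j + m], so that orthogonality at the roots of unity selects
     [i + m' = j + m] exactly. *)
  pose N := (D + M)%N.
  case: (posnP N) => N0.
    by rewrite big1// => i _; have := ltn_ord i; rewrite /N in N0; lia.
  pose w (s : nat) : R[i] := E (s%:R / N%:R).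
  pose T n s := \sum_(m < M) conjc (w s ^+ m) * x (n + m)%N.
  pose P (n : nat) := \sum_(s < N) (\sum_(i < D) \sum_(j < D) A i j * (w s ^+ i * conjc (w s ^+ j)))
         * (T n s * conjc (T n s)).
  have P0 n : 0 <= Re (P n).
    rewrite /P cRe_sum sumr_ge0// => s _.
    by rewrite mulcJ mulrC cReMC mulr_ge0 ?sqr_ge0//; exact: A0.
  have PE n : P n = N%:R * \sum_(i < D) \sum_(j < D) \sum_(m < M) \sum_(m' < M)
      ((i + m' == j + m)%N%:R * A i j) * (x (n + m)%N * conjc (x (n + m')%N)).
    rewrite /P; under eq_bigr => s _.
      rewrite mulr_suml; under eq_bigr => i _.
        rewrite mulr_suml; under eq_bigr => j _.
          rewrite /T conjc_sum mulr_suml mulr_sumr.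
          under eq_bigr => m _ do rewrite mulr_sumr mulr_sumr.
          over.
        over.
      over.
    rewrite exchange_big mulr_sumr; apply: eq_bigr => i _.
    rewrite exchange_big mulr_sumr; apply: eq_bigr => j _.
    rewrite exchange_big mulr_sumr; apply: eq_bigr => m _.
    rewrite exchange_big mulr_sumr; apply: eq_bigr => m' _.
    transitivity ((\sum_(s < N) w s ^+ (i + m') * conjc (w s ^+ (j + m))) *
      (A i j * (x (n + m)%N * conjc (x (n + m')%N)))).
      rewrite mulr_suml; apply: eq_bigr => s _.
      by rewrite !conjcM conjcK !exprD !conjcM; ring.
    rewrite unity_orth; last 2 first.
    - by have := ltn_ord i; have := ltn_ord m'; rewrite /N; lia.
    - by have := ltn_ord j; have := ltn_ord m; rewrite /N; lia.
    by rewrite -(mulr_natl (_ == _)%:R N) -!mulrA.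
  have bP : bounded_cseq P.
    rewrite /P; apply: bdc_sum => s _; apply: bdcZ.
    have bT : bounded_cseq (fun n => T n s) by apply: bdc_sum => m _; exact: bdcZ.
    exact: bd_ip.
  have : 0 <= Re (cmean P) by apply: mean_ge0 => //; exact: bdr_Re.
  have -> : cmean P = N%:R * \sum_(i < D) \sum_(j < D) (cnt M i j)%:R * (A i j * g i j).
    have -> : P = fun n => N%:R * \sum_(i < D) \sum_(j < D) \sum_(m < M) \sum_(m' < M)
      ((i + m' == j + m)%N%:R * A i j) * (x (n + m)%N * conjc (x (n + m')%N)).
      by apply/funext => n; rewrite PE.
    have b4 i j m m' : bounded_cseq (fun n => ((i + m' == j + m)%N%:R * A i j) *
      (x (n + m)%N * conjc (x (n + m')%N))) by apply: bdcZ; exact: bd_ip.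
    have b3 i j m : bounded_cseq (fun n => \sum_(m' < M) ((i + m' == j + m)%N%:R * A i j) *
      (x (n + m)%N * conjc (x (n + m')%N))) by apply: bdc_sum.
    have b2 i j : bounded_cseq (fun n => \sum_(m < M) \sum_(m' < M) ((i + m' == j + m)%N%:R * A i j) *
      (x (n + m)%N * conjc (x (n + m')%N))) by apply: bdc_sum.
    have b1 i : bounded_cseq (fun n => \sum_(j < D) \sum_(m < M) \sum_(m' < M) ((i + m' == j + m)%N%:R * A i j) *
      (x (n + m)%N * conjc (x (n + m')%N))) by apply: bdc_sum.
    rewrite cmeanZ; last by apply: bdc_sum.
    congr (_ * _); rewrite cmean_sum//; apply: eq_bigr => i _.
    rewrite cmean_sum//; apply: eq_bigr => j _.
    rewrite cmean_sum// natr_sum mulr_suml; apply: eq_bigr => m _.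
    rewrite cmean_sum// natr_sum mulr_suml; apply: eq_bigr => m' _.
    rewrite cmeanZ; last exact: bd_ip.
    rewrite -/(ip _ _) -/(g m m'); case: eqP => [e|_]; last by rewrite !mul0r.
    by rewrite (gsh i j m m' e) !mul1r.
  by rewrite -[N%:R](rmorph_nat (real_complex R)) cReMC pmulr_rge0// ltr0n.
(* For given [m] there is at most one [m'], and there is one unless [m] lies within [D] of an end of
   the range. *)
have cntlb M (i j : 'I_D) : (cnt M i j <= M)%N && (M <= cnt M i j + D.*2)%N.
  have h (m : 'I_M) : (\sum_(m' < M) (i + m' == j + m)%N = (i <= j + m < i + M)%N)%N.
    have [/andP[h1 h2]|h] := boolP (i <= j + m < i + M)%N.
      have lt : (j + m - i < M)%N by lia.
      rewrite (bigD1 (Ordinal lt)) //= big1 ?addn0; first by rewrite subnKC// eqxx.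
      by move=> k kn; case: eqP => // e; case/eqP: kn; apply: val_inj => /=; lia.
    by rewrite big1// => k _; case: eqP => // e; have := ltn_ord k; lia.
  rewrite /cnt (eq_bigr _ (fun m _ => h m)).
  have := ltn_ord i; have := ltn_ord j => ltj lti.
  apply/andP; split.
    rewrite -[X in (_ <= X)%N]card_ord -sum1_card; apply: leq_sum => m _; exact: leq_b1.
  have [|lt] := leqP M (i + j); first by lia.
  rewrite -(big_mkord xpredT (fun m => nat_of_bool (i <= j + m < i + M)%N)).
  rewrite (big_cat_nat (n := i)) //=; last by lia.
  rewrite (big_cat_nat (m := i) (n := (M - j)%N)) //=; [|lia|lia].
  suff : (M - j - i <= \sum_(i <= m < M - j) (i <= j + m < i + M))%N by lia.
  rewrite -[X in (X <= _)%N]muln1 -sum_nat_const_nat big_nat [X in (_ <= X)%N]big_nat.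
  by apply: leq_sum => m /andP[h1 h2]; rewrite lt0b; lia.
(* A lower bound for [M * Re S] that does not depend on [M] forces [Re S] to be nonnegative. *)
have SE M : - ((D.*2)%:R * B) <= M%:R * Re S.
  have := main M; set S' := (X in 0 <= Re X) => S'0.
  suff : Re S' - M%:R * Re S <= (D.*2)%:R * B by lra.
  have <- : Re (M%:R * S) = M%:R * Re S.
    by rewrite -[M%:R in LHS](rmorph_nat (real_complex R)) cReMC.
  rewrite -cReB (le_trans (cRe_le_nrm _))// /S' /S mulr_sumr -sumrB /B mulr_sumr.
  rewrite (le_trans (nrm_sum _ _ _))// ler_sum// => i _.
  rewrite mulr_sumr -sumrB mulr_sumr.
  rewrite (le_trans (nrm_sum _ _ _))// ler_sum// => j _.
  have /andP[c1 c2] := cntlb M i j.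
  rewrite -/(g i j) -mulrBl [X in X <= _]nrmM; apply: ler_wpM2r; first exact: nrm_ge0.
  by rewrite nrmBC -natrB// nrm_nat ler_nat; lia.
have [//|neg] := leP 0 (Re S).
have Bge : 0 <= (D.*2)%:R * B.
  by rewrite mulr_ge0// /B sumr_ge0// => i _; rewrite sumr_ge0// => j _; exact: nrm_ge0.
have := SE (Num.truncn ((D.*2)%:R * B / - Re S)).+1.
have := truncnS_gt ((D.*2)%:R * B / - Re S).
rewrite ltr_pdivrMr ?oppr_gt0// mulrN => h1 h2.
by move: (lt_le_trans h1 (lexx _)); lra.
Qed.
End MeanFunctionals.

(** * Averages, their behaviour under shifts, and ultrafilter limits *)

Section Averages.
Context {R : realType}.
Implicit Types (u v : nat -> R) (x y : nat -> R[i]) (Nq : nat -> nat).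

Lemma cvg_complex (T : Type) (F : set_system T) {FF : Filter F} (g : T -> R[i]) (l : R[i]) :
  ((g : T -> R[i]^o) @ F --> (l : R[i]^o)) <->
  ((fun t => Re (g t)) @ F --> Re l) /\ ((fun t => Im (g t)) @ F --> Im l).
Proof.
have nE (z : R[i]) (e : R) : (`|(z : R[i]^o)| < (e%:C)%C) = (normc z < e).
  by rewrite -ltcR; case: z.
split => [/cvgrPdist_lt h|[/cvgrPdist_lt hr /cvgrPdist_lt hi]].
  split; apply/cvgrPdist_lt => e e0;
    (have e0' : 0 < (e%:C)%C :> R[i] by rewrite ltcR);
    apply: filterS (h _ e0') => t; rewrite nE; apply: le_lt_trans.
    by rewrite -cReB cRe_nrm.
  by rewrite -cImB cIm_nrm.
apply/cvgrPdist_lt => e0 e00.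
have [e e0E] : exists e : R, e0 = (e%:C)%C.
  by exists (Re e0); move: e00; rewrite ltcE => /andP[/eqP h _]; apply: cplxP.
move: e00; rewrite e0E ltcR => e_gt0 {e0 e0E}.
have e2 : 0 < e / 2 by rewrite divr_gt0.
apply: filterS2 (hr _ e2) (hi _ e2) => t h1 h2; rewrite nE.
rewrite (le_lt_trans (nrm_ReIm _))// cReB cImB.
by rewrite [e]splitr ltrD.
Qed.

Lemma cvg_nrm (T : Type) (F : set_system T) {FF : Filter F} (g : T -> R[i]) (l : R[i]) :
  ((g : T -> R[i]^o) @ F --> (l : R[i]^o)) ->
  (fun t => normc (g t)) @ F --> normc l.
Proof.
have nE (z : R[i]) (e : R) : (`|(z : R[i]^o)| < (e%:C)%C) = (normc z < e).
  by rewrite -ltcR; case: z.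
move=> /cvgrPdist_lt h; apply/cvgrPdist_lt => e e0.
have e0' : 0 < (e%:C)%C :> R[i] by rewrite ltcR.
apply: filterS (h _ e0') => t; rewrite nE; apply: le_lt_trans.
rewrite ler_norml; apply/andP; split.
  by rewrite lerBrDl lerBlDl nrmBC (le_trans _ (nrmD _ _))// subrK.
by rewrite lerBlDl addrC (le_trans _ (nrmD _ _))// subrK.
Qed.

Lemma invc_nat N : (N%:R : R[i])^-1 = ((N%:R)^-1)%:C%C.
Proof. by rewrite fmorphV rmorph_nat. Qed.
Lemma Re_average N x : Re (average N x) = average N (fun n => Re (x n)).
Proof. by rewrite /average invc_nat mulrC cReMC cRe_sum mulrC. Qed.
Lemma Im_average N x : Im (average N x) = average N (fun n => Im (x n)).
Proof. by rewrite /average invc_nat mulrC cImMC cIm_sum mulrC. Qed.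

Lemma averageD (F : fieldType) N (u v : nat -> F) : average N (fun n => u n + v n) = average N u + average N v.
Proof. by rewrite /average big_split mulrDl. Qed.
Lemma averageZ (F : fieldType) N (a : F) (u : nat -> F) : average N (fun n => a * u n) = a * average N u.
Proof. by rewrite /average -mulr_sumr mulrA. Qed.
Lemma averageN (F : fieldType) N (u : nat -> F) : average N (fun n => - u n) = - average N u.
Proof. by rewrite /average sumrN mulNr. Qed.
Lemma averageB (F : fieldType) N (u v : nat -> F) :
  average N (fun n => u n - v n) = average N u - average N v.
Proof. by rewrite averageD averageN. Qed.
Lemma average_sum (F : fieldType) N (I : Type) (r : seq I) (u : I -> nat -> F) :
  average N (fun n => \sum_(i <- r) u i n) = \sum_(i <- r) average N (u i).
Proof. by rewrite /average exchange_big /= mulr_suml. Qed.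
Lemma average_realC N u : average N (fun n => (u n)%:C%C) = (average N u)%:C%C.
Proof. by apply: cplxP; [rewrite Re_average|rewrite Im_average /average big1 ?mul0r]. Qed.
Lemma average_le N u v : (forall n, (0 < n)%N -> u n <= v n) -> average N u <= average N v.
Proof.
move=> uv; rewrite /average ler_wpM2r ?invr_ge0//.
rewrite big_nat [leRHS]big_nat.
by apply: ler_sum => n /andP[n0 _]; exact: uv.
Qed.
Lemma average_eq (F : fieldType) N (u v : nat -> F) : (forall n, (0 < n)%N -> u n = v n) -> average N u = average N v.
Proof.
move=> uv; congr (_ / _); rewrite big_nat [RHS]big_nat.
by apply: eq_bigr => n /andP[n0 _]; exact: uv.
Qed.
Lemma average_cst N a : (0 < N)%N -> average N (fun=> a : R) = a.
Proof.
move=> N0; rewrite /average sumr_const_nat subn1 -(mulr_natr a) mulfK//.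
by rewrite pnatr_eq0 -lt0n.
Qed.
Lemma average_bound N u (M : R) : 0 <= M -> (forall n, (0 < n)%N -> `|u n| <= M) ->
  `|average N u| <= M.
Proof.
move=> M0 uM; case: (posnP N) => [->|N0].
  by rewrite /average big_geq// mul0r normr0.
rewrite ler_norml -{2}(average_cst M N0) -(average_cst (- M) N0).
by apply/andP; split; apply: average_le => n n0; have := uM n n0; rewrite ler_norml => /andP[].
Qed.

(** Each unit shift exchanges one boundary term for another, at a cost of at most [2 * M / N]. *)
Lemma average_shift_bound N k u (M : R) : (forall n, (0 < n)%N -> `|u n| <= M) ->
  `|average N (fun n => u (n + k)%N) - average N u| <= (k.*2)%:R * M / N%:R.
Proof.
move=> uM; elim: k => [|k IH].
  rewrite !mul0r /average; under eq_bigr do rewrite addn0.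
  by rewrite subrr normr0.
have M0 : 0 <= M by apply: le_trans (uM 1%N isT); exact: normr_ge0.
have -> : average N (fun n => u (n + k.+1)%N) - average N u =
   (average N (fun n => u (n + k)%N) - average N u) + (u (N.+1 + k)%N - u k.+1) / N%:R.
  rewrite /average -!mulrBl -mulrDl; congr (_ / _).
  have -> : \sum_(1 <= n < N.+1) u (n + k.+1)%N = \sum_(1 <= n < N.+1) u (n + k)%N + (u (N.+1 + k)%N - u k.+1).
    under eq_bigr do rewrite -addSnnS.
    rewrite -(big_add1 _ _ 1 N.+2 predT (fun n => u (n + k)%N)) /=.
    have e1 : \sum_(1 <= n < N.+2) u (n + k)%N = \sum_(1 <= n < N.+1) u (n + k)%N + u (N.+1 + k)%N.
      by rewrite big_nat_recr.
    have e2 : \sum_(1 <= n < N.+2) u (n + k)%N = u k.+1 + \sum_(2 <= n < N.+2) u (n + k)%N.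
      by rewrite big_ltn// add1n.
    by rewrite addrA -e1 e2; ring.
  ring.
rewrite (le_trans (ler_normD _ _))//.
have -> : ((k.+1).*2)%:R * M / N%:R = (k.*2)%:R * M / N%:R + 2 * M / N%:R.
  by rewrite -!mulrDl -natrD addn2 doubleS.
rewrite lerD// normrM normfV normr_nat ler_wpM2r ?invr_ge0//.
rewrite mulr2n mulrDl mul1r (le_trans (ler_normB _ _))//.
by rewrite lerD ?uM.
Qed.

Lemma pos_increasing_ge Nq : pos_increasing Nq -> forall q, (0 < q)%N -> (q <= Nq q)%N.
Proof.
move=> [pos inc]; elim=> // -[_ _|q IH _]; first exact: pos.
by apply: leq_ltn_trans (IH _) (inc _ _ _ _).
Qed.

Lemma pos_increasing_inv Nq : pos_increasing Nq ->
  (fun q => ((Nq q)%:R^-1 : R)) @ \oo --> 0.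
Proof.
move=> hN; apply/cvgrPdist_lt => e e0.
near=> q; rewrite sub0r normrN normfV normr_nat.
have q0 : (0 < q)%N by near: q; exact: nbhs_infty_gt.
have qN := pos_increasing_ge hN q0.
have : e^-1 < q%:R by near: q; exact: nbhs_infty_gtr.
move=> h; rewrite -[e]invrK ltf_pV2 ?posrE ?invr_gt0// ?ltr0n; last first.
  exact: leq_trans qN.
by rewrite (lt_le_trans h)// ler_nat.
Unshelve. all: by end_near. Qed.

Lemma average_shift_cvg Nq k u (l : R) : pos_increasing Nq -> bounded_rseq u ->
  (fun q => average (Nq q) u) @ \oo --> l ->
  (fun q => average (Nq q) (fun n => u (n + k)%N)) @ \oo --> l.
Proof.
move=> hN [M uM] ul.
have -> : (fun q => average (Nq q) (fun n => u (n + k)%N)) =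
  (fun q => average (Nq q) u + (average (Nq q) (fun n => u (n + k)%N) - average (Nq q) u)).
  by apply/funext => q; rewrite subrKC.
rewrite -[l]addr0; apply: cvgD => //.
apply/norm_cvg0P; apply: (@squeeze_cvgr _ _ _ _ (fun=> 0) (fun q => (k.*2)%:R * M * (Nq q)%:R^-1)).
- by near=> q; rewrite normr_ge0 /= average_shift_bound.
- exact: cvg_cst.
- by rewrite -[X in _ --> X](mulr0 ((k.*2)%:R * M)); apply: cvgMr; exact: pos_increasing_inv.
Unshelve. all: by end_near. Qed.

Lemma caverage_shift_cvg Nq k x (l : R[i]) : pos_increasing Nq -> bounded_cseq x ->
  (fun q => average (Nq q) x : R[i]^o) @ \oo --> (l : R[i]^o) ->
  (fun q => average (Nq q) (fun n => x (n + k)%N) : R[i]^o) @ \oo --> (l : R[i]^o).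
Proof.
move=> hN bx /cvg_complex[hr hi]; apply/cvg_complex; split.
  under eq_fun do rewrite Re_average; apply: (@average_shift_cvg Nq k (fun n => Re (x n))) => //.
    exact: bdr_Re.
  by under eq_fun do rewrite -Re_average.
under eq_fun do rewrite Im_average; apply: (@average_shift_cvg Nq k (fun n => Im (x n))) => //.
  exact: bdr_Im.
by under eq_fun do rewrite -Im_average.
Qed.

(** The last clause brings a lower bound on [L u] back to averages at arbitrarily late indices; the
    construction of large blocks relies on it. *)
Definition average_limit Nq (L : (nat -> R) -> R) : Prop :=
  [/\ mean L,
   forall u l, bounded_rseq u -> (fun q => average (Nq q) u) @ \oo --> l -> L u = l &
   forall u e, bounded_rseq u -> e < L u ->
     forall n, exists2 q, (n <= q)%N & e < average (Nq q) u].

(** [L] is the limit along an ultrafilter finer than [\oo]. It exists for all bounded sequences at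
    once because their averages stay in a compact segment, and it is shift-invariant because
    boundary terms tend to [0]. *)
Lemma average_limit_exists Nq : pos_increasing Nq -> exists L, average_limit Nq L.
Proof.
move=> hN; have [G [GU sG]] := ultraFilterLemma (F := \oo) _.
have GF : ProperFilter G by exact: ultra_proper.
pose L u := lim ((fun q => average (Nq q) u) @ G).
have Lcvg u : bounded_rseq u -> (fun q => average (Nq q) u) @ G --> L u.
  move=> [M uM]; have M0 : 0 <= M by apply: le_trans (uM 1%N isT); exact: normr_ge0.
  have [|p [_ pcl]] := @segment_compact R (- M) M ((fun q => average (Nq q) u) @ G) _.
    by apply: (@filterE _ G) => q /=; rewrite in_itv /= -ler_norml; exact: average_bound.
  apply: (cvgP p) => A pA.
  have [//|GnA] := in_ultra_setVsetC ((fun q => average (Nq q) u) @^-1` A) GU.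
  by have [z [h1 h2]] := pcl (~` A) A GnA pA.
exists L; split.
- split.
  + move=> u v bu bv; apply: cvg_lim => //.
    under eq_fun do rewrite averageD.
    by apply: cvgD; exact: Lcvg.
  + move=> a u bu; apply: cvg_lim => //.
    under eq_fun do rewrite averageZ.
    by apply: cvgMr; exact: Lcvg.
  + move=> u bu u0; apply: (limr_ge (Lcvg _ bu)); apply: filterE => q.
    have -> : 0 = average (Nq q) (fun=> 0 : R).
      by rewrite /average big1 ?mul0r.
    exact: average_le.
  + apply: cvg_lim => //; apply: (@cvg_trans _ (1 @[_ --> G])); last exact: cvg_cst.
    apply: near_eq_cvg; apply: sG; near=> q; rewrite average_cst//.
    by apply: hN.1; near: q; exact: nbhs_infty_gt.
  + move=> u bu; apply: cvg_lim => //; have [M uM] := bu.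
    have -> : (fun q => average (Nq q) (fun n => u n.+1)) =
      (fun q => average (Nq q) u + (average (Nq q) (fun n => u n.+1) - average (Nq q) u)).
      by apply/funext => q; rewrite subrKC.
    rewrite -[L u]addr0; apply: cvgD; first exact: Lcvg.
    have h : (fun q => average (Nq q) (fun n => u n.+1) - average (Nq q) u) @ \oo --> 0.
      apply/norm_cvg0P; apply: (@squeeze_cvgr _ _ _ _ (fun=> 0) (fun q => 2 * M * (Nq q)%:R^-1)).
      - near=> q; rewrite normr_ge0 /=.
        by have := average_shift_bound (Nq q) 1 uM; under eq_fun do rewrite addn1.
      - exact: cvg_cst.
      - by rewrite -[X in _ --> X](mulr0 (2 * M)); apply: cvgMr; exact: pos_increasing_inv.
    by apply: cvg_trans h => A; exact: sG.
- move=> u l bu h; apply: cvg_lim => //; apply: cvg_trans h => A; exact: sG.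
- move=> u e bu eL n.
  have h1 : G [set q | e < average (Nq q) u].
    by have /cvgrPdist_lt/(_ (L u - e)) := Lcvg u bu; rewrite subr_gt0 => /(_ eL); apply: filterS => q;
      rewrite ltr_norml => /andP[_]; rewrite ltrD2l ltrN2.
  have h2 : G [set q | (n <= q)%N] by apply: sG; exact: nbhs_infty_ge.
  have [q [q1 q2]] := filter_ex (filterI h1 h2).
  by exists q.
Unshelve. all: by end_near. Qed.

End Averages.

Lemma cvg_ext (T : Type) (V : topologicalType) (F : set_system T) (f g : T -> V) (l : V) :
  f =1 g -> f @ F --> l -> g @ F --> l.
Proof. by move=> /funext ->. Qed.

(** * Extraction of permissible triples and their correlations as inner products *)

Section Permissible.
Context {R : realType}.
Implicit Types (u v : nat -> R) (x y : nat -> R[i]) (Nq : nat -> nat).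

(** Instead of nested subsequences, one ultrafilter makes all coordinates converge simultaneously;
    the next index is then chosen beyond the previous one and such that the first [q] coordinates
    are within [1 / (q + 1)] of their limits. *)
Lemma diagonal_extraction (f : nat -> nat -> R) (P : nat -> Prop) :
  (forall i, exists M : R, forall N, `|f i N| <= M) ->
  (forall n, exists2 N, (n <= N)%N & P N) ->
  exists Nq, [/\ pos_increasing Nq, forall q, (0 < q)%N -> P (Nq q) &
    forall i, cvgn (fun q => f i (Nq q))].
Proof.
move=> bf hP.
have /choice[phi hphi] : forall n, exists N, (n <= N)%N /\ P N.
  by move=> n; have [N nN PN] := hP n; exists N.
have phiS n := (hphi n).1; have phiP n := (hphi n).2.
have [G [GU sG]] := ultraFilterLemma (F := \oo) _.
have GF : ProperFilter G by exact: ultra_proper.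
have fl i : exists l : R, (fun k => f i (phi k)) @ G --> l.
  have [M fM] := bf i.
  have [|p [_ pcl]] := @segment_compact R (- M) M ((fun q => f i (phi q)) @ G) _.
    by apply: (@filterE _ G) => q /=; rewrite in_itv /= -ler_norml.
  exists p => A pA.
  have [//|GnA] := in_ultra_setVsetC ((fun q => f i (phi q)) @^-1` A) GU.
  by have [z [h1 h2]] := pcl (~` A) A GnA pA.
have {fl}[l fl] := choice fl.
have step (qm : nat * nat) : exists k, (qm.2 <= k)%N /\
    forall i, (i <= qm.1)%N -> `|l i - f i (phi k)| < qm.1.+1%:R^-1.
  case: qm => q m /=.
  have h1 : G [set k | (m <= k)%N] by apply: sG; exact: nbhs_infty_ge.
  have h2 : G [set k | forall i, (i <= q)%N -> `|l i - f i (phi k)| < q.+1%:R^-1].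
    elim: {1}q => [|j IH].
      have q0 : 0 < q.+1%:R^-1 :> R by rewrite invr_gt0 ltr0n.
      have /cvgrPdist_lt/(_ _ q0) := fl 0%N.
      by apply: filterS => k hk i; rewrite leqn0 => /eqP ->.
    have q0 : 0 < q.+1%:R^-1 :> R by rewrite invr_gt0 ltr0n.
    have /cvgrPdist_lt/(_ _ q0) := fl j.+1.
    apply: filterS2 IH => k hi hk i.
    by rewrite leq_eqVlt => /orP[/eqP ->//|]; rewrite ltnS; exact: hi.
  by have [k [k1 k2]] := filter_ex (filterI h1 h2); exists k.
have {step}[kap kapP] := choice step.
pose s := fix s q := if q is q'.+1 then phi (kap (q', (s q').+1)) else 0%N.
have sS q : (s q < s q.+1)%N.
  by rewrite (leq_trans _ (phiS _))// (kapP (q, (s q).+1)).1.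
have inc j k : (j < k)%N -> (s j < s k)%N.
  elim: k => // k IH; rewrite ltnS leq_eqVlt => /orP[/eqP ->//|/IH h].
  exact: ltn_trans (sS k).
exists s; split.
- by split=> [k|j k _]; [exact: (inc 0%N)|exact: inc].
- by case=> // q _; exact: phiP.
move=> i; apply: (cvgP (l i)); rewrite -(cvg_shiftn 1).
apply/cvgrPdist_lt => e e0; near=> q.
have iq : (i <= q)%N by near: q; exact: nbhs_infty_ge.
rewrite /= addn1 /=; apply: lt_trans ((kapP (q, (s q).+1)).2 i iq) _ => /=.
have : e^-1 < q%:R by near: q; exact: nbhs_infty_gtr.
move=> h; rewrite -[e]invrK ltf_pV2 ?posrE ?invr_gt0// ?ltr0n//.
by rewrite (lt_trans h)// ltr_nat.
Unshelve. all: by end_near. Qed.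

Lemma correlationE x y h N :
  correlation x y h N = average N (fun n => x (n + h)%N * conjc (y n)).
Proof. by []. Qed.

Lemma permissible_extraction x y (P : nat -> Prop) :
  bounded_cseq x -> bounded_cseq y -> (forall n, exists2 N, (n <= N)%N & P N) ->
  exists Nq, permissible x y Nq /\ forall q, (0 < q)%N -> P (Nq q).
Proof.
move=> bx bY hP.
pose sq (b : bool) := if b then x else y.
have bsq b : bounded_cseq (sq b) by case: b.
(* Countably many real coordinates encode all correlations: the two lowest bits of [i] choose the
   sequences, the third chooses the real or the imaginary part, and the remaining digits are the
   lag. *)
pose f (i : nat) (N : nat) : R :=
  let c := sq (odd i) in let d := sq (odd (i./2)) in
  let z := correlation c d (i./2./2./2) N in if odd (i./2./2) then Re z else Im z.
have bf i : exists M : R, forall N, `|f i N| <= M.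
  have bcd : bounded_cseq (fun n => sq (odd i) (n + i./2./2./2)%N * conjc (sq (odd (i./2)) n)).
    by apply: bd_ip => //; exact: bdc_shift.
  rewrite /f; case: (odd i./2./2).
    have [M uM] := bdr_Re bcd; exists M => N; rewrite correlationE Re_average.
    apply: average_bound => //; apply: le_trans (uM 1%N isT); exact: normr_ge0.
  have [M uM] := bdr_Im bcd; exists M => N; rewrite correlationE Im_average.
  apply: average_bound => //; apply: le_trans (uM 1%N isT); exact: normr_ge0.
have [Nq [inc PN cv]] := diagonal_extraction bf hP.
exists Nq; split => //; split => // h c d hc hd.
have [b1 ->] : exists b, c = sq b by move: hc => [->|->]; [exists true|exists false].
have [b2 ->] : exists b, d = sq b by move: hd => [->|->]; [exists true|exists false].
pose i (b3 : bool) : nat := (b1 + (b2 + (b3 + h.*2).*2).*2)%N.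
have hb (b : bool) n : (b + n.*2)./2 = n by rewrite half_bit_double.
have ob (b : bool) n : odd (b + n.*2) = b by rewrite oddD odd_double addbF oddb.
have fi b3 : f (i b3) = fun N => if b3 then Re (correlation (sq b1) (sq b2) h N)
    else Im (correlation (sq b1) (sq b2) h N).
  by apply/funext => N; rewrite /f /i !(hb, ob).
have hr := cv (i true); have hi := cv (i false).
rewrite fi in hr; rewrite fi in hi.
apply: (cvgP (Complex (limn (fun q => Re (correlation (sq b1) (sq b2) h (Nq q))))
   (limn (fun q => Im (correlation (sq b1) (sq b2) h (Nq q)))) : R[i]^o)).
by apply/cvg_complex; split.
Qed.

Lemma permissible_sub x y Nq : permissible x y Nq -> permissible x x Nq.
Proof. by move=> [bx bY inc h]; split => // k c d [] -> [] ->; apply: h; left. Qed.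
Lemma permissible_sym x y Nq : permissible x y Nq -> permissible y x Nq.
Proof. by move=> [bx bY inc h]; split => // k c d hc hd; apply: h; rewrite setUC. Qed.

Variables (Nq : nat -> nat) (L : (nat -> R) -> R).
Hypothesis NqL : average_limit Nq L.

Lemma cmean_average x (l : R[i]) : bounded_cseq x ->
  (fun q => average (Nq q) x : R[i]^o) @ \oo --> (l : R[i]^o) -> cmean L x = l.
Proof.
case: NqL => _ h _ bx /cvg_complex[hr hi]; apply: cplxP => /=; apply: h.
- exact: bdr_Re.
- by under eq_fun do rewrite -Re_average.
- exact: bdr_Im.
- by under eq_fun do rewrite -Im_average.
Qed.

Lemma cvg_ip x y h : bounded_cseq x -> bounded_cseq y ->
  cvgn (fun q => correlation x y h (Nq q) : R[i]^o) ->
  (fun q => correlation x y h (Nq q) : R[i]^o) @ \oo -->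
    (ip L (fun n => x (n + h)%N) y : R[i]^o).
Proof.
move=> bx bY cv; rewrite /ip (cmean_average _ cv)//.
by apply: bd_ip => //; exact: bdc_shift.
Qed.

Lemma permissible_ip x y h : permissible x y Nq ->
  (fun q => correlation x y h (Nq q) : R[i]^o) @ \oo -->
    (ip L (fun n => x (n + h)%N) y : R[i]^o).
Proof.
move=> [bx bY _ cv]; apply: cvg_ip => //; apply: cv; by [left|right].
Qed.

(** The squared difference expands into four products of translates, each of which is a shifted
    autocorrelation. Hence the limit in the definition of compactness exists and is a value of
    [sqn]. *)
Lemma permissible_sqn x l k : permissible x x Nq ->
  (fun q => average (Nq q) (fun n => normc (x (n + l)%N - x (n + k)%N) ^+ 2)) @ \oo -->
  sqn L (fun n => x (n + l)%N - x (n + k)%N).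
Proof.
move=> px; have [bx _ inc cv] := px.
have bb i j : bounded_cseq (fun n => x (n + i)%N * conjc (x (n + j)%N)).
  by apply: bd_ip; exact: bdc_shift.
have cij i j : exists c : R[i], (fun q => average (Nq q) (fun n => x (n + i)%N * conjc (x (n + j)%N)) : R[i]^o) @ \oo --> (c : R[i]^o).
  (* Exchanging [i] and [j] conjugates the product, so only the nonnegative lags covered by
     permissibility remain. *)
  wlog ji : i j / (j <= i)%N.
    move=> H; have [/H//|/ltnW/H[c /cvg_complex[h1 h2]]] := leqP j i.
    exists (conjc c); apply/cvg_complex; rewrite cReJ cImJ; split.
      apply: cvg_ext h1 => q; rewrite !Re_average.
      by congr average; apply/funext => n; rewrite -cReJ conjcM conjcK mulrC.
    apply: cvg_ext (cvgN h2) => q.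
    rewrite -[LHS]/(- Im (average (Nq q) (fun n => x (n + j)%N * conjc (x (n + i)%N)))).
    rewrite !Im_average -averageN.
    by congr average; apply/funext => n; rewrite -cImJ conjcM conjcK mulrC.
  have [c hc] : exists c : R[i], (fun q => correlation x x (i - j) (Nq q) : R[i]^o) @ \oo --> (c : R[i]^o).
    by eexists; apply: (cv (i - j)%N); left.
  exists c; have := @caverage_shift_cvg R Nq j (fun n => x (n + (i - j))%N * conjc (x n)) c inc.
  move=> /(_ _ hc) h; have {}h := h _.
  apply: cvg_ext (h (bd_ip (bdc_shift _ bx) bx)) => q; congr average; apply/funext => n.
  by rewrite -addnA subnKC.
have sqE : (fun q => average (Nq q) (fun n => normc (x (n + l)%N - x (n + k)%N) ^+ 2)) =
  (fun q => Re (average (Nq q) (fun n => x (n + l)%N * conjc (x (n + l)%N)))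
   - Re (average (Nq q) (fun n => x (n + l)%N * conjc (x (n + k)%N)))
   - Re (average (Nq q) (fun n => x (n + k)%N * conjc (x (n + l)%N)))
   + Re (average (Nq q) (fun n => x (n + k)%N * conjc (x (n + k)%N)))).
  apply/funext => q; rewrite !Re_average -!averageB -averageD; congr average.
  apply/funext => n; rewrite -[LHS]cReC -mulcJ conjcB -!cReB -cReD; congr Re; ring.
have [c1 /cvg_complex[h1 _]] := cij l l; have [c2 /cvg_complex[h2 _]] := cij l k.
have [c3 /cvg_complex[h3 _]] := cij k l; have [c4 /cvg_complex[h4 _]] := cij k k.
have h : (fun q => average (Nq q) (fun n => normc (x (n + l)%N - x (n + k)%N) ^+ 2)) @ \oo -->
    Re c1 - Re c2 - Re c3 + Re c4.
  by rewrite sqE; exact: cvgD (cvgB (cvgB h1 h2) h3) h4.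
have [_ hL _] := NqL.
by rewrite /sqn (hL _ _ _ h)//; apply: bdr_sqn; apply: bdcB; exact: bdc_shift.
Qed.
End Permissible.

(** * Asymptotic orthogonality; the case of compact sequences *)

Section Orthogonality.
Context {R : realType}.
Implicit Types (u w : nat -> R[i]).

(** Averages that do not tend to [0] stay above some [e] along a subsequence. It can be thinned to
    be permissible, and there [ip L u w] is the limit of the averages. *)
Lemma orthogonality_criterion u w : bounded_cseq u -> bounded_cseq w ->
  (forall Nq L, permissible u w Nq -> average_limit Nq L -> ip L u w = 0) ->
  (fun N => normc (average N (fun n => u n * conjc (w n)))) @ \oo --> (0 : R).
Proof.
move=> bu bw H; apply: contrapT => ncv.
have [e e0 he] : exists2 e : R, 0 < e & forall n, exists2 N, (n <= N)%N &
    e <= normc (average N (fun n => u n * conjc (w n))).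
  apply: contrapT => hn; apply: ncv; apply/cvgrPdist_lt => e e0.
  apply: contrapT => hf; apply: hn; exists e => // n.
  apply: contrapT => hn; apply: hf; exists n => // N /= nN.
  rewrite sub0r normrN ger0_norm ?nrm_ge0// ltNge; apply/negP => h.
  by apply: hn; exists N.
have [Nq [pN hN]] := permissible_extraction bu bw he.
have [L NqL] := @average_limit_exists R Nq (let: And4 _ _ inc _ := pN in inc).
have /cvgrPdist_lt h : (fun q => normc (correlation u w 0 (Nq q))) @ \oo --> (0 : R).
  have hc := @permissible_ip _ _ _ NqL _ _ 0%N pN.
  have e1 : (fun n => u (n + 0)%N) = u by apply/funext => n; rewrite addn0.
  by have := cvg_nrm hc; rewrite e1 (H _ _ pN NqL) nrm0; apply.
case: (h e e0) => n _ hn.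
have {hn h} := hn n.+1 (leqnSn n).
rewrite sub0r normrN ger0_norm ?nrm_ge0// correlationE ltNge => /negP; apply.
rewrite (_ : average _ _ = average (Nq n.+1) (fun n => u n * conjc (w n))); first exact: hN.
by apply: average_eq => k _; rewrite addn0.
Qed.

Lemma compact_approx w Nq L e : compact_cseq w -> permissible w w Nq ->
  average_limit Nq L -> 0 < e -> exists2 K, (0 < K)%N &
  forall l, (0 < l)%N -> exists2 k, (0 < k <= K)%N &
    sqn L (fun n => w (n + l)%N - w (n + k)%N) < e.
Proof.
move=> [bw cw] pw NqL e0; have [K K0 hK] := cw Nq pw e e0.
exists K => // l l0.
apply: contrapT => hn.
(* If no [k <= K] served this [l], the minimum over [k], and with it the supremum over [l], would be
   at least [e]. *)
move: hK; rewrite ltNge => /negP; apply.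
apply: le_trans (ereal_sup_ubound _); last by exists l.
rewrite big_nat; elim/big_ind : _ => [|x y hx hy|k /andP[k0 kK]].
- exact: leey.
- by rewrite le_min hx hy.
rewrite lee_fin.
rewrite (cvg_lim _ (@permissible_sqn _ _ _ NqL w l k pw))// leNgt; apply/negP => h.
by apply: hn; exists k => //; rewrite k0.
Qed.

(** Write [U] for the shift. The inner product of [u] and [w] equals that of [U^(l+K) u] and
    [U^(l+K) w], nearly that of [U^(l+K) u] and [U^k w] for some [k <= K], and so nearly the
    correlation at lag [l + K - k]. Were it nonzero, every run of [K] lags would contain a large
    correlation, although the correlations average to [0]. *)
Lemma wm_compact_orthogonal u w : nearly_weakly_mixing u -> compact_cseq w ->
  (fun N => normc (average N (fun n => u n * conjc (w n)))) @ \oo --> (0 : R).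
Proof.
move=> [bu hu] cw; have [bw _] := cw.
apply: orthogonality_criterion => // Nq L pN NqL.
have mL : mean L by case: NqL.
have pw : permissible w w Nq by apply: permissible_sub (permissible_sym pN).
apply/eqP; rewrite -nrm_eq0; apply/eqP; set d := normc _.
have [//|dn0] := eqVneq d 0.
have d0 : 0 < d by rewrite lt_neqAle eq_sym dn0 nrm_ge0.
have su := sqn_ge0 mL bu.
(* By Cauchy-Schwarz, replacing [w] by a translate at squared distance [e] changes the inner product
   by at most [d / 2]. *)
pose e := (d / 2) ^+ 2 / (sqn L u + 1).
have e0 : 0 < e by rewrite divr_gt0 ?exprn_gt0 ?divr_gt0// ltr_wpDl.
have [K K0 hK] := compact_approx cw pw NqL e0.
pose a h := normc (ip L (fun n => u (n + h)%N) w).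
have ba : bounded_rseq a.
  have [Mu hMu] := bu; have [Mw hMw] := bw.
  exists (Mu * Mw) => h h0; rewrite ger0_norm ?nrm_ge0//.
  have b := bd_ip (bdc_shift h bu) bw.
  rewrite (le_trans (nrm_cmean mL b))// -(mean_cst mL (Mu * Mw)).
  apply: (mean_le mL) => [||n n0]; [exact: bdr_nrm|exact: bdr_cst|].
  by rewrite nrmM nrmJ ler_pM ?nrm_ge0 ?hMu ?hMw ?ltn_addr.
(* A second mean, over the lags: it vanishes on [a], hence also on a sum of [K] translates of
   [a]. *)
have [L' NL'] := @average_limit_exists R id (conj (fun k h => h) (fun j k _ h => h)).
have mL' : mean L' by case: NL'.
have La : L' a = 0.
  have [_ h _] := NL'; apply: h => //.
  apply: cvg_ext (hu _ _ pN) => H; congr average; apply/funext => h.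
  by apply: cvg_lim => //; apply: cvg_nrm; exact: permissible_ip.
have key l : d / 2 <= \sum_(k < K) a (l + k)%N.
  (* Starting at [l + K] rather than [l] keeps the lag nonnegative after [k] is cancelled and places
     it among the [K] lags that follow [l]. *)
  have [|k /andP[k0 kK] hk] := hK (l + K)%N; first by rewrite ltn_addl.
  have lt : (K - k < K)%N by rewrite ltn_subrL k0.
  apply: (@le_trans _ _ (a (l + (K - k))%N)); last first.
    by rewrite (bigD1 (Ordinal lt)) //= lerDl sumr_ge0// => i _; exact: nrm_ge0.
  have aE : a (l + (K - k))%N = normc (ip L (fun n => u (n + (l + K))%N) (fun n => w (n + k)%N)).
    rewrite /a -(ip_shift mL k (bdc_shift _ bu) bw); congr (normc (ip L _ _)).
    by apply/funext => n; congr u; lia.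
  have bul := bdc_shift (l + K) bu; have bwl := bdc_shift (l + K) bw; have bwk := bdc_shift k bw.
  have dE := ipBr mL bwl bwk bul.
  rewrite (ip_shift mL (l + K) bu bw) in dE.
  have := cauchy_schwarz mL bul (bdcB bwl bwk); rewrite dE sqn_shift// => cs.
  have h1 : normc (ip L u w - ip L (fun n => u (n + (l + K))%N) (fun n => w (n + k)%N)) <= d / 2.
    rewrite -(@ler_pXn2r _ 2)// ?nnegrE ?nrm_ge0 ?divr_ge0 ?nrm_ge0//.
    rewrite (le_trans cs)// (le_trans (ler_wpM2l su (ltW hk)))//.
    rewrite /e mulrA ler_pdivrMr ?ltr_wpDl// mulrC ler_wpM2l ?sqr_ge0//.
    by rewrite lerDl.
  rewrite aE; have := nrmD (ip L u w - ip L (fun n => u (n + (l + K))%N) (fun n => w (n + k)%N))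
     (ip L (fun n => u (n + (l + K))%N) (fun n => w (n + k)%N)).
  by rewrite subrK -/d; lra.
have : L' (fun _ => d / 2) <= L' (fun l => \sum_(k < K) a (l + k)%N).
  apply: (mean_le mL') => //; first exact: bdr_cst.
  by apply: bdr_sum => k _; case: ba => M uM; exists M => n n0; apply: uM; rewrite ltn_addr.
rewrite mean_cst// mean_sum//; last first.
  by move=> k _; case: ba => M uM; exists M => n n0; apply: uM; rewrite ltn_addr.
rewrite big1 => [|k _]; last by rewrite mean_shift.
by rewrite leNgt divr_gt0.
Qed.
End Orthogonality.

(** * Mean size of sums over windows, and frequencies at which it is large *)

Section WindowSums.
Context {R : realType}.
Variable L : (nat -> R) -> R.
Hypothesis mL : mean L.
Implicit Types (x y z v : nat -> R[i]).

Definition window (m : nat) z : R := L (fun n => normc (\sum_(h < m) z (n + h)%N)).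

Lemma bdc_window m z : bounded_cseq z -> bounded_cseq (fun n => \sum_(h < m) z (n + h)%N).
Proof. by move=> bz; apply: bdc_sum => h _; exact: bdc_shift. Qed.

Lemma window_ge0 m z : bounded_cseq z -> 0 <= window m z.
Proof.
by move=> bz; apply: (mean_ge0 mL) => [|n _]; [exact/bdr_nrm/bdc_window|exact: nrm_ge0].
Qed.

(** A sum over [H] terms, repeated [m] times, is a sum of [H] windows of length [m] up to moving its
    ends by less than [m], at a cost of at most [2 * m * C] each time. After division by [m * H]: a
    large long window forces large short ones once [H] is large compared with [m]. *)
Lemma window_quasi_mono (C : R) m H z : (forall n, (0 < n)%N -> normc (z n) <= C) ->
  m%:R * window H z <= H%:R * window m z + (2 * m ^ 2)%:R * C.
Proof.
move=> zC; have bz : bounded_cseq z by exists C.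
have C0 : 0 <= C by apply: le_trans (zC 1%N isT); exact: nrm_ge0.
have shift n k : (0 < n)%N -> normc (\sum_(h < H) z (n + h)%N - \sum_(h < H) z (n + k + h)%N) <= (2 * k)%:R * C.
  move=> n0; elim: k => [|k IH]; first by rewrite addn0 subrr nrm0 muln0 mul0r.
  have -> : \sum_(h < H) z (n + h)%N - \sum_(h < H) z (n + k.+1 + h)%N =
    (\sum_(h < H) z (n + h)%N - \sum_(h < H) z (n + k + h)%N) + (z (n + k)%N - z (n + k + H)%N).
    have -> : \sum_(h < H) z (n + k.+1 + h)%N = \sum_(h < H.+1) z (n + k + h)%N - z (n + k)%N.
      rewrite big_ord_recl addn0 addrC addKr; apply: eq_bigr => h _.
      by congr z; rewrite /= /bump; lia.
    by rewrite big_ord_recr /=; ring.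
  rewrite (le_trans (nrmD _ _))//.
  have -> : (2 * k.+1)%:R * C = (2 * k)%:R * C + (C + C).
    by rewrite mulnS natrD mulrDl addrC; congr (_ + _); rewrite mulrDl mul1r.
  by rewrite lerD// (le_trans (nrmB _ _))// lerD// zC//; lia.
have pt n : (0 < n)%N -> m%:R * normc (\sum_(h < H) z (n + h)%N) <=
   \sum_(h < H) normc (\sum_(i < m) z (n + h + i)%N) + (2 * m ^ 2)%:R * C.
  move=> n0; set S := \sum_(h < H) z (n + h)%N.
  have -> : m%:R * normc S = normc (\sum_(i < m) S).
    by rewrite sumr_const card_ord -(mulr_natl S) nrmM nrm_nat.
  have -> : \sum_(i < m) S = \sum_(h < H) (\sum_(i < m) z (n + h + i)%N) +
      \sum_(i < m) (S - \sum_(h < H) z (n + i + h)%N).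
    rewrite [X in _ = X + _]exchange_big -big_split; apply: eq_bigr => i _ /=.
    rewrite -[LHS](subrKC (\sum_(h < H) z (n + i + h)%N)); congr (_ + _).
    by apply: eq_bigr => h _; rewrite addnAC.
  rewrite (le_trans (nrmD _ _))// lerD ?nrm_sum//.
  rewrite (le_trans (nrm_sum _ _ _))//.
  have -> : (2 * m ^ 2)%:R * C = \sum_(i < m) (2 * m)%:R * C.
    by rewrite sumr_const card_ord -mulrnAl -mulrnA -mulnA mulnn.
  apply: ler_sum => i _; rewrite (le_trans (shift _ _ n0))// ler_wpM2r// ler_nat.
  by rewrite leq_mul2l /= ltnW.
have bw k : bounded_rseq (fun n => normc (\sum_(h < k) z (n + h)%N)).
  exact/bdr_nrm/bdc_window.
have bw' h : bounded_rseq (fun n => normc (\sum_(i < m) z (n + h + i)%N)).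
  by have [M hM] := bw m; exists M => n n0; apply: hM; rewrite ltn_addr.
have b3 : bounded_rseq (fun n => \sum_(h < H) normc (\sum_(i < m) z (n + h + i)%N)).
  by apply: bdr_sum => h _; exact: bw'.
have := mean_le mL (bdrZ m%:R (bw H)) (bdrD b3 (bdr_cst ((2 * m ^ 2)%:R * C))) pt.
rewrite (meanZ mL)// (meanD mL b3 (bdr_cst _)) (mean_cst mL).
rewrite (mean_sum mL)//.
under eq_bigr => h _ do rewrite (mean_shift mL h (bw m)).
by rewrite sumr_const card_ord -[X in _ <= X + _ -> _]mulr_natl.
Qed.

Lemma windowD m z z' : bounded_cseq z -> bounded_cseq z' ->
  window m (fun n => z n + z' n) <= window m z + window m z'.
Proof.
move=> bz bz'; have b1 := bdr_nrm (bdc_window m bz); have b2 := bdr_nrm (bdc_window m bz').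
rewrite /window -(meanD mL)//; apply: (mean_le mL); [|exact: bdrD|].
  exact: (bdr_nrm (bdc_window m (bdcD bz bz'))).
by move=> n n0; rewrite big_split nrmD.
Qed.

Lemma window_sum (I : Type) (r : seq I) m (z : I -> nat -> R[i]) : (forall i, bounded_cseq (z i)) ->
  window m (fun n => \sum_(i <- r) z i n) <= \sum_(i <- r) window m (z i).
Proof.
move=> bz; elim: r => [|i r IH].
  rewrite big_nil -(mean_cst mL 0) le_eqVlt; apply/orP; left; apply/eqP; congr L.
  by apply/funext => n; rewrite big1 ?nrm0// => h _; rewrite big_nil.
rewrite big_cons (le_trans _ (lerD (lexx _) IH))//.
apply: (le_trans _ (windowD m (bz i) _)); last exact: bdc_sum.
by rewrite le_eqVlt; apply/orP; left; apply/eqP; congr (window m _); apply/funext => n; rewrite big_cons.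
Qed.

Lemma window_bound m z (C : R) : (forall n, (0 < n)%N -> normc (z n) <= C) ->
  window m z <= m%:R * C.
Proof.
move=> zC; have bz : bounded_cseq z by exists C.
rewrite -(mean_cst mL (m%:R * C)); apply: (mean_le mL); [|exact: bdr_cst|].
  exact/bdr_nrm/bdc_window.
move=> n n0; rewrite (le_trans (nrm_sum _ _ _))//.
have -> : m%:R * C = \sum_(h < m) C by rewrite sumr_const card_ord mulr_natl.
by apply: ler_sum => h _; rewrite zC// ltn_addr.
Qed.

Lemma nrm_twist t v n m : normc (\sum_(h < m) E t ^+ (n + h) * v (n + h)%N) =
  normc (\sum_(h < m) E t ^+ h * v (n + h)%N).
Proof.
under eq_bigr do rewrite exprD -mulrA.
by rewrite -mulr_sumr nrmM nrmX nrmE expr1n mul1r.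
Qed.

Lemma window_twist m t v : window m (fun n => E t ^+ n * v n) =
  L (fun n => normc (\sum_(h < m) E t ^+ h * v (n + h)%N)).
Proof. by congr L; apply/funext => n; rewrite nrm_twist. Qed.

(* If the correlations of [v] with some [y] do not average to zero, positivity
   of the Toeplitz form attached to the conjugate autocorrelations produces a
   frequency at which the twisted sums of [v] are large. *)
Lemma frequency_exists v y (C e : R) H : (forall n, (0 < n)%N -> normc (v n) <= C) ->
  bounded_cseq y -> 0 < e -> 0 < C -> (0 < H)%N ->
  H%:R * e <= \sum_(h < H) normc (ip L (fun n => v (n + h)%N) y) ->
  exists t, H%:R * ((e ^+ 2 / (sqn L y + 1)) ^+ 2 / ((sqn L v + 1) * C)) <= window H (fun n => E t ^+ n * v n).
Proof.
move=> vC bY e0 C0 H0 He; have bv : bounded_cseq v by exists C.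
have y0 := sqn_ge0 mL bY; have v0 := sqn_ge0 mL bv.
set k := e ^+ 2 / _; have k0 : 0 < k by rewrite divr_gt0 ?exprn_gt0// ltr_wpDl.
have bsh h : bounded_cseq (fun n => v (n + h)%N) by exact: bdc_shift.
pose g i j := ip L (fun n => v (n + i)%N) (fun n => v (n + j)%N).
have Hr : 0 < H%:R :> R by rewrite ltr0n.
have ipl (w : nat -> R[i]) z : bounded_cseq z ->
    ip L (fun n => \sum_(h < H) w h * v (n + h)%N) z = \sum_(h < H) w h * ip L (fun n => v (n + h)%N) z.
  move=> bz; exact: (@ip_suml R L mL _ _ (fun h : 'I_H => w h) (fun (h : 'I_H) n => v (n + h)%N) z).
have ipr (w : nat -> R[i]) z : bounded_cseq z ->
    ip L z (fun n => \sum_(h < H) w h * v (n + h)%N) = \sum_(h < H) conjc (w h) * ip L z (fun n => v (n + h)%N).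
  move=> bz; exact: (@ip_sumr R L mL _ _ (fun h : 'I_H => w h) (fun (h : 'I_H) n => v (n + h)%N) z).
have expand (w : nat -> R[i]) : (sqn L (fun n => \sum_(h < H) w h * v (n + h)%N))%:C%C =
    \sum_(i < H) \sum_(j < H) w i * conjc (w j) * g i j.
  have bw : bounded_cseq (fun n => \sum_(h < H) w h * v (n + h)%N).
    by apply: bdc_sum => h _; exact: bdcZ.
  rewrite -(ip_sqn mL) (ipl w _ bw); apply: eq_bigr => i _.
  rewrite (ipr w _ (bsh i)) mulr_sumr; apply: eq_bigr => j _.
  by rewrite /g; ring.
(* Unimodular weights [w h] align the phases of the correlations with [y]. By Cauchy-Schwarz the
   weighted sum [V] has a large norm, and expanding that norm involves only the autocorrelations
   [g]. *)
have S1 : H%:R ^+ 2 * k <= \sum_(i < H) \sum_(j < H) normc (g i j).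
  have /choice[w hw] : forall h, exists w, normc w = 1 /\ Re (w * ip L (fun n => v (n + h)%N) y) =
      normc (ip L (fun n => v (n + h)%N) y).
    by move=> h; have [w w1 w2] := rotate_Re (ip L (fun n => v (n + h)%N) y); exists w.
  pose V n := \sum_(h < H) w h * v (n + h)%N.
  have bV : bounded_cseq V by apply: bdc_sum => h _; exact: bdcZ.
  have ipV : H%:R * e <= normc (ip L V y).
    rewrite (le_trans He)// (le_trans _ (cRe_le_nrm _))// ipl// cRe_sum.
    by rewrite ler_sum// => h _; rewrite (hw h).2.
  have h1 : (H%:R * e) ^+ 2 <= sqn L V * sqn L y.
    rewrite (le_trans _ (cauchy_schwarz mL bV bY))// ler_pXn2r ?nnegrE ?nrm_ge0//.
    by rewrite mulr_ge0// ltW.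
  have h2 : sqn L V <= \sum_(i < H) \sum_(j < H) normc (g i j).
    rewrite -[sqn L V]cReC expand (le_trans (cRe_le_nrm _))//.
    rewrite (le_trans (nrm_sum _ _ _))// ler_sum// => i _.
    rewrite (le_trans (nrm_sum _ _ _))// ler_sum// => j _.
    by rewrite !nrmM nrmJ !(hw _).1 !mul1r.
  rewrite /k mulrA -exprMn ler_pdivrMr ?ltr_wpDl// (le_trans h1)//.
  have V0 := sqn_ge0 mL bV.
  by rewrite ler_pM// lerDl.
(* Sum [(|g| - k)^2 >= 0] over all pairs. *)
have S2 : H%:R ^+ 2 * k ^+ 2 <= \sum_(i < H) \sum_(j < H) normc (g i j) ^+ 2.
  have : \sum_(i < H) \sum_(j < H) (2 * k * normc (g i j) - k ^+ 2) <=
     \sum_(i < H) \sum_(j < H) normc (g i j) ^+ 2.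
    apply: ler_sum => i _; apply: ler_sum => j _; rewrite -subr_ge0.
    by rewrite (_ : _ - _ = (normc (g i j) - k) ^+ 2) ?sqr_ge0//; ring.
  apply: le_trans.
  have -> : \sum_(i < H) \sum_(j < H) (2 * k * normc (g i j) - k ^+ 2) =
     2 * k * (\sum_(i < H) \sum_(j < H) normc (g i j)) - H%:R ^+ 2 * k ^+ 2.
    under eq_bigr do rewrite big_split /= sumr_const card_ord -mulr_sumr.
    rewrite big_split /= sumr_const card_ord -mulr_sumr; congr (_ + _).
    by rewrite -[_ *+ H *+ H]mulr_natl -[_ *+ H]mulr_natl; ring.
  have := ler_wpM2l (ltW k0) S1; nra.
set s := H%:R ^+ 2 * k ^+ 2 / (sqn L v + 1).
have Hk0 : 0 < H%:R ^+ 2 * k ^+ 2 by apply: mulr_gt0; exact: exprn_gt0.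
have s0 : 0 < s by apply: divr_gt0; last exact: ltr_wpDl.
have [t ht] : exists t : R, s <= sqn L (fun n => \sum_(h < H) E t ^+ h * v (n + h)%N).
  apply: contrapT => hn.
  have {}hn t : sqn L (fun n => \sum_(h < H) E t ^+ h * v (n + h)%N) < s.
    by rewrite ltNge; apply/negP => h; apply: hn; exists t.
  (* If all twisted norms were below [s], the symbol of [A] would be nonnegative. The form at [v]
     would then give [s * sqn L v >= \sum |g|^2], which contradicts [S2] by the choice of [s]. *)
  pose A (i j : nat) : R[i] := ((i == 0%N) && (j == 0%N))%:R * s%:C%C - conjc (g i j).
  have pick (f : nat -> nat -> R[i]) : \sum_(i < H) \sum_(j < H) (((i : nat) == 0%N) && ((j : nat) == 0%N))%:R * f i j = f 0%N 0%N.
    rewrite (bigD1 (Ordinal H0)) //= [X in _ + X]big1 ?addr0; last first.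
      move=> i i0; rewrite big1// => j _; case: eqP => [i0'|_]; last by rewrite mul0r.
      by case/eqP: i0; exact: val_inj.
    rewrite (bigD1 (Ordinal H0)) //= mul1r big1 ?addr0// => j j0.
    case: eqP => [j0'|_]; last by rewrite mul0r.
    by case/eqP: j0; exact: val_inj.
  have := toeplitz_ge0 mL (D := H) (A := A) bv.
  have AE (f : nat -> nat -> R[i]) : \sum_(i < H) \sum_(j < H) A i j * f i j =
     s%:C%C * f 0%N 0%N - \sum_(i < H) \sum_(j < H) conjc (g i j) * f i j.
    rewrite -(pick (fun i j => s%:C%C * f i j)) -sumrB; apply: eq_bigr => i _.
    by rewrite -sumrB; apply: eq_bigr => j _; rewrite /A; ring.
  rewrite (AE (fun i j => g i j)) => h.
  have /h : forall t, 0 <= Re (\sum_(i < H) \sum_(j < H) A i j * (E t ^+ i * conjc (E t ^+ j))).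
    move=> t; rewrite (AE (fun i j => (E t ^+ i * conjc (E t ^+ j)))) !expr0 conjc1 !mulr1 cReB cReC subr_ge0.
    have -> : Re (\sum_(i < H) \sum_(j < H) conjc (g i j) * (E t ^+ i * conjc (E t ^+ j))) =
      sqn L (fun n => \sum_(h < H) E (- t) ^+ h * v (n + h)%N).
      rewrite -[RHS]cReC expand -[RHS]cReJ conjc_sum; congr Re; apply: eq_bigr => i _.
      rewrite conjc_sum; apply: eq_bigr => j _.
      by rewrite EN !conjcM !conjcX !conjcK mulrC.
    exact/ltW/hn.
  rewrite cReB cReMC subr_ge0.
  have -> : Re (g 0%N 0%N) = sqn L v.
    rewrite -[RHS]cReC -(ip_sqn mL) /g; congr (Re (ip L _ _)); by apply/funext => n; rewrite addn0.
  have -> : Re (\sum_(i < H) \sum_(j < H) conjc (g i j) * g i j) = \sum_(i < H) \sum_(j < H) normc (g i j) ^+ 2.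
    rewrite cRe_sum; apply: eq_bigr => i _; rewrite cRe_sum; apply: eq_bigr => j _.
    by rewrite mulrC mulcJ cReC.
  move=> hle; have := le_trans S2 hle; rewrite leNgt => /negP; apply.
  rewrite /s mulrAC ltr_pdivrMr; last exact: ltr_wpDl.
  by rewrite (ltr_pM2l Hk0) ltrDl.
exists t; rewrite window_twist.
have bV : bounded_cseq (fun n => \sum_(h < H) E t ^+ h * v (n + h)%N).
  by apply: bdc_sum => h _; exact: bdcZ.
(* Passage from the mean square to the mean modulus, a twisted sum being bounded by [H * C]. *)
have h1 : sqn L (fun n => \sum_(h < H) E t ^+ h * v (n + h)%N) <=
   (H%:R * C) * L (fun n => normc (\sum_(h < H) E t ^+ h * v (n + h)%N)).
  rewrite -(meanZ mL); last exact: bdr_nrm.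
  apply: (mean_le mL); [exact: bdr_sqn|exact/bdrZ/bdr_nrm|].
  move=> n n0; rewrite expr2 ler_wpM2r ?nrm_ge0// (le_trans (nrm_sum _ _ _))//.
  have -> : H%:R * C = \sum_(h < H) C by rewrite sumr_const card_ord mulr_natl.
  by apply: ler_sum => h _; rewrite nrmM nrmX nrmE expr1n mul1r vC// ltn_addr.
have {h1} := le_trans ht h1; rewrite -ler_pdivrMl ?mulr_gt0//; apply: le_trans.
rewrite le_eqVlt; apply/orP; left; apply/eqP; rewrite /s; field.
by rewrite !gt_eqF// ltr_wpDl.
Qed.
End WindowSums.

(** * A frequency, and then an arc, that serve all window lengths *)

Section Frequency.
Context {R : realType}.
Implicit Types (u v x y z : nat -> R[i]) (t : R).

Lemma E_floor t : E (t - (Num.floor t)%:~R) = E t.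
Proof. by rewrite ED EN Eint conjc1 mulr1. Qed.

Lemma frac01 t : 0 <= t - (Num.floor t)%:~R < 1.
Proof.
rewrite subr_ge0 floor_le_tmp ltrBlDl /=.
by have := floorD1_gt t; rewrite rmorphD.
Qed.

(** The factor [E t ^+ n] is unimodular and common to the window; once it is removed by
    [window_twist], the Lipschitz constant depends on the window length but not on [n]. *)
Lemma window_lipschitz L m v (C : R) t t' : mean L -> (forall n, (0 < n)%N -> normc (v n) <= C) ->
  window L m (fun n => E t ^+ n * v n) <=
  window L m (fun n => E t' ^+ n * v n) + (m ^ 2)%:R * (2 * pi * C) * `|t - t'|.
Proof.
move=> mL vC; have bv : bounded_cseq v by exists C.
have C0 : 0 <= C by apply: le_trans (vC 1%N isT); exact: nrm_ge0.
rewrite !window_twist; set c := _ * `|t - t'|.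
have bw s : bounded_rseq (fun n => normc (\sum_(h < m) E s ^+ h * v (n + h)%N)).
  by apply: bdr_nrm; apply: bdc_sum => h _; apply: bdcZ; exact: bdc_shift.
rewrite -(mean_cst mL c) -(meanD mL (bw t') (bdr_cst c)).
apply: (mean_le mL) => [||n n0]; [exact: bw|exact: bdrD (bw t') (bdr_cst c)|].
rewrite -lerBlDl (le_trans _ (_ : normc (\sum_(h < m) E t ^+ h * v (n + h)%N - \sum_(h < m) E t' ^+ h * v (n + h)%N) <= _))//.
  by rewrite lerBlDl (le_trans _ (nrmD _ _))// subrKC.
rewrite -sumrB (le_trans (nrm_sum _ _ _))//.
have -> : c = \sum_(h < m) m%:R * (2 * pi * C) * `|t - t'|.
  by rewrite sumr_const card_ord -mulrnAl -mulrnAl -mulrnA mulnn.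
apply: ler_sum => h _; rewrite -mulrBl nrmM !EX.
have h1 : normc (E (t *+ h) - E (t' *+ h)) <= 2 * pi * (m%:R * `|t - t'|).
  rewrite (le_trans (E_lip _ _))// ler_wpM2l ?mulr_ge0 ?pi_ge0// -mulrnBl normrMn.
  by rewrite -[X in X <= _]mulr_natl ler_wpM2r// ler_nat ltnW.
have h2 : normc (v (n + h)%N) <= C by rewrite vC// ltn_addr.
rewrite (le_trans (ler_pM _ _ h1 h2)) ?nrm_ge0//.
by rewrite le_eqVlt; apply/orP; left; apply/eqP; ring.
Qed.

(** There are arbitrarily long windows, each with its own good frequency. By [window_quasi_mono]
    such a frequency is also good for much shorter windows, and a cluster point of the frequencies
    is good for every length by the Lipschitz bound. *)
Lemma not_wm_frequency u : bounded_cseq u -> ~ nearly_weakly_mixing u ->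
  exists Nq L t d, [/\ pos_increasing Nq, average_limit Nq L, 0 < d &
    forall m, m%:R * d <= window L m (fun n => E t ^+ n * u n)].
Proof.
move=> bu nwm.
have [y [Nq [pN ncv]]] : exists y Nq, permissible u y Nq /\
   ~ ((fun H : nat => average H (fun h =>
       limn (fun q => normc (correlation u y h (Nq q))))) @ \oo --> (0 : R)).
  apply: contrapT => hn; apply: nwm; split => // y Nq pN.
  by apply: contrapT => ncv; apply: hn; exists y, Nq.
have [_ bY inc _] := pN.
have [L NqL] := average_limit_exists (R := R) inc.
have mL : mean L by case: NqL.
(* The average in the definition runs over lags [1] to [H], the sums of [frequency_exists] over lags
   [0] to [H - 1]. *)
pose v n := u n.+1; have bv : bounded_cseq v.
  by case: bu => M uM; exists M => n n0; exact: uM.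
have [C0 uC0] := bu; pose C := `|C0| + 1.
have C_gt0 : 0 < C by rewrite ltr_wpDl.
have uC n : (0 < n)%N -> normc (u n) <= C.
  move=> n0; rewrite (le_trans (uC0 n n0))// (le_trans (ler_norm _))//.
  by rewrite lerDl.
have vC n : (0 < n)%N -> normc (v n) <= C by move=> n0; exact: uC.
have limE h : limn (fun q => normc (correlation u y h (Nq q))) =
    normc (ip L (fun n => u (n + h)%N) y).
  by apply: cvg_lim => //; apply: cvg_nrm; exact: permissible_ip.
have [e e0 he] : exists2 e : R, 0 < e & forall n, exists2 H, (n < H)%N &
    H%:R * e <= \sum_(h < H) normc (ip L (fun n => v (n + h)%N) y).
  apply: contrapT => hn; apply: ncv; apply/cvgrPdist_lt => e e0.
  apply: contrapT => hf; apply: hn; exists e => // n.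
  apply: contrapT => hn; apply: hf; exists n.+1 => // H /= nH.
  have ge0 : 0 <= average H (fun h => limn (fun q => normc (correlation u y h (Nq q)))).
    rewrite /average mulr_ge0 ?invr_ge0// sumr_ge0// => h _; rewrite limE; exact: nrm_ge0.
  rewrite sub0r normrN ger0_norm// ltNge; apply/negP => h.
  apply: hn; exists H => //.
  move: h; rewrite /average ler_pdivlMr ?ltr0n; last by lia.
  rewrite mulrC big_add1 /= big_mkord; congr (_ <= _); apply: eq_bigr => h _.
  by rewrite limE; congr (normc (ip L _ _)); apply/funext => n'; rewrite /v addnS.
pose c := (e ^+ 2 / (sqn L y + 1)) ^+ 2 / ((sqn L v + 1) * C).
have c0 : 0 < c.
  have y0 := sqn_ge0 mL bY; have v0 := sqn_ge0 mL bv.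
  apply: divr_gt0; last by apply: mulr_gt0 => //; exact: ltr_wpDl.
  by apply: exprn_gt0; apply: divr_gt0; [exact: exprn_gt0|exact: ltr_wpDl].
have /choice[Ht hHt] : forall n : nat, exists Ht : nat * R, [/\ (n < Ht.1)%N, 0 <= Ht.2 <= 1 &
    Ht.1%:R * c <= window L Ht.1 (fun k => E Ht.2 ^+ k * v k)].
  move=> n; have [H nH hH] := he n.
  have [|t ht] := frequency_exists mL vC bY e0 C_gt0 _ hH; first by lia.
  exists (H, t - (Num.floor t)%:~R); split => //=.
    by have /andP[-> /ltW] := frac01 t.
  by rewrite E_floor.
(* The threshold on the long window makes the boundary term of [window_quasi_mono] at most half of
   the main term. *)
have lower m n : (0 < m)%N -> 4 * m%:R * C / c <= (Ht n).1%:R ->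
    m%:R * (c / 2) <= window L m (fun k => E (Ht n).2 ^+ k * v k).
  move=> m0; have [lt _ hw] := hHt n; rewrite ler_pdivrMr// => hm.
  set H := (Ht n).1 in lt hw hm; set z := fun k => _ in hw *.
  have zC k : (0 < k)%N -> normc (z k) <= C.
    by move=> k0; rewrite /z nrmM nrmX nrmE expr1n mul1r vC.
  have H0 : 0 < H%:R :> R by rewrite ltr0n; lia.
  have mr : 0 < m%:R :> R by rewrite ltr0n.
  have := window_quasi_mono mL m H zC; rewrite natrM natrX => h2.
  rewrite -(ler_pM2l H0).
  have h1 := ler_wpM2l (ltW mr) hw; have h3 := ler_wpM2l (ltW mr) hm.
  nra.
have [|p [_ pcl]] := @segment_compact R 0 1 ((fun n => (Ht n).2) @ \oo) _.
  by exists 0%N => // n _ /=; have [_ + _] := hHt n; rewrite in_itv.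
have main m : m%:R * (c / 4) <= window L m (fun n => E p ^+ n * v n).
  have bz : bounded_cseq (fun n => E p ^+ n * v n).
    by exists C => n n0; rewrite nrmM nrmX nrmE expr1n mul1r vC.
  have [->|m0] := posnP m; first by rewrite mul0r window_ge0.
  have mr : 0 < m%:R :> R by rewrite ltr0n.
  have D0 : 0 < (m ^ 2)%:R * (2 * pi * C) :> R.
    by rewrite mulr_gt0 ?ltr0n ?expn_gt0 ?m0// mulr_gt0// mulr_gt0// pi_gt0.
  (* At distance [eta] from [p] the Lipschitz error is at most [m * c / 4], half of what [lower]
     provides. *)
  pose eta := m%:R * (c / 4) / ((m ^ 2)%:R * (2 * pi * C)).
  have eta0 : 0 < eta by rewrite divr_gt0// mulr_gt0// divr_gt0.
  pose n0 := Num.truncn (4 * m%:R * C / c).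
  have FA : ((fun n => (Ht n).2) @ \oo) [set t | exists2 n, (n0 <= n)%N & t = (Ht n).2].
    by exists n0 => // n /= nn; exists n.
  have [t [[n nn ->] ht]] := pcl _ _ FA (nbhsx_ballx p eta eta0).
  have h1 : 4 * m%:R * C / c <= (Ht n).1%:R.
    have [lt _ _] := hHt n; rewrite (le_trans (ltW (truncnS_gt _)))// ler_nat.
    by rewrite -/n0; lia.
  have h2 := lower m n m0 h1.
  have h3 := window_lipschitz m (Ht n).2 p mL vC.
  have h4 : (m ^ 2)%:R * (2 * pi * C) * `|(Ht n).2 - p| <= m%:R * (c / 4).
    rewrite mulrC -ler_pdivlMr// ltW//.
    by move: ht; rewrite /ball /= distrC.
  have h5 := le_trans h2 h3; lra.
exists Nq, L, p, (c / 4); split => //; first by rewrite divr_gt0.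
move=> m; rewrite (le_trans (main m))// /window.
have bw : bounded_rseq (fun n => normc (\sum_(h < m) E p ^+ (n + h) * u (n + h)%N)).
  apply: bdr_nrm; apply: (bdc_window m (z := fun n => E p ^+ n * u n)).
  by exists C => n n0; rewrite nrmM nrmX nrmE expr1n mul1r uC.
rewrite -(mean_shift mL 1 bw) le_eqVlt; apply/orP; left; apply/eqP.
congr L; apply/funext => n; rewrite !nrm_twist; congr normc.
by apply: eq_bigr => h _; rewrite /v addn1 addSn.
Qed.

(** For [al = J * t] this is the index of the arc of length [1 / J] of the circle that contains
    [t * n] modulo [1]. *)
Definition arc_code (al : R) (J n : nat) : nat := absz (Num.floor (al * n%:R) %% J)%Z.

Lemma arc_code_lt al J n : (0 < J)%N -> (arc_code al J n < J)%N.
Proof.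
move=> J0; have Jn : (J%:Z != 0) by rewrite -lt0n.
by rewrite /arc_code -ltz_nat gez0_abs ?modz_ge0// (ltz_mod _ Jn).
Qed.

Lemma arc_code_approx t J n : (0 < J)%N ->
  normc (E t ^+ n - E ((arc_code (J%:R * t) J n)%:R / J%:R)) <= 2 * pi / J%:R.
Proof.
move=> J0; have Jn : (J%:Z != 0) by rewrite -lt0n.
have Jr : 0 < J%:R :> R by rewrite ltr0n.
rewrite /arc_code; set x := J%:R * t * n%:R.
have /andP[f0 f1] := frac01 x.
set f := x - _ in f0 f1; set q := (Num.floor x %/ J)%Z; set r := absz _.
have fl : Num.floor x = q * J%:Z + r%:Z by rewrite {1}(divz_eq (Num.floor x) J) /r gez0_abs// modz_ge0.
have tn : t *+ n = q%:~R + (r%:R / J%:R + f / J%:R).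
  have xE : x = q%:~R * J%:R + r%:R + f.
    by rewrite -[LHS](subrK ((Num.floor x)%:~R)) -/f addrC fl rmorphD rmorphM.
  have -> : t *+ n = x / J%:R.
    by rewrite -[t *+ n]mulr_natr /x; field; rewrite gt_eqF.
  by rewrite xE; field; rewrite gt_eqF.
rewrite EX tn ED Eint mul1r (le_trans (E_lip _ _))//.
have -> : r%:R / J%:R + f / J%:R - r%:R / J%:R = f / J%:R by ring.
rewrite ger0_norm; last by rewrite divr_ge0.
apply: ler_wpM2l; first by rewrite mulr_ge0 ?pi_ge0.
by rewrite ler_pdivrMr// mulVf ?gt_eqF// ltW.
Qed.

(** Up to a small error the character is constant on each arc, so the twisted window is bounded by
    the sum of the windows of the [J] restrictions of [u]. One arc serves all lengths: if each arc
    failed at some length, quasi-monotonicity would make all [J] windows small at a common large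
    length. *)
Lemma not_wm_arc u : bounded_cseq u -> ~ nearly_weakly_mixing u ->
  exists Nq L al J j d, [/\ pos_increasing Nq, average_limit Nq L, (0 < J)%N, 0 < d &
    forall m, (0 < m)%N -> m%:R * d <= window L m (fun n => (arc_code al J n == j)%:R * u n)].
Proof.
move=> bu /(not_wm_frequency bu)[Nq [L [t [d [inc NqL d0 hd]]]]].
have mL : mean L by case: NqL.
have [C0 uC0] := bu; pose C := `|C0| + 1.
have C_gt0 : 0 < C by rewrite ltr_wpDl.
have uC n : (0 < n)%N -> normc (u n) <= C.
  move=> n0; rewrite (le_trans (uC0 n n0))// (le_trans (ler_norm _))//.
  by rewrite lerDl.
(* The arcs are short enough for the discretisation of the character to cost at most [d / 2] per
   term. *)
pose J := (Num.truncn (4 * pi * C / d)).+1.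
have Jr : 0 < J%:R :> R by rewrite ltr0n.
have hJ : 2 * pi / J%:R * C <= d / 2.
  have := truncnS_gt (4 * pi * C / d); rewrite -/J ltr_pdivrMr// => h.
  have -> : 2 * pi / J%:R * C = (2 * pi * C) / J%:R by field; rewrite gt_eqF.
  by rewrite ler_pdivrMr//; lra.
pose al := J%:R * t.
pose z (j : 'I_J) n := (arc_code al J n == j)%:R * u n.
have zC j n : (0 < n)%N -> normc (z j n) <= C.
  move=> n0; rewrite /z nrmM nrm_nat; case: eqP => _; rewrite ?mul1r ?uC// mul0r.
  exact: ltW.
have bz j : bounded_cseq (z j) by exists C; exact: zC.
pose err n := (E t ^+ n - E ((arc_code al J n)%:R / J%:R)) * u n.
have errC n : (0 < n)%N -> normc (err n) <= d / 2.
  move=> n0; rewrite nrmM (le_trans _ hJ)// ler_pM ?nrm_ge0 ?uC//.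
  exact: arc_code_approx.
have berr : bounded_cseq err by exists (d / 2).
have zE : (fun n => E t ^+ n * u n) = (fun n => \sum_(j < J) E (j%:R / J%:R) * z j n + err n).
  apply/funext => n; have lt : (arc_code al J n < J)%N by rewrite arc_code_lt.
  rewrite (bigD1 (Ordinal lt)) //= big1 ?addr0; last first.
    move=> j jn; rewrite /z; case: eqP => [e|_]; last by rewrite mul0r mulr0.
    by case/eqP: jn; apply: val_inj.
  by rewrite /z eqxx mul1r /err -mulrDl subrKC.
have nz (j : 'I_J) m : window L m (fun n => E (j%:R / J%:R) * z j n) = window L m (z j).
  congr L; apply/funext => n; rewrite -mulr_sumr nrmM nrmE mul1r //.
have low m : m%:R * (d / 2) <= \sum_(j < J) window L m (z j).
  have bs : bounded_cseq (fun n => \sum_(j < J) E (j%:R / J%:R) * z j n).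
    by apply: bdc_sum => j _; exact: bdcZ.
  have := hd m; rewrite zE => h1.
  have h2 := windowD mL m bs berr.
  have h3 := window_sum mL (index_enum 'I_J) m (fun j : 'I_J => bdcZ (E (j%:R / J%:R)) (bz j)).
  rewrite (eq_bigr _ (fun j _ => nz j m)) in h3.
  have h4 := window_bound mL m errC.
  by have := le_trans (le_trans h1 h2) (lerD h3 h4); lra.
suff [j hj] : exists j : 'I_J, forall m, (0 < m)%N -> m%:R * (d / (8 * J%:R)) <= window L m (z j).
  exists Nq, L, al, J, (nat_of_ord j), (d / (8 * J%:R)); split => //.
  by rewrite divr_gt0// mulr_gt0.
apply: contrapT => hn.
have /choice[M hM] : forall j : 'I_J, exists m, (0 < m)%N /\ window L m (z j) < m%:R * (d / (8 * J%:R)).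
  move=> j; apply: contrapT => hj; apply: hn; exists j => m m0.
  by rewrite leNgt; apply/negP => h; apply: hj; exists m.
pose mm := (\max_(j < J) M j)%N.
(* Long enough for the boundary term to be at most [m * H * d / (8 * J)]; every arc then contributes
   at most [H * d / (4 * J)], in total less than the lower bound [H * d / 2]. *)
pose H := (Num.truncn (16 * J%:R * mm%:R * C / d)).+1.
have Hr : 0 < H%:R :> R by rewrite ltr0n.
have hH : 16 * J%:R * mm%:R * C < H%:R * d.
  by have := truncnS_gt (16 * J%:R * mm%:R * C / d); rewrite -/H ltr_pdivrMr.
have up (j : 'I_J) : window L H (z j) <= H%:R * (d / (4 * J%:R)).
  have [m0 hm] := hM j; set m := M j in m0 hm.
  have mr : 0 < m%:R :> R by rewrite ltr0n.
  have mmm : m%:R <= mm%:R :> R by rewrite ler_nat; exact: (leq_bigmax (F := M) j).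
  have := window_quasi_mono mL m H (zC j); rewrite natrM natrX => h1.
  rewrite -(ler_pM2l mr) (le_trans h1)//.
  have h2 := ler_wpM2l (ltW Hr) (ltW hm).
  have h3 : 2 * m%:R ^+ 2 * C <= m%:R * (H%:R * (d / (8 * J%:R))).
    have -> : 2 * m%:R ^+ 2 * C = m%:R * (2 * m%:R * C) by ring.
    rewrite ler_pM2l//.
    have -> : H%:R * (d / (8 * J%:R)) = (H%:R * d) / (8 * J%:R) by rewrite mulrA.
    rewrite ler_pdivlMr ?mulr_gt0//.
    have h4 : J%:R * m%:R * C <= J%:R * mm%:R * C by rewrite ler_pM2r// ler_pM2l.
    by lra.
  rewrite (le_trans (lerD h2 h3))// le_eqVlt; apply/orP; left; apply/eqP; field.
  by rewrite gt_eqF.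
have := low H; rewrite leNgt => /negP; apply.
have : \sum_(j < J) window L H (z j) <= \sum_(j < J) H%:R * (d / (4 * J%:R)).
  by apply: ler_sum => j _; exact: up.
move=> /le_lt_trans; apply; rewrite sumr_const card_ord -[_ *+ J]mulr_natl.
have -> : J%:R * (H%:R * (d / (4 * J%:R))) = H%:R * (d / 4) by field; rewrite gt_eqF.
by rewrite ltr_pM2l//; lra.
Qed.
End Frequency.

(** * Sparse sets and almost periodic colourings of the integers *)

Section TotallyBounded.
Context {R : realType}.

Definition sparse (e : R) (P : pred nat) : Prop :=
  \forall N \near \oo, average N (fun n => (P n)%:R) <= e.

(* The translates of [b] are totally bounded for the upper density of the set
   where two of them differ; the fibres of [col] are balls of radius [e]. *)
Definition almost_periodic (T : eqType) (b : nat -> T) : Prop :=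
  forall e : R, 0 < e -> exists (C : finType) (col : nat -> C),
    forall l l', col l = col l' -> sparse e (fun n => b (n + l)%N != b (n + l')%N).

Lemma sparse_sub e (P Q : pred nat) : (forall n, P n -> Q n) -> sparse e Q -> sparse e P.
Proof.
move=> PQ; apply: filterS => N; apply: le_trans; apply: average_le => n _.
by rewrite ler_nat; have := PQ n; case: (P n) => // ->.
Qed.

Lemma sparseU e e' (P Q : pred nat) : sparse e P -> sparse e' Q ->
  sparse (e + e') (fun n => P n || Q n).
Proof.
apply: filterS2 => N h1 h2; apply: le_trans (lerD h1 h2).
rewrite -averageD; apply: average_le => n _.
by rewrite -natrD ler_nat; case: (P n); case: (Q n).
Qed.

(** The margin [e' - e] absorbs the boundary error [2 * k / N]. *)
Lemma sparse_shift e e' P k : e < e' -> sparse e P -> sparse e' (fun n => P (n + k)%N).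
Proof.
move=> ee' hP; near=> N.
have N0 : (0 < N)%N by near: N; exact: nbhs_infty_gt.
have h1 : average N (fun n => (P n)%:R) <= e by near: N.
have h2 : (k.*2)%:R / (e' - e) < N%:R by near: N; exact: nbhs_infty_gtr.
have b n : (0 < n)%N -> `|((P n)%:R : R)| <= 1.
  by move=> _; rewrite normr_nat lern1 leq_b1.
have := average_shift_bound N k b; rewrite mulr1 => /(le_trans (ler_norm _)).
rewrite lerBlDl => h3; apply: (le_trans h3).
rewrite ltr_pdivrMr ?subr_gt0// in h2.
have : (k.*2)%:R / N%:R <= e' - e by rewrite ler_pdivrMr ?ltr0n// mulrC ltW.
by lra.
Unshelve. all: by end_near. Qed.

Lemma sparse_windows (e : R) (P : pred nat) (W a0 : nat) : (0 < W)%N -> W%:R^-1 < e ->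
  (forall a i j, (a0 <= a)%N -> (i < j < W)%N -> P (a + i)%N -> P (a + j)%N -> False) ->
  sparse e P.
Proof.
move=> W0 We h; have Wr : 0 < W%:R :> R by rewrite ltr0n.
pose S N := (\sum_(i < N) P (a0 + i))%N.
have Smono m n : (m <= n)%N -> (S m <= S n)%N.
  by move=> mn; rewrite -(subnKC mn) /S big_split_ord /= leq_addr.
have win a : (a0 <= a)%N -> (\sum_(i < W) P (a + i) <= 1)%N.
  move=> aa; have [/existsP[i Pi]|hn] := boolP [exists i : 'I_W, P (a + i)%N].
    rewrite (bigD1 i) //= big1 ?addn0; first exact: leq_b1.
    move=> j ji; apply/eqP; rewrite eqb0; apply/negP => Pj.
    have /orP[lt|lt] : ((i < j) || (j < i))%N by rewrite -neq_ltn eq_sym.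
      by apply: (h a i j) => //; rewrite lt ltn_ord.
    by apply: (h a j i) => //; rewrite lt ltn_ord.
  by rewrite big1// => i _; move: hn; rewrite negb_exists => /forallP/(_ i)/negbTE ->.
have SW k : (S (k * W) <= k)%N.
  elim: k => [|k IH]; first by rewrite /S big_ord0.
  rewrite mulSn addnC /S big_split_ord /= -addn1 leq_add//.
  have -> : (\sum_(i < W) P (a0 + (k * W + i)) = \sum_(i < W) P (a0 + k * W + i))%N.
    by apply: eq_bigr => i _; rewrite addnA.
  by apply: win; rewrite leq_addr.
have cnt N : (\sum_(1 <= n < N.+1) P n <= a0 + (N.+1 %/ W).+1)%N.
  have h1 : (\sum_(1 <= n < N.+1) P n <= \sum_(0 <= n < a0 + N.+1) P n)%N.
    rewrite [X in (_ <= X)%N](big_cat_nat (n := 1)) //=; last by lia.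
    rewrite [X in (_ <= _ + X)%N](big_cat_nat (n := N.+1)) //=; last by lia.
    by rewrite addnCA leq_addr.
  apply: (leq_trans h1); rewrite big_mkord big_split_ord /= leq_add//.
    rewrite -[X in (_ <= X)%N]card_ord -sum1_card; apply: leq_sum => i _; exact: leq_b1.
  apply: (leq_trans _ (SW _)); apply: Smono.
  by rewrite ltnW// ltn_ceil.
near=> N.
have N0 : 0 < N%:R :> R by rewrite ltr0n; near: N; exact: nbhs_infty_gt.
rewrite /average ler_pdivrMr// -natr_sum.
rewrite (le_trans (_ : _ <= (a0 + (N.+1 %/ W).+1)%:R))//; first by rewrite ler_nat cnt.
have h1 : (N.+1 %/ W)%:R <= N.+1%:R / W%:R :> R.
  by rewrite ler_pdivlMr// -natrM ler_nat leq_divM.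
have h2 : (a0%:R + 2) / (e - W%:R^-1) < N%:R by near: N; exact: nbhs_infty_gtr.
rewrite ltr_pdivrMr ?subr_gt0// in h2.
have W1 : W%:R^-1 <= 1 :> R by rewrite invf_le1// ler1n.
rewrite natrD -[X in _ + X%:R]addn1 natrD.
move: h1; rewrite -natr1 mulrDl; nra.
Unshelve. all: by end_near. Qed.

Lemma almost_periodic_image (T U : eqType) (f : T -> U) (b : nat -> T) :
  almost_periodic b -> almost_periodic (fun n => f (b n)).
Proof.
move=> hb e e0; have [C [col hc]] := hb e e0.
exists C, col => l l' /hc; apply: sparse_sub => n.
by apply: contra_neq => ->.
Qed.

Lemma almost_periodic_pair (T U : eqType) (b : nat -> T) (b' : nat -> U) :
  almost_periodic b -> almost_periodic b' -> almost_periodic (fun n => (b n, b' n)).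
Proof.
move=> hb hb' e e0; have e2 : 0 < e / 2 by rewrite divr_gt0.
have [C [col hc]] := hb _ e2; have [C' [col' hc']] := hb' _ e2.
exists (C * C')%type, (fun l => (col l, col' l)) => l l' [/hc h /hc' h'].
rewrite [e]splitr; apply: sparse_sub (sparseU h h') => n.
by rewrite xpair_eqE negb_and.
Qed.

Lemma almost_periodic_periodic (T : eqType) (b : nat -> T) p : (0 < p)%N ->
  (forall n, b (n + p)%N = b n) -> almost_periodic b.
Proof.
move=> p0 hp e e0; have hk k n : b (n + k * p)%N = b n.
  by elim: k => [|k IH]; rewrite ?addn0// mulSn addnCA addnC hp.
have hm l n : b (n + l)%N = b (n + l %% p)%N.
  by rewrite {1}(divn_eq l p) addnCA addnC hk.
exists 'I_p, (fun l => Ordinal (ltn_pmod l p0)) => l l' [e1].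
apply: filterE => N; rewrite /average big1 ?mul0r ?ltW// => n _.
by rewrite hm [b (n + l')%N]hm e1 eqxx.
Qed.

(** When changes have density zero, a translate by any fixed [l] differs from [b] on a set of
    density zero, and a single colour suffices. *)
Lemma almost_periodic_slow (T : eqType) (b : nat -> T) :
  (forall e, 0 < e -> sparse e (fun n => b n.+1 != b n)) -> almost_periodic b.
Proof.
move=> hb; have hl l e : 0 < e -> sparse e (fun n => b (n + l)%N != b n).
  elim: l e => [|l IH] e e0.
    apply: filterE => N; rewrite /average big1 ?mul0r ?ltW// => n _.
    by rewrite addn0 eqxx.
  have e4 : 0 < e / 4 by rewrite divr_gt0.
  have lt : e / 4 < e / 2 by lra.
  have h := sparse_shift l lt (hb _ e4).
  have e2 : 0 < e / 2 by rewrite divr_gt0.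
  rewrite [e]splitr; apply: sparse_sub (sparseU h (IH _ e2)) => n.
  rewrite addnS -negb_and; apply: contra => /andP[/eqP h1 /eqP h2].
  by rewrite h1 h2.
move=> e e0; have e2 : 0 < e / 2 by rewrite divr_gt0.
exists unit, (fun=> tt) => l l' _.
rewrite [e]splitr; apply: sparse_sub (sparseU (hl l _ e2) (hl l' _ e2)) => n.
by rewrite -negb_and; apply: contra => /andP[/eqP -> /eqP ->].
Qed.

Lemma floor_perturb (x s : R) : Num.floor (x + s) != Num.floor x ->
  exists k : int, `|x - k%:~R| <= `|s|.
Proof.
move=> ne; have /andP[f0 f1] := frac01 x; have /andP[g0 g1] := frac01 (x + s).
have [lt|ge] := ltP (Num.floor x) (Num.floor (x + s)).
  have : (Num.floor x)%:~R + 1 <= (Num.floor (x + s))%:~R :> R.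
    by rewrite -[1]/(1%:~R) -rmorphD /= ler_int lezD1.
  move=> h; exists (Num.floor x + 1); rewrite rmorphD /=.
  rewrite ler0_norm; last by lra.
  have s0 : 0 <= s by lra.
  by rewrite ger0_norm//; lra.
have lt : (Num.floor (x + s) < Num.floor x) by rewrite lt_neqAle ne.
have : (Num.floor (x + s))%:~R + 1 <= (Num.floor x)%:~R :> R.
  by rewrite -[1]/(1%:~R) -rmorphD /= ler_int lezD1.
move=> h; exists (Num.floor x); rewrite ger0_norm//.
have s0 : s <= 0 by lra.
by rewrite ler0_norm//; lra.
Qed.

Lemma dist_int_gt0 (y : R) : (forall k : int, y != k%:~R) ->
  exists2 eta, 0 < eta & forall k : int, eta <= `|y - k%:~R|.
Proof.
move=> hy; have /andP[f0 f1] := frac01 y.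
have f0' : 0 < y - (Num.floor y)%:~R by rewrite lt_neqAle f0 eq_sym subr_eq0 hy.
exists (Num.min (y - (Num.floor y)%:~R) (1 - (y - (Num.floor y)%:~R))).
  by rewrite lt_min f0' subr_gt0.
move=> k; rewrite ge_min; have [le|gt] := leP k (Num.floor y).
  apply/orP; left; rewrite (le_trans _ (ler_norm _))// lerD2l lerN2 ler_int//.
apply/orP; right; rewrite -normrN (le_trans _ (ler_norm _))//.
have : (Num.floor y)%:~R + 1 <= k%:~R :> R.
  by rewrite -[1]/(1%:~R) -rmorphD /= ler_int lezD1.
by lra.
Qed.

(** If a multiple of [al] is an integer, the code is periodic. Otherwise [l] is coloured by the
    position of [al * l / J] modulo [1] among [K] short arcs. For equal colours the codes of [n + l]
    and [n + l'] differ only when [al * (n + l')] is close to an integer, and two such [n] less than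
    [W] apart would bring some [al * p], [0 < p < W], close to an integer. *)
Lemma almost_periodic_arc al J : (0 < J)%N -> almost_periodic (arc_code (R := R) al J).
Proof.
move=> J0; have Jr : 0 < J%:R :> R by rewrite ltr0n.
have [[p p0 [k pk]]|irr] := pselect (exists2 p, (0 < p)%N & exists k : int, al * p%:R = k%:~R).
  apply: (@almost_periodic_periodic _ _ (p * J)%N); first by rewrite muln_gt0 p0.
  move=> n; rewrite /arc_code natrD natrM mulrDr mulrA pk -[J%:R]/(J%:~R) -rmorphM /=.
  by rewrite floorDrz ?intr_int// intrKfloor addrC modzMDl.
move=> e e0.
pose W := (Num.truncn (e^-1)).+1.
have We : W%:R^-1 < e.
  by rewrite -[e]invrK ltf_pV2 ?posrE ?ltr0n ?invr_gt0// truncnS_gt.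
(* Finitely many numbers, none of them an integer, keep a common distance from the integers. *)
have [eta eta0 heta] : exists2 eta, 0 < eta & forall p (k : int), (0 < p < W)%N -> eta <= `|al * p%:R - k%:~R|.
  elim: (W) => [|V [eta eta0 h]]; first by exists 1 => // p k; lia.
  have [V0|V0] := posnP V; first by exists 1 => // p k; lia.
  have [|eta' eta'0 h'] := @dist_int_gt0 (al * V%:R).
    by move=> k; apply/eqP => hk; apply: irr; exists V => //; exists k.
  exists (Num.min eta eta'); first by rewrite lt_min eta0.
  move=> p k /andP[p0]; rewrite ltnS leq_eqVlt => /orP[/eqP ->|pV].
    by rewrite ge_min h' orbT.
  by rewrite ge_min h// p0.
pose K := (Num.truncn (2 * J%:R / eta)).+1.
have Kr : 0 < K%:R :> R by rewrite ltr0n.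
have hK : 2 * (J%:R / K%:R) < eta.
  by rewrite mulrA ltr_pdivrMr// [ltRHS]mulrC -ltr_pdivrMr// truncnS_gt.
pose fr l := al / J%:R * l%:R - (Num.floor (al / J%:R * l%:R))%:~R.
have frlt l : (Num.truncn (K%:R * fr l) < K)%N.
  have /andP[f0 f1] := frac01 (al / J%:R * l%:R).
  rewrite -(ltr_nat R); apply: (@le_lt_trans _ _ (K%:R * fr l)).
    by rewrite truncn_le// mulr_ge0// ltW.
  by rewrite -[X in _ < X]mulr1 ltr_pM2l.
exists 'I_K, (fun l => Ordinal (frlt l)) => l l' [ell].
have close : `|fr l - fr l'| <= K%:R^-1.
  have /andP[f0 _] := frac01 (al / J%:R * l%:R); have /andP[f0' _] := frac01 (al / J%:R * l'%:R).
  have h1 := truncn_itv (mulr_ge0 (ltW Kr) f0); have h2 := truncn_itv (mulr_ge0 (ltW Kr) f0').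
  rewrite -(ler_pM2l Kr) mulfV ?gt_eqF// -[X in X * _](ger0_norm (ltW Kr)) -normrM mulrBr.
  move: h1 h2; rewrite -!/(fr _) ell -!natr1 => /andP[a1 a2] /andP[b1 b2].
  by rewrite ler_norml; apply/andP; split; lra.
set s := J%:R * (fr l - fr l').
have hs : `|s| <= J%:R / K%:R by rewrite normrM (ger0_norm (ltW Jr)) ler_pM2l.
(* The integer part of the displacement is a multiple of [J], which does not affect the code; only
   [s] can. *)
have [z hz] : exists z : int, al * l%:R = al * l'%:R + J%:R * z%:~R + s.
  exists (Num.floor (al / J%:R * l%:R) - Num.floor (al / J%:R * l'%:R)).
  by rewrite rmorphB /= /s /fr; field; rewrite gt_eqF.
have bad n : arc_code al J (n + l) != arc_code al J (n + l') ->
    exists k : int, `|al * (n + l')%:R - k%:~R| <= J%:R / K%:R.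
  move=> ne; have [|k hk] := @floor_perturb (al * (n + l')%:R) s; last by exists k; exact: le_trans hs.
  apply: contra ne => /eqP e1; rewrite /arc_code.
  have -> : al * (n + l)%:R = al * (n + l')%:R + s + (z * J%:Z)%:~R.
    by rewrite !natrD !mulrDr hz rmorphM /=; ring.
  by rewrite floorDrz ?intr_int// intrKfloor e1 addrC modzMDl.
apply: (@sparse_windows e _ W 0%N) => // a i j _ /andP[ij jW] /bad[k hk] /bad[k' hk'].
have pW : (0 < j - i < W)%N by lia.
have := heta (j - i)%N (k' - k) pW; rewrite leNgt => /negP; apply.
apply: (le_lt_trans _ hK).
have -> : al * (j - i)%:R - (k' - k)%:~R = (al * (a + j + l')%:R - k'%:~R) - (al * (a + i + l')%:R - k%:~R).
  by rewrite natrB 1?ltnW// rmorphB /= !natrD; ring.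
by rewrite (le_trans (ler_normB _ _))// mulr_natl mulr2n lerD.
Qed.

(** Each colour is represented by one translate. Translates of equal colour differ on a set of small
    density, where the squared difference is at most [4 * M ^+ 2]. *)
Lemma almost_periodic_compact (T : eqType) (b : nat -> T) (g : T -> R[i]) (M : R) :
  almost_periodic b -> (forall n, (0 < n)%N -> normc (g (b n)) <= M) -> compact_cseq (fun n => g (b n)).
Proof.
move=> hb gM; split; first by exists M.
move=> Nq pN e e0.
have M0 : 0 <= M by apply: le_trans (gM 1%N isT); exact: nrm_ge0.
have inc : pos_increasing Nq by case: pN.
have [L NqL] := average_limit_exists (R := R) inc.
pose eps := e / (8 * (M ^+ 2 + 1)).
have D0 : 0 < 8 * (M ^+ 2 + 1) by rewrite mulr_gt0// ltr_wpDl// sqr_ge0.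
have eps0 : 0 < eps by rewrite divr_gt0.
have [C [col hc]] := hb eps eps0.
(* A colour that no positive [l] attains receives the default representative [1]. *)
have /choice[rep hrep] : forall c : C, exists k : nat, (0 < k)%N /\ forall l, (0 < l)%N -> col l = c -> col k = c.
  move=> c; have [[l [l0 hl]]|hn] := pselect (exists l, (0 < l)%N /\ col l = c).
    by exists l.
  by exists 1%N; split => // l l0 hl; case: hn; exists l.
pose K := (\max_(c : C) rep c)%N.
exists K.+1 => //; apply: (@le_lt_trans _ _ ((e / 2)%:E)); last first.
  by rewrite lte_fin; lra.
apply: ub_ereal_sup => _ [l /= l0 <-].
pose k := rep (col l); have [k0 hk] := hrep (col l).
have kK : (k <= K)%N by exact: (leq_bigmax (F := rep) (col l)).
have kin : k \in index_iota 1 K.+2 by rewrite mem_index_iota k0 /= ltnS leqW.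
apply: (@le_trans _ _ (limn (fun q => average (Nq q) (fun n => normc (g (b (n + l)%N) - g (b (n + k)%N)) ^+ 2)))%:E).
  exact: (@ge_bigmin_seq _ _ _ (index_iota 1 K.+2) +oo%E k xpredT (fun k => (limn (fun q =>
    average (Nq q) (fun n => normc (g (b (n + l)%N) - g (b (n + k)%N)) ^+ 2)))%:E) kin isT).
rewrite lee_fin.
have cv := @permissible_sqn _ _ _ NqL _ l k pN.
apply: limr_le; first exact: (cvgP _ cv).
have hsp := hc l k (esym (hk l l0 erefl)).
near=> q.
have h1 : average (Nq q) (fun n => (b (n + l)%N != b (n + k)%N)%:R) <= eps.
  near: q; case: hsp => n0 _ hn0; exists n0.+1 => // q /= qn; apply: hn0 => /=.
  by have := pos_increasing_ge inc (leq_ltn_trans (leq0n _) qn); lia.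
have h2 : average (Nq q) (fun n => normc (g (b (n + l)%N) - g (b (n + k)%N)) ^+ 2) <=
   4 * M ^+ 2 * average (Nq q) (fun n => (b (n + l)%N != b (n + k)%N)%:R).
  rewrite -averageZ; apply: average_le => n n0.
  have [->|ne] := eqVneq (b (n + l)%N) (b (n + k)%N); first by rewrite subrr nrm0 expr0n mulr0.
  rewrite mulr1; have -> : 4 * M ^+ 2 = (M + M) ^+ 2 by ring.
  rewrite ler_pXn2r ?nnegrE ?nrm_ge0 ?addr_ge0// (le_trans (nrmB _ _))//.
  by rewrite lerD ?gM// ltn_addr.
rewrite (le_trans h2)//.
have M2 : 0 <= 4 * M ^+ 2 by rewrite mulr_ge0 ?sqr_ge0.
rewrite (le_trans (ler_wpM2l M2 h1))// /eps mulrA ler_pdivrMr//.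
have := sqr_ge0 M; nra.
Unshelve. all: by end_near. Qed.
End TotallyBounded.

(** * Almost periodic sets assembled from favourable blocks *)

Section Blocks.
Context {R : realType}.

(** One of the four half planes given by the signs of the real and imaginary parts carries a quarter
    of the sum of the moduli, and inside a half plane the sum does not cancel in the corresponding
    direction. *)
Lemma large_subsum (I : Type) (r : seq I) (P : pred I) (c : I -> R[i]) : exists sel : pred I,
  \sum_(i <- r | P i) normc (c i) <= 4 * normc (\sum_(i <- r | P i && sel i) c i).
Proof.
pose s1 i := 0 <= Re (c i). pose s2 i := Re (c i) <= 0.
pose s3 i := 0 <= Im (c i). pose s4 i := Im (c i) <= 0.
pose F (s : pred I) := normc (\sum_(i <- r | P i && s i) c i).
have posR (f : I -> R) (s : pred I) : (forall i, s i = (0 <= f i)) ->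
    \sum_(i <- r | P i) Num.max (f i) 0 = \sum_(i <- r | P i && s i) f i.
  move=> hs; rewrite big_mkcondr; apply: eq_bigr => i _; rewrite hs.
  by case: (leP 0 (f i)) => [h|/ltW h]; rewrite ?max_l ?max_r.
have b1 : \sum_(i <- r | P i) Num.max (Re (c i)) 0 <= F s1.
  by rewrite (posR _ s1)// -cRe_sum cRe_le_nrm.
have b2 : \sum_(i <- r | P i) Num.max (- Re (c i)) 0 <= F s2.
  rewrite (posR _ s2)//; last by move=> i; rewrite oppr_ge0.
  by rewrite sumrN -cRe_sum -cReN (le_trans (cRe_le_nrm _))// nrmN.
have b3 : \sum_(i <- r | P i) Num.max (Im (c i)) 0 <= F s3.
  by rewrite (posR _ s3)// -cIm_sum (le_trans (ler_norm _))// cIm_nrm.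
have b4 : \sum_(i <- r | P i) Num.max (- Im (c i)) 0 <= F s4.
  rewrite (posR _ s4)//; last by move=> i; rewrite oppr_ge0.
  by rewrite sumrN -cIm_sum -cImN (le_trans (ler_norm _))// (le_trans (cIm_nrm _))// nrmN.
have tot : \sum_(i <- r | P i) normc (c i) <= F s1 + F s2 + F s3 + F s4.
  have amax (a : R) : `|a| = Num.max a 0 + Num.max (- a) 0.
    have [a0|/ltW a0] : 0 <= a \/ a < 0 by case: (leP 0 a); [left|right].
      by rewrite ger0_norm// max_l// max_r ?oppr_le0// addr0.
    by rewrite ler0_norm// max_r// max_l ?oppr_ge0// add0r.
  apply: le_trans (lerD (lerD (lerD b1 b2) b3) b4).
  rewrite -!big_split; apply: ler_sum => i _ /=.
  by rewrite -addrA -!amax (le_trans (nrm_ReIm _))// !amax; lra.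
apply: contrapT => hn.
have lt s : 4 * F s < \sum_(i <- r | P i) normc (c i).
  by rewrite ltNge; apply/negP => h; apply: hn; exists s.
by have := lt s1; have := lt s2; have := lt s3; have := lt s4; move: tot; lra.
Qed.

(** One residue class [s] modulo [m] carries its share of the window sums, and its windows are
    disjoint. [large_subsum] selects windows whose sums do not cancel, and [beta] is the indicator
    function of their union. *)
Lemma block_choice (v : nat -> R[i]) m N (D : R) : (0 < m)%N ->
  m%:R * D <= \sum_(1 <= n < N.+1) normc (\sum_(h < m) v (n + h)%N) ->
  exists s (beta : nat -> bool),
    (forall n, beta n.+1 != beta n -> (m %| n + s)%N) /\
    D <= 4 * normc (\sum_(1 <= n < (N + m).+1) (beta n)%:R * v n).
Proof.
move=> m0 hD; pose c n := \sum_(h < m) v (n + h)%N.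
have mr : 0 < m%:R :> R by rewrite ltr0n.
have shiftsum (f : nat -> R[i]) n : \sum_(n <= k < n + m) f k = \sum_(h < m) f (n + h)%N.
  rewrite -{1}[n]add0n big_addn addKn big_mkord.
  by apply: eq_bigr => h _; rewrite addnC.
have [s hs] : exists s : 'I_m, D <= \sum_(1 <= n < N.+1 | (n %% m)%N == s) normc (c n).
  apply: contrapT => hn.
  have lt (s : 'I_m) : \sum_(1 <= n < N.+1 | (n %% m)%N == s) normc (c n) < D.
    by rewrite ltNge; apply/negP => h; apply: hn; exists s.
  have : \sum_(s < m) \sum_(1 <= n < N.+1 | (n %% m)%N == s) normc (c n) < \sum_(s < m) D.
    by apply: ltr_sum => //; apply/hasP; exists (Ordinal m0); rewrite ?mem_index_enum.
  rewrite sumr_const card_ord -[_ *+ m]mulr_natl ltNge => /negP; apply.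
  apply: (le_trans hD); rewrite le_eqVlt; apply/orP; left; apply/eqP.
  rewrite (exchange_big_dep xpredT) //=; apply: eq_bigr => n _.
  rewrite [RHS](bigD1 (Ordinal (ltn_pmod n m0))) //= [X in _ = _ + X]big1 ?addr0// => j /andP[/eqP h1 /eqP h2].
  by case: h2; apply: val_inj.
have [sel hsel] := large_subsum (index_iota 1 N.+1) (fun n => (n %% m)%N == s) c.
(* The start of the window of the class [s] that contains [k]; adding [m - s] instead of subtracting
   [s] avoids truncated subtraction. If no such window starts at a positive integer, the value is
   [0], which [G] rejects. *)
pose st k := (k - (k + (m - s)) %% m)%N.
pose G n := [&& (0 < n)%N, (n <= N)%N, (n %% m)%N == s & sel n].
have sm := ltn_ord s.
have sts k n : (n %% m)%N = s -> (0 < n)%N -> (st k == n) = ((n <= k) && (k < n + m))%N.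
  move=> ns n0; rewrite /st.
  have nE := divn_eq n m.
  apply/eqP/andP => [e|[h1 h2]].
    have := ltn_pmod (k + (m - s)) m0; lia.
  have -> : (k + (m - s) = (n %/ m).+1 * m + (k - n))%N by rewrite mulSn; lia.
  by rewrite modnMDl modn_small; lia.
(* A change between [n] and [n.+1] requires [n.+1] to be congruent to [s], which is divisibility of
   [n + (m - s).+1] by [m]. *)
exists (m - s).+1, (fun k => G (st k)); split.
  move=> n; apply: contraR => hn; rewrite /st.
  have e1 : (n.+1 + (m - s) = (n + (m - s)).+1)%N by [].
  have : ((n + (m - s)).+1 %% m = ((n + (m - s)) %% m).+1)%N.
    have lt := ltn_pmod (n + (m - s)) m0.
    rewrite [in LHS](divn_eq (n + (m - s)) m) -addnS modnMDl.
    move: lt; rewrite leq_eqVlt => /orP[/eqP e2|lt]; last by rewrite modn_small.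
    case/negP: hn; rewrite addnS (divn_eq (n + (m - s)) m) -addnS e2.
    by rewrite dvdn_addr ?dvdn_mull.
  by move=> e2; rewrite e1 e2 subSS.
apply: (le_trans hs); apply: (le_trans hsel); rewrite le_eqVlt; apply/orP; left; apply/eqP.
congr (_ * normc _).
transitivity (\sum_(1 <= n < N.+1 | (n %% m == s)%N && sel n) \sum_(1 <= k < (N + m).+1) (st k == n)%:R * v k).
  rewrite big_nat_cond [RHS]big_nat_cond; apply: eq_bigr => n /andP[/andP[n0 nN] /andP[/eqP ns _]].
  rewrite (big_cat_nat (n := n)) //=; [|lia].
  rewrite (big_cat_nat (m := n) (n := (n + m)%N)) //=; [|lia|lia].
  rewrite [X in X + _]big_nat big1 ?add0r; last first.
    move=> k /andP[k1 k2]; rewrite sts//; case: (leqP n k) => h; first by lia.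
    by rewrite mul0r.
  rewrite [X in _ + X]big_nat [X in _ + X]big1 ?addr0; last first.
    move=> k /andP[k1 k2]; rewrite sts// [(k < n + m)%N]ltnNge k1 andbF mul0r//.
  rewrite shiftsum /c; apply: eq_bigr => h _.
  by rewrite sts// leq_addr ltn_add2l ltn_ord mul1r.
rewrite (exchange_big_dep xpredT) //=; apply: eq_bigr => k _.
rewrite -mulr_suml; congr (_ * _).
have [Gk|Gk] := boolP (G (st k)).
  have /and4P[g1 g2 g3 g4] := Gk.
  rewrite big_mkcond (bigD1_seq (st k)) ?iota_uniq ?mem_index_iota ?g1 ?ltnS//=.
  rewrite g3 g4 eqxx /= big1 ?addr0// => n ne; rewrite [st k == n]eq_sym (negbTE ne).
  by case: ifP.
rewrite big_nat_cond big1// => n /andP[/andP[n0 nN] /andP[/andP[ns sn] _]].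
case: eqP => // e; case/negP: Gk.
by rewrite e; apply/and4P; split; rewrite // -ltnS.
Qed.

(** The lower bound of [not_wm_arc] holds for every window length, so stage [i] can use blocks of
    length [i.+1]. Each stage is long enough to make the earlier ones negligible in its average. As
    the block lengths tend to infinity, the resulting set changes on a set of density zero; it is
    finally intersected with the arc set. *)
Lemma core_almost_periodic (u : nat -> R[i]) : bounded_cseq u -> ~ nearly_weakly_mixing u ->
  exists b : nat -> bool, almost_periodic (R := R) b /\
    ~ ((fun N => normc (average N (fun n => (b n)%:R * u n))) @ \oo --> (0 : R)).
Proof.
move=> bu /(not_wm_arc bu)[Nq [L [al [J [j [d [inc NqL J0 d0 hd]]]]]]].
have mL : mean L by case: NqL.
have [C0 uC0] := bu; pose C := `|C0| + 1.
have C_gt0 : 0 < C by rewrite ltr_wpDl.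
pose v n := (arc_code al J n == j)%:R * u n.
have vC n : (0 < n)%N -> normc (v n) <= C.
  move=> n0; rewrite /v nrmM nrm_nat; case: eqP => _; rewrite ?mul1r ?mul0r; last exact: ltW.
  by rewrite (le_trans (uC0 n n0))// (le_trans (ler_norm _))// lerDl.
have bv : bounded_cseq v by exists C.
(* [X] consists of the end of the stage, the shift of its blocks and its indicator function. The
   estimate is stated for every [b] that agrees with it after [B], since earlier values are already
   fixed. *)
have step (iB : nat * nat) : exists X : nat * (nat * (nat -> bool)),
   [/\ (iB.2 + iB.1.+1 <= X.1)%N,
    forall n, X.2.2 n.+1 != X.2.2 n -> (iB.1.+1 %| n + X.2.1)%N &
    forall b : nat -> bool, (forall n, (iB.2 < n <= X.1)%N -> b n = X.2.2 n) ->
      X.1%:R * (d / 16) <= normc (\sum_(1 <= n < X.1.+1) (b n)%:R * v n)].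
  case: iB => i B /=; set m := i.+1.
  have [_ _ freq] := NqL.
  have lt : m%:R * (d / 2) < window L m v.
    rewrite (lt_le_trans _ (hd m isT))// ltr_pM2l ?ltr0n//; lra.
  (* [block_choice] leaves [N * d / 8]. With this [N], the first [B] terms and the overhang of
     length [m] cost at most half of it. *)
  pose N0 := (B + m + (Num.truncn (32 * B%:R * C / d + m%:R)).+1)%N.
  have [q qN hq] := freq _ _ (bdr_nrm (bdc_window m bv)) lt N0.
  set N := Nq q in hq.
  have NN0 : (N0 <= N)%N.
    have q0 : (0 < q)%N by apply: leq_trans qN; rewrite /N0; lia.
    exact: leq_trans qN (pos_increasing_ge inc q0).
  have Nr : 0 < N%:R :> R by rewrite ltr0n; move: NN0; rewrite /N0; lia.
  have big : 32 * B%:R * C / d + m%:R <= N%:R.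
    by rewrite (le_trans (ltW (truncnS_gt _)))// ler_nat; apply: leq_trans NN0; rewrite leq_addl.
  have hD : m%:R * (N%:R * (d / 2)) <= \sum_(1 <= n < N.+1) normc (\sum_(h < m) v (n + h)%N).
    move: hq; rewrite /average ltr_pdivlMr// => /ltW; apply: le_trans.
    by rewrite le_eqVlt; apply/orP; left; apply/eqP; ring.
  have [s [beta [hb hsum]]] := block_choice (ltn0Sn i) hD.
  exists ((N + m)%N, (s, beta)); split => //=; first by move: NN0; rewrite /N0; lia.
  move=> b hbb.
  have diff : normc (\sum_(1 <= n < (N + m).+1) (b n)%:R * v n - \sum_(1 <= n < (N + m).+1) (beta n)%:R * v n) <= B%:R * C.
    rewrite -sumrB (big_cat_nat (n := B.+1)) //=; last by move: NN0; rewrite /N0; lia.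
    rewrite [X in _ + X]big_nat [X in _ + X]big1 ?addr0; last first.
      move=> n /andP[n1 n2]; rewrite hbb ?subrr//; lia.
    rewrite (le_trans (nrm_sum _ _ _))//.
    have -> : B%:R * C = \sum_(1 <= n < B.+1) C by rewrite sumr_const_nat subn1 mulr_natl.
    rewrite big_nat [leRHS]big_nat; apply: ler_sum => n /andP[n0 _].
    rewrite -mulrBl nrmM -[leRHS]mul1r ler_pM ?nrm_ge0 ?vC//.
    by case: (b n); case: (beta n); rewrite ?subrr ?subr0 ?sub0r ?nrmN ?nrm0 ?nrm1.
  have h1 : normc (\sum_(1 <= n < (N + m).+1) (beta n)%:R * v n) <=
     normc (\sum_(1 <= n < (N + m).+1) (b n)%:R * v n) + B%:R * C.
    rewrite -lerBlDl (le_trans _ diff)// nrmBC lerBlDl (le_trans _ (nrmD _ _))//.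
    by rewrite subrKC.
  have h2 : 32 * B%:R * C + m%:R * d <= N%:R * d.
    move: big; rewrite -(ler_pM2r d0) mulrDl divfK// gt_eqF//.
  have BC0 : 0 <= B%:R * C by rewrite mulr_ge0// ltW.
  by rewrite natrD; lra.
(* Stage [i] occupies the integers in []NE i, NE i.+1]]; its end is the [B] of the next stage. *)
have [NE [bet [sh [NEgap betP sumP]]]] : exists (NE : nat -> nat) (bet : nat -> nat -> bool) (sh : nat -> nat),
  [/\ forall i, (NE i + i.+1 <= NE i.+1)%N,
     forall i n, bet i n.+1 != bet i n -> (i.+1 %| n + sh i)%N &
     forall i (b : nat -> bool), (forall n, (NE i < n <= NE i.+1)%N -> b n = bet i n) ->
      (NE i.+1)%:R * (d / 16) <= normc (\sum_(1 <= n < (NE i.+1).+1) (b n)%:R * v n)].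
  have {step}[X hX] := choice step.
  pose NE := fix NE i := if i is i'.+1 then (X (i', NE i')).1 else 0%N.
  exists NE, (fun i => (X (i, NE i)).2.2), (fun i => (X (i, NE i)).2.1).
  by split => [i|i n|i b]; have [h1 h2 h3] := hX (i, NE i); [exact: h1|exact: h2|exact: h3].
have NEmono i k : (i <= k)%N -> (NE i <= NE k)%N.
  by elim: k => [|k IH]; [rewrite leqn0 => /eqP ->|rewrite leq_eqVlt => /orP[/eqP -> //|/IH h]; have := NEgap k; lia].
have NEge i : (i <= NE i)%N by elim: i => // i IH; have := NEgap i; lia.
have exst n : exists i, (n <= NE i.+1)%N by exists n; have := NEge n.+1; lia.
pose stg n := ex_minn (exst n).
have stgP n : (n <= NE (stg n).+1)%N by rewrite /stg; case: ex_minnP.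
have stgm n i : (n <= NE i.+1)%N -> (stg n <= i)%N by rewrite /stg; case: ex_minnP => k _; apply.
have stg_lt n i : (i < stg n)%N -> (NE i.+1 < n)%N.
  by move=> h; rewrite ltnNge; apply/negP => /stgm; lia.
have stg_eq n i : (NE i < n <= NE i.+1)%N -> stg n = i.
  move=> /andP[h1 h2]; apply/eqP; rewrite eqn_leq stgm//= leqNgt; apply/negP => h.
  have := NEmono _ _ h; have := stgP n; lia.
have stgS n : stg n.+1 != stg n -> n = NE (stg n).+1.
  move=> ne; apply/eqP; rewrite eqn_leq stgP /= leqNgt; apply/negP => h.
  case/eqP: ne; apply/eqP; rewrite eqn_leq stgm//= leqNgt; apply/negP => h'.
  by have := stg_lt n _ h'; have := stgP n.+1; lia.
pose b n := bet (stg n) n.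
have bchange n : b n.+1 != b n -> (n == NE (stg n).+1) || ((stg n).+1 %| n + sh (stg n))%N.
  have [e|ne] := eqVneq (stg n.+1) (stg n).
    by rewrite /b e => /betP ->; rewrite orbT.
  by move=> _; rewrite -(stgS n ne) eqxx.
have apb : almost_periodic (R := R) b.
  apply: almost_periodic_slow => e e0.
  have [W W0 We] : exists2 W, (0 < W)%N & W%:R^-1 < e / 3.
    exists (Num.truncn ((e / 3)^-1)).+1 => //.
    by rewrite -[ltRHS]invrK ltf_pV2 ?posrE ?ltr0n ?invr_gt0 ?divr_gt0// truncnS_gt.
  have big a i : (NE W.+1 <= a)%N -> (0 < i)%N -> (W <= stg (a + i))%N.
    move=> h i0; rewrite leqNgt; apply/negP => h'.
    have := leq_trans (leq_trans (stgP (a + i)%N) (NEmono _ _ (leqW h'))) h.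
    by rewrite -{2}[a]addn0 leq_add2l leqNgt i0.
  have near_stg n n' : (n < n')%N -> (stg n <= stg n')%N.
    by move=> h; apply: stgm; have := stgP n'; lia.
  pose P0 n := n == NE (stg n).+1.
  (* Block edges of adjacent stages can be close to each other, hence the split by parity. Two edges
     of equal parity lie in the same stage, at a distance divisible by the block length, or have a
     whole stage between them. *)
  pose P1 n := odd (stg n) && ((stg n).+1 %| n + sh (stg n))%N.
  pose P2 n := ~~ odd (stg n) && ((stg n).+1 %| n + sh (stg n))%N.
  have s0 : sparse (e / 3) P0.
    apply: (@sparse_windows _ _ _ W (NE W.+1).+1) => // a i k aa /andP[ik kW] /eqP h1 /eqP h2.
    set n1 := (a + i)%N in h1; set n2 := (a + k)%N in h2.
    have lt : (n1 < n2)%N by rewrite /n1 /n2; lia.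
    have st_lt : (stg n1 < stg n2)%N.
      rewrite ltn_neqAle near_stg// andbT; apply/eqP => e1; move: lt; rewrite h1 h2 e1; lia.
    have st1 : (W <= stg n1)%N.
      have -> : n1 = (a.-1 + i.+1)%N by rewrite /n1; lia.
      by apply: big => //; lia.
    have := NEgap (stg n1).+1; have := NEmono (stg n1).+2 (stg n2).+1; rewrite -h1 -h2.
    by rewrite /n1 /n2 in st1 st_lt *; lia.
  have sdiv (Q : pred nat) : (forall p q, Q p -> Q q -> odd p = odd q) ->
      sparse (e / 3) (fun n => Q (stg n) && ((stg n).+1 %| n + sh (stg n))%N).
    move=> hQ; apply: (@sparse_windows _ _ _ W (NE W.+1).+1) => // a i k aa /andP[ik kW] /andP[q1 d1] /andP[q2 d2].
    set n1 := (a + i)%N in q1 d1; set n2 := (a + k)%N in q2 d2.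
    have lt : (n1 < n2)%N by rewrite /n1 /n2; lia.
    have st1 : (W <= stg n1)%N.
      have -> : n1 = (a.-1 + i.+1)%N by rewrite /n1; lia.
      by apply: big => //; lia.
    have par := hQ _ _ q1 q2.
    have [e1|ne] := eqVneq (stg n1) (stg n2).
      rewrite e1 in d1 st1; have := dvdn_sub d2 d1.
      have -> : (n2 + sh (stg n2) - (n1 + sh (stg n2)) = k - i)%N by rewrite /n1 /n2; lia.
      by move/dvdn_leq; lia.
    have st2 : ((stg n1).+1 < stg n2)%N.
      have := near_stg _ _ lt; move: ne par; clear; lia.
    have := stg_lt _ _ st2; have := NEgap (stg n1).+1; have := stgP n1.
    by rewrite /n1 /n2 in st1 *; lia.
  have s1 : sparse (e / 3) P1 by apply: (sdiv (fun p => odd p)) => p q -> ->.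
  have s2 : sparse (e / 3) P2 by apply: (sdiv (fun p => ~~ odd p)) => p q /negbTE -> /negbTE ->.
  have -> : e = e / 3 + (e / 3 + e / 3) by field.
  apply: sparse_sub (sparseU s0 (sparseU s1 s2)) => n /bchange.
  rewrite /P0 /P1 /P2; case: (n == _) => //=; case: odd => /=; rewrite ?orbF//.
exists (fun n => b n && (arc_code al J n == j)); split.
  have := almost_periodic_image (fun p : bool * nat => p.1 && (p.2 == j))
    (almost_periodic_pair apb (almost_periodic_arc al J0)).
  by [].
move=> cv; have d16 : 0 < d / 16 by rewrite divr_gt0.
move/cvgrPdist_lt: cv => h; case: (h _ d16) => n0 _ hn0.
have n0N : (n0 <= NE n0.+1)%N by have := NEge n0.+1; lia.
have {hn0} := hn0 _ n0N; rewrite /= sub0r normrN ger0_norm ?nrm_ge0// ltNge => /negP; apply.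
have Nr : 0 < (NE n0.+1)%:R :> R by rewrite ltr0n; have := NEge n0.+1; lia.
rewrite /average nrmM nrm_inv nrm_nat ler_pdivlMr// mulrC.
have -> : \sum_(1 <= n < (NE n0.+1).+1) (b n && (arc_code al J n == j))%:R * u n =
   \sum_(1 <= n < (NE n0.+1).+1) (b n)%:R * v n.
  by apply: eq_bigr => n _; rewrite /v mulrA -natrM mulnb.
by apply: sumP => n hn; rewrite /b (stg_eq n n0).
Qed.
End Blocks.

(** * Polynomials on the unit circle *)

Section CirclePolynomials.
Context {R : realType}.
Implicit Types (F p : {poly R[i]}) (t : R).

Lemma nrm_poly_circle F t : normc F.[E t] <= \sum_(i < size F) normc F`_i.
Proof.
rewrite horner_coef (le_trans (nrm_sum _ _ _))//; apply: ler_sum => i _.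
by rewrite nrmM nrmX nrmE expr1n mulr1.
Qed.

Lemma half_plane_quotient (w : R[i]) : 0 <= Re w -> let q := w / (1 + w) in
  [/\ 1 + Re w <= normc (1 + w), normc q ^+ 2 <= Re q, normc q <= 1, normc q <= normc w &
      1 - q = (1 + w)^-1].
Proof.
move=> w0 q; have h1 : 1 + Re w <= normc (1 + w) by rewrite (le_trans _ (cRe_le_nrm _))// cReD.
have n1 : 1 <= normc (1 + w) by rewrite (le_trans _ h1)// lerDl.
have n0 : 0 < normc (1 + w) by apply: lt_le_trans n1.
have w1 : 1 + w != 0 by rewrite -nrm_eq0 gt_eqF.
have nq : normc q = normc w / normc (1 + w) by rewrite nrmM nrm_inv.
have sq : normc (1 + w) ^+ 2 = (1 + Re w) ^+ 2 + Im w ^+ 2 by rewrite sqr_nrm cReD cImD /= add0r.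
have Rq : Re q = (Re w + normc w ^+ 2) / normc (1 + w) ^+ 2.
  have -> : q = ((normc (1 + w) ^+ 2)^-1)%:C%C * (w * conjc (1 + w)).
    rewrite mulrCA /q; congr (_ * _); apply: (mulfI w1).
    rewrite mulfV// mulrCA mulcJ -rmorphM /= mulVf//.
    by rewrite expf_neq0// gt_eqF.
  rewrite cReMC mulrC conjcD conjc1 mulrDr mulr1 cReD mulcJ cReC//.
have q2 : normc q ^+ 2 <= Re q.
  by rewrite nq Rq expr_div_n ler_pM2r ?invr_gt0 ?exprn_gt0// lerDr.
split => //.
- have : normc q ^+ 2 <= normc q by rewrite (le_trans q2)// cRe_le_nrm.
  have := nrm_ge0 q; rewrite expr2; nra.
- by rewrite nq ler_pdivrMr// ler_peMr// nrm_ge0.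
- by rewrite /q; field.
Qed.

(* [p] approximates [F / (1 + F)], which maps the half plane [Re >= 0] to the
   disc [|w|^2 <= Re w]; the inverse of [1 + F] is a Neumann series. *)
Lemma disc_polynomial F (k : R) : (forall t, 0 <= Re F.[E t]) -> 0 < k ->
  exists p, forall t, [/\ normc p.[E t] ^+ 2 <= Re p.[E t] + k,
    normc p.[E t] <= 1 + k, normc p.[E t] <= normc F.[E t] + k &
    normc (1 - p.[E t]) <= (1 + Re F.[E t])^-1 + k].
Proof.
move=> F0 k0.
pose C := 1 + \sum_(i < size F) normc F`_i.
have C1 : 1 <= C by rewrite lerDl sumr_ge0// => i _; exact: nrm_ge0.
have C0 : 0 < C by apply: lt_le_trans C1.
have FC t : normc (1 + F.[E t]) <= C.
  by rewrite (le_trans (nrmD _ _))// nrm1 lerD2l nrm_poly_circle.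
pose s := (C ^+ 2)^-1.
have s0 : 0 < s by rewrite invr_gt0 exprn_gt0.
have s1 : s <= 1 by rewrite invf_le1 ?exprn_gt0// exprn_ege1.
(* Writing [W] for [1 + F], one has [|1 - s W|^2 = 1 - 2 s Re W + s^2 |W|^2 <= 1 - s], since
   [Re W >= 1] and [s |W|^2 <= 1]. *)
pose r : {poly R[i]} := 1 - (s%:C)%C%:P * (1 + F).
have rE t : normc r.[E t] ^+ 2 <= 1 - s.
  rewrite /r !hornerE; set w := F.[E t].
  have w0 : 0 <= Re w := F0 t.
  have h : normc (1 + w) ^+ 2 <= C ^+ 2 by rewrite ler_pXn2r ?nnegrE ?nrm_ge0 ?(ltW C0)// FC.
  have h2 : s * normc (1 + w) ^+ 2 <= 1 by rewrite mulrC ler_pdivrMr ?exprn_gt0// mul1r.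
  rewrite !sqr_nrm cReB cImB cReMC cImMC !cReD !cImD /= in h2 *.
  have h3 := ler_wpM2l (ltW s0) h2.
  nra.
(* Squaring a perturbation [k' <= 1] of a number of modulus at most [1] costs at most [3 * k'], and
   the real part costs one more [k']. *)
pose k' := Num.min 1 (k / 4).
have k'0 : 0 < k' by rewrite lt_min ltr01 divr_gt0.
have k'1 : k' <= 1 by rewrite ge_min lexx.
have k'4 : 4 * k' <= k.
  have : k' <= k / 4 by rewrite ge_min lexx orbT.
  by lra.
have [n hn] : exists n, (1 - s) ^+ n <= k' ^+ 2.
  have lt1 : `|1 - s| < 1 by rewrite ger0_norm ?subr_ge0//; lra.
  have /cvgrPdist_le h := cvg_expr lt1.
  case: (h (k' ^+ 2) (exprn_gt0 _ k'0)) => n _ /(_ n (leqnn n)) /=.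
  by rewrite sub0r normrN ger0_norm ?exprn_ge0 ?subr_ge0// => hn; exists n.
(* Truncated Neumann series: the geometric sum telescopes, and the error with respect to
   [F / (1 + F)] is [r ^+ n / (1 + F)]. *)
exists (1 - (s%:C)%C%:P * \sum_(i < n) r ^+ i) => t.
set pv := horner _ _; set w := F.[E t].
have [h1 q2 q1 qw q1E] := half_plane_quotient (F0 t).
have n1 : 1 <= normc (1 + w) by rewrite (le_trans _ h1)// lerDl; exact: F0.
have n0 : 0 < normc (1 + w) by apply: lt_le_trans n1.
have w1 : 1 + w != 0 by rewrite -nrm_eq0 gt_eqF.
set q := _ / _ in q2 q1 qw q1E.
have pq : normc (pv - q) <= k'.
  have -> : pv - q = r.[E t] ^+ n / (1 + w).
    apply: (mulIf w1); rewrite divfK// mulrBl divfK//.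
    rewrite /pv !hornerE horner_sum; under eq_bigr do rewrite horner_exp.
    have := subrX1 r.[E t] n.
    set S := \sum_(_ < n) _; have -> : r.[E t] = 1 - s%:C%C * (1 + w) by rewrite /r !hornerE.
    move=> e; have e' : (1 - s%:C%C * (1 + w)) ^+ n = 1 - s%:C%C * (1 + w) * S by rewrite -[LHS](subrK 1) e; ring.
    by rewrite e' -/w; ring.
  rewrite nrmM nrm_inv nrmX ler_pdivrMr// -(@ler_pXn2r _ 2) ?nnegrE ?exprn_ge0 ?nrm_ge0 ?mulr_ge0 ?(ltW k'0) ?nrm_ge0//.
  rewrite exprAC (le_trans (lerXn2r n _ _ (rE t))) ?nnegrE ?sqr_ge0 ?subr_ge0//.
  rewrite (le_trans hn)// exprMn ler_peMr ?sqr_ge0// exprn_ege1//.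
have pn : normc pv <= normc q + k'.
  by rewrite -[pv](subrK q) addrC (le_trans (nrmD _ _))// lerD2l.
have k'k : k' <= k by lra.
split.
- have h2 : normc pv ^+ 2 <= (normc q + k') ^+ 2.
    by rewrite ler_pXn2r ?nnegrE ?addr_ge0 ?nrm_ge0// ltW.
  have h3 : Re q <= Re pv + k'.
    rewrite -lerBlDl -cReB (le_trans (cRe_le_nrm _))// nrmBC//.
  have h4 : k' ^+ 2 <= k' by rewrite expr2 ler_piMr// ltW.
  have h5 : normc q * k' <= k' by rewrite ler_piMl// ltW.
  by move: h2; rewrite sqrrD -mulr_natl; lra.
- lra.
- by have := qw; rewrite -/w; lra.
- have -> : 1 - pv = (1 + w)^-1 - (pv - q) by rewrite -q1E; ring.
  rewrite (le_trans (nrmB _ _))// lerD ?(le_trans pq)// nrm_inv lef_pV2 ?posrE//.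
  by rewrite ltr_wpDr//; exact: F0.
Qed.

(** [Re F] is a discretised Fejer mean of [b] over the [N]-th roots of unity. The kernel is
    nonnegative, its sum over the nodes is [N], and it is small at nodes far from [t]. The
    hypothesis is a modulus of continuity in terms of chords, so that [0] and [1] count as the same
    point. *)
Lemma fejer_approx (b : R -> R) (M eps c : R) : 0 < eps -> 0 < c ->
  (forall t, 0 <= t <= 1 -> 0 <= b t <= M) ->
  (forall t s, 0 <= t <= 1 -> 0 <= s <= 1 ->
    `|b t - b s| <= eps \/ c <= normc (E t - E s) ^+ 2) ->
  exists F, [/\ forall t, 0 <= Re F.[E t],
    forall t, 0 <= t <= 1 -> `|Re F.[E t] - b t| <= 2 * eps & F.[0] = (Re F.[0])%:C%C].
Proof.
move=> eps0 c0 bM bc.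
have M0 : 0 <= M by have /andP[h1 h2] := bM 0 (introT andP (conj (lexx 0) ler01)); exact: le_trans h2.
(* At far nodes the kernel is at most [4 / (N * c)] while [b] varies by at most [M]; together they
   contribute at most [eps]. *)
pose N := (Num.truncn (4 * M / (c * eps))).+1.
have Nr : 0 < N%:R :> R by rewrite ltr0n.
have hN : 4 * M / (N%:R * c) <= eps.
  rewrite ler_pdivrMr ?mulr_gt0//.
  by have := truncnS_gt (4 * M / (c * eps)); rewrite -/N ltr_pdivrMr ?mulr_gt0// => /ltW h; rewrite (le_trans h)// le_eqVlt; apply/orP; left; apply/eqP; ring.
pose w (s : nat) : R[i] := E (s%:R / N%:R).
pose bs (s : nat) := b (s%:R / N%:R).
have s01 (s : 'I_N) : 0 <= (s%:R / N%:R : R) <= 1.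
  by rewrite divr_ge0//= ler_pdivrMr// mul1r ler_nat ltnW.
have bs0 (s : 'I_N) : 0 <= bs s by have /andP[] := bM _ (s01 s).
(* This is [|m - m'|]. Conjugating the terms with a negative exponent keeps their real parts and
   turns the trigonometric polynomial into a genuine polynomial. *)
pose dist (m m' : nat) := ((m - m') + (m' - m))%N.
pose F : {poly R[i]} := \sum_(s < N) \sum_(m < N) \sum_(m' < N)
   (((bs s / N%:R ^+ 2)%:C)%C * conjc (w s) ^+ dist m m') *: 'X^(dist m m').
pose S (s : nat) t := \sum_(m < N) (E t * conjc (w s)) ^+ m.
pose ker (s : nat) t := normc (S s t) ^+ 2 / N%:R.
have nu (s : nat) t : normc (E t * conjc (w s)) = 1 by rewrite nrmM nrmJ !nrmE mulr1.
have ReF t : Re F.[E t] = (\sum_(s < N) bs s * ker s t) / N%:R.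
  rewrite horner_sum cRe_sum mulr_suml; apply: eq_bigr => s _.
  have -> : bs s * ker s t / N%:R = (bs s / N%:R ^+ 2) * Re (S s t * conjc (S s t)).
    by rewrite mulcJ cReC /ker; field; rewrite gt_eqF.
  rewrite /S conjc_sum mulr_suml -cReMC mulr_sumr horner_sum !cRe_sum; apply: eq_bigr => m _.
  rewrite mulr_sumr mulr_sumr horner_sum !cRe_sum; apply: eq_bigr => m' _.
  rewrite hornerZ hornerXn -mulrA cReMC [RHS]cReMC; congr (_ * _).
  rewrite mulrC -exprMn; set z := E t * _.
  have zz k : z ^+ k * conjc (z ^+ k) = 1 by rewrite mulcJ nrmX nu !expr1n.
  rewrite /dist; have [le|/ltnW le] := leqP m m'.
    have -> : (m - m' = 0)%N by apply/eqP; rewrite subn_eq0.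
    rewrite add0n -[in RHS](subnKC le) exprD conjcM mulrA zz mul1r cReJ//.
  have -> : (m' - m = 0)%N by apply/eqP; rewrite subn_eq0.
  by rewrite addn0 -[in RHS](subnK le) exprD -mulrA zz mulr1.
have kerge s t : 0 <= ker s t by rewrite divr_ge0// sqr_ge0.
have ker1 t : \sum_(s < N) ker s t = N%:R.
  rewrite /ker -mulr_suml; suff -> : \sum_(s < N) normc (S s t) ^+ 2 = N%:R * N%:R by rewrite mulfK// gt_eqF.
  have SE s : S s t * conjc (S s t) = \sum_(m < N) \sum_(m' < N)
      (E t ^+ m * conjc (E t ^+ m')) * (w s ^+ m' * conjc (w s ^+ m)).
    rewrite /S conjc_sum mulr_suml; apply: eq_bigr => m _.
    rewrite mulr_sumr; apply: eq_bigr => m' _.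
    by rewrite !exprMn conjcM !conjcX conjcK; ring.
  transitivity (Re (\sum_(s < N) S s t * conjc (S s t))).
    by rewrite cRe_sum; apply: eq_bigr => s _; rewrite mulcJ.
  under eq_bigr do rewrite SE.
  rewrite exchange_big /=.
  under eq_bigr => m _ do rewrite exchange_big /=.
  rewrite cRe_sum.
  have -> : N%:R * N%:R = \sum_(m < N) (N%:R : R) by rewrite sumr_const card_ord mulr_natl.
  apply: eq_bigr => m _; under eq_bigr => m' _ do
    rewrite -mulr_sumr unity_orth//.
  rewrite (bigD1 m) //= eqxx mulcJ nrmX nrmE !expr1n big1 ?addr0.
    by rewrite mulr1n mul1r -(rmorph_nat (real_complex R)).
  by move=> m' /negbTE m'm; rewrite -val_eqE /= in m'm; rewrite m'm mul0rn mulr0.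
(* The geometric sum satisfies [|S|^2 * |y - 1|^2 = |y ^+ N - 1|^2 <= 4]. *)
have kerf (s : 'I_N) t : c <= normc (E t - w s) ^+ 2 -> ker s t <= 4 / (N%:R * c).
  move=> h; set y := E t * conjc (w s).
  have y1 : normc (y - 1) ^+ 2 = normc (E t - w s) ^+ 2.
    have -> : E t - w s = (y - 1) * w s.
      by rewrite mulrBl mul1r -mulrA [conjc (w s) * _]mulrC EJ mulr1.
    by rewrite nrmM nrmE mulr1.
  have h1 : normc (S s t) ^+ 2 * c <= 4.
    apply: (@le_trans _ _ (normc (S s t) ^+ 2 * normc (y - 1) ^+ 2)).
      by rewrite ler_wpM2l ?sqr_ge0// y1.
    rewrite -exprMn -nrmM mulrC -subrX1.
    have -> : 4 = 2 ^+ 2 :> R by ring.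
    rewrite ler_pXn2r ?nnegrE ?nrm_ge0// (le_trans (nrmB _ _))//.
    by rewrite nrmX nu expr1n nrm1.
  have -> : 4 / (N%:R * c) = (4 / c) / N%:R by field; rewrite !gt_eqF.
  by rewrite /ker ler_pM2r ?invr_gt0// ler_pdivlMr.
exists F; split.
- by move=> t; rewrite ReF divr_ge0// sumr_ge0// => s _; rewrite mulr_ge0.
- move=> t t01.
  have -> : Re F.[E t] - b t = (\sum_(s < N) (bs s - b t) * ker s t) / N%:R.
    rewrite ReF; under [X in _ = X / _]eq_bigr do rewrite mulrBl.
    by rewrite sumrB -mulr_sumr ker1 mulrBl mulfK// gt_eqF.
  rewrite normrM normfV normr_nat ler_pdivrMr//.
  rewrite (le_trans (ler_norm_sum _ _ _))//.
  apply: (@le_trans _ _ (\sum_(s < N) (eps * ker s t + M * (4 / (N%:R * c))))).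
    apply: ler_sum => s _; rewrite normrM [X in _ * X]ger0_norm//.
    have MM : 0 <= M * (4 / (N%:R * c)) by rewrite mulr_ge0 ?divr_ge0 ?mulr_ge0// ltW.
    have [h|h] := bc _ _ (s01 s) t01.
      by rewrite -[leLHS]addr0 lerD// ler_wpM2r.
    rewrite -[leLHS]add0r; apply: lerD; first by rewrite mulr_ge0// ltW.
    rewrite ler_pM//; last by apply: kerf; rewrite nrmBC.
    have /andP[a1 a2] := bM _ (s01 s); have /andP[b1 b2] := bM _ t01.
    by rewrite ler_norml; apply/andP; split; rewrite /bs; lra.
  rewrite big_split /= -mulr_sumr ker1 sumr_const card_ord.
  have -> : M * (4 / (N%:R * c)) *+ N = N%:R * (4 * M / (N%:R * c)) by rewrite -[_ *+ N]mulr_natl; ring.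
  have := ler_wpM2l (ltW Nr) hN; lra.
- have F00 : F.[0] = \sum_(s < N) \sum_(m < N) \sum_(m' < N) (((bs s / N%:R ^+ 2) * (m == m')%:R)%:C)%C.
    rewrite horner_sum; apply: eq_bigr => s _; rewrite horner_sum; apply: eq_bigr => m _.
    rewrite horner_sum; apply: eq_bigr => m' _; rewrite hornerZ hornerXn.
    have [<-|ne] := eqVneq m m'; first by rewrite /dist subnn addn0 !expr0 !mulr1.
    have d0 : (0 < dist m m')%N by move: ne; rewrite -val_eqE /dist /=; lia.
    by rewrite (expr0n _ (dist m m')) gtn_eqF// mulr0 mulr0.
  rewrite F00; apply: cplxP => //; rewrite cImC cIm_sum big1// => s _.
  by rewrite cIm_sum big1// => m _; rewrite cIm_sum big1.
Qed.
End CirclePolynomials.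

(** * Complex-valued integrals over finite measures *)

Section ComplexIntegral.
Context {R : realType} {dT : measure_display} {T : measurableType dT}.
Variable mu : {finite_measure set T -> \bar R}.
Variable D : set T.
Hypothesis mD : measurable D.
Implicit Types (f g : T -> R[i]).

Lemma finite_mu : (mu D < +oo)%E.
Proof. by rewrite ltey_eq fin_num_measure. Qed.

Lemma bounded_integrable (g : T -> R) (M : R) : measurable_fun setT g ->
  (forall t, D t -> `|g t| <= M) -> mu.-integrable D (EFin \o g).
Proof.
move=> mg gM; apply: measurable_bounded_integrable => //; first exact: finite_mu.
  exact: measurable_funTS.
exists M; split; first exact: num_real.
by move=> x Mx t Dt; apply: (le_trans (gM t Dt)); exact: ltW.
Qed.

Lemma cintegrableD f g : cintegrable mu D f -> cintegrable mu D g ->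
  cintegrable mu D (fun t => f t + g t).
Proof.
move=> [f1 f2] [g1 g2]; split.
  by apply: eq_integrable (integrableD mD f1 g1) => // t _; rewrite cReD EFinD.
by apply: eq_integrable (integrableD mD f2 g2) => // t _; rewrite cImD EFinD.
Qed.

Lemma cintegralD f g : cintegrable mu D f -> cintegrable mu D g ->
  cintegral mu D (fun t => f t + g t) = cintegral mu D f + cintegral mu D g.
Proof.
move=> [f1 f2] [g1 g2]; apply: cplxP; rewrite ?cReD ?cImD /=.
  by rewrite -RintegralD//; apply: eq_Rintegral => t _; rewrite cReD.
by rewrite -RintegralD//; apply: eq_Rintegral => t _; rewrite cImD.
Qed.

Lemma cintegrableZ (c : R[i]) f : cintegrable mu D f -> cintegrable mu D (fun t => c * f t).
Proof.
move=> [f1 f2]; split.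
  apply: eq_integrable (integrableB mD (integrableZl mD (Re c) f1) (integrableZl mD (Im c) f2)) => // t _.
  by rewrite cReM EFinB !EFinM.
apply: eq_integrable (integrableD mD (integrableZl mD (Re c) f2) (integrableZl mD (Im c) f1)) => // t _.
by rewrite cImM EFinD !EFinM.
Qed.

Lemma cintegralZ (c : R[i]) f : cintegrable mu D f ->
  cintegral mu D (fun t => c * f t) = c * cintegral mu D f.
Proof.
move=> [f1 f2].
have i1 a (g : T -> R) : mu.-integrable D (EFin \o g) -> mu.-integrable D (EFin \o (fun t => a * g t)).
  by move=> h; apply: eq_integrable (integrableZl mD a h) => // t _; rewrite /= EFinM.
apply: cplxP; [rewrite [RHS]cReM /=|rewrite [RHS]cImM /=].
  rewrite -!RintegralZl// -RintegralB//; [|exact: i1..].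
  by apply: eq_Rintegral => t _; rewrite cReM.
rewrite -!RintegralZl// -RintegralD//; [|exact: i1..].
by apply: eq_Rintegral => t _; rewrite cImM.
Qed.

Lemma cintegralJ f : cintegrable mu D f ->
  cintegral mu D (fun t => conjc (f t)) = conjc (cintegral mu D f).
Proof.
move=> [f1 f2]; apply: cplxP; rewrite ?cReJ ?cImJ /=.
  by apply: eq_Rintegral => t _; rewrite cReJ.
rewrite -mulN1r -RintegralZl//; apply: eq_Rintegral => t _.
by rewrite cImJ mulN1r.
Qed.

Lemma cintegrable0 : cintegrable mu D (fun=> 0).
Proof.
by split; apply: (@bounded_integrable (fun=> 0) 0) => // t _; rewrite normr0.
Qed.

Lemma cintegrable_sum (I : Type) (r : seq I) (F : I -> T -> R[i]) :
  (forall i, cintegrable mu D (F i)) -> cintegrable mu D (fun t => \sum_(i <- r) F i t) /\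
  cintegral mu D (fun t => \sum_(i <- r) F i t) = \sum_(i <- r) cintegral mu D (F i).
Proof.
move=> iF; elim: r => [|i r [IH1 IH2]].
  have -> : (fun t => \sum_(i <- [::]) F i t) = (fun=> 0).
    by apply/funext => t; rewrite big_nil.
  split; first exact: cintegrable0.
  rewrite big_nil; apply: cplxP => /=; by rewrite Rintegral_cst// mul0r.
have -> : (fun t => \sum_(j <- i :: r) F j t) = (fun t => F i t + \sum_(j <- r) F j t).
  by apply/funext => t; rewrite big_cons.
by split; [exact: cintegrableD|rewrite cintegralD// IH2 big_cons].
Qed.

Lemma cintegrable1 : cintegrable mu D (fun=> 1).
Proof.
by split; [apply: (@bounded_integrable (fun=> 1) 1)|apply: (@bounded_integrable (fun=> 0) 1)] => // t _ ; rewrite ?normr1 ?normr0.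
Qed.

End ComplexIntegral.

(** * Integration of trigonometric polynomials *)

Section CircleIntegral.
Context {R : realType}.
Local Notation RB := (measurableTypeR R).
Variable mu : {finite_measure set RB -> \bar R}.
Variable D : set RB.
Hypothesis mD : measurable D.
Implicit Types (f g : RB -> R[i]).

Lemma measurable_Re_Eexp h : measurable_fun setT (fun t : RB => Re (E t ^+ h)).
Proof.
have -> : (fun t : RB => Re (E t ^+ h)) = (fun t => cos (2 * pi * h%:R * t)).
  by apply/funext => t; rewrite -expi_nat.
apply: continuous_measurable_fun => t.
by apply: continuous_comp; [exact: cvgMr|exact: continuous_cos].
Qed.
Lemma measurable_Im_Eexp h : measurable_fun setT (fun t : RB => Im (E t ^+ h)).
Proof.
have -> : (fun t : RB => Im (E t ^+ h)) = (fun t => sin (2 * pi * h%:R * t)).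
  by apply/funext => t; rewrite -expi_nat.
apply: continuous_measurable_fun => t.
by apply: continuous_comp; [exact: cvgMr|exact: continuous_sin].
Qed.

Lemma measurable_poly_circle (p : {poly R[i]}) :
  measurable_fun setT (fun t : RB => Re p.[E t]) /\ measurable_fun setT (fun t : RB => Im p.[E t]).
Proof.
split.
  have -> : (fun t : RB => Re p.[E t]) = (fun t => \sum_(i < size p) (Re p`_i * Re (E t ^+ i) - Im p`_i * Im (E t ^+ i))).
    by apply/funext => t; rewrite horner_coef cRe_sum; apply: eq_bigr => i _; rewrite cReM.
  apply: measurable_sum => i; apply: measurable_funB; apply: measurable_funM => //.
    exact: measurable_Re_Eexp.
  exact: measurable_Im_Eexp.
have -> : (fun t : RB => Im p.[E t]) = (fun t => \sum_(i < size p) (Re p`_i * Im (E t ^+ i) + Im p`_i * Re (E t ^+ i))).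
  by apply/funext => t; rewrite horner_coef cIm_sum; apply: eq_bigr => i _; rewrite cImM.
apply: measurable_sum => i; apply: measurable_funD; apply: measurable_funM => //.
  exact: measurable_Im_Eexp.
exact: measurable_Re_Eexp.
Qed.

Lemma cintegrable_EJ i j : cintegrable mu D (fun t => E t ^+ i * conjc (E t ^+ j)).
Proof.
have bd t : normc (E t ^+ i * conjc (E t ^+ j)) <= 1.
  by rewrite nrmM nrmJ !nrmX nrmE !expr1n mulr1.
split; apply: (bounded_integrable mu mD (M := 1)) => [|t _].
- have -> : (fun t : RB => Re (E t ^+ i * conjc (E t ^+ j))) =
    (fun t => Re (E t ^+ i) * Re (E t ^+ j) + Im (E t ^+ i) * Im (E t ^+ j)).
    by apply/funext => t; rewrite cReM cReJ cImJ; ring.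
  by apply: measurable_funD; apply: measurable_funM;
    [exact: measurable_Re_Eexp|exact: measurable_Re_Eexp|exact: measurable_Im_Eexp|exact: measurable_Im_Eexp].
- by apply: (le_trans (cRe_nrm _)); exact: bd.
- have -> : (fun t : RB => Im (E t ^+ i * conjc (E t ^+ j))) =
    (fun t => Im (E t ^+ i) * Re (E t ^+ j) - Re (E t ^+ i) * Im (E t ^+ j)).
    by apply/funext => t; rewrite cImM cReJ cImJ; ring.
  by apply: measurable_funB; apply: measurable_funM;
    [exact: measurable_Im_Eexp|exact: measurable_Re_Eexp|exact: measurable_Re_Eexp|exact: measurable_Im_Eexp].
- by apply: (le_trans (cIm_nrm _)); exact: bd.
Qed.

Lemma cintegrable_mul_poly f (p : {poly R[i]}) : cintegrable mu D f ->
  cintegrable mu D (fun t => f t * p.[E t]).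
Proof.
move=> [f1 f2]; have [m1 m2] := measurable_poly_circle p.
have bd (g : RB -> R) : (forall t, `|g t| <= normc p.[E t]) -> [bounded g x | x in D].
  move=> hg; exists (\sum_(i < size p) normc p`_i); split; first exact: num_real.
  by move=> x Mx t Dt; apply: (le_trans (hg t)); apply: (le_trans (nrm_poly_circle _ _)); exact: ltW.
have b1 : [bounded Re p.[E x] | x in D] by apply: bd => t; exact: cRe_nrm.
have b2 : [bounded Im p.[E x] | x in D] by apply: bd => t; exact: cIm_nrm.
have m1' : measurable_fun D (fun t : RB => Re p.[E t]) := measurable_funTS m1.
have m2' : measurable_fun D (fun t : RB => Im p.[E t]) := measurable_funTS m2.
split.
  apply: eq_integrable (integrableB mD (integrableMl mD f1 m1' b1) (integrableMl mD f2 m2' b2)) => // t _.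
  by rewrite cReM EFinB !EFinM.
apply: eq_integrable (integrableD mD (integrableMl mD f1 m2' b2) (integrableMl mD f2 m1' b1)) => // t _.
by rewrite cImM EFinD !EFinM.
Qed.

Lemma cintegral_mul_poly f (p : {poly R[i]}) : cintegrable mu D f ->
  cintegral mu D (fun t => f t * p.[E t]) =
  \sum_(h < size p) p`_h * cintegral mu D (fun t => f t * E t ^+ h).
Proof.
move=> fi; have fE h : cintegrable mu D (fun t => f t * E t ^+ h).
  have := cintegrable_mul_poly 'X^h fi; congr cintegrable.
  by apply/funext => t; rewrite hornerXn.
have [_ h2] := cintegrable_sum mD (index_enum 'I_(size p)) (fun h : 'I_(size p) => cintegrableZ mD p`_h (fE h)).
under [RHS]eq_bigr => h _ do rewrite -(cintegralZ mD p`_h (fE h)).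
rewrite -h2.
congr cintegral; apply/funext => t; rewrite horner_coef mulr_sumr.
by apply: eq_bigr => h _; rewrite mulrCA.
Qed.

End CircleIntegral.

(** * Fourier orthogonality for Lebesgue measure *)

Section LebesgueCircle.
Context {R : realType}.
Local Notation RB := (measurableTypeR R).
Local Notation leb := (@lebesgue01 R).

Lemma Rintegral_lebesgue01 (g : R -> R) :
  \int[leb]_(t in unitI) g t = \int[@lebesgue_measure R]_(t in `[0, 1]%classic) g t.
Proof.
rewrite /Rintegral; congr fine; apply: eq_measure_integral => A mA AD.
by rewrite -[LHS]/(@lebesgue_measure R (A `&` unitI)) setIidl.
Qed.

Lemma is_derive_linear (k t : R) : is_derive t (1 : R) (fun s : R => k * s) k.
Proof.
have := @is_deriveZ R R R id k t 1 1 (is_derive_id t 1).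
by rewrite /GRing.scale /= mulr1.
Qed.

Lemma integral_periodic_derivative (F f : R -> R) : (forall t : R, is_derive t (1 : R) F (f t)) ->
  continuous f -> F 1 = F 0 -> \int[leb]_(t in unitI) f t = 0.
Proof.
move=> dF cf F10; rewrite Rintegral_lebesgue01 /Rintegral.
have cF : continuous F.
  by move=> t; apply: differentiable_continuous; apply/derivable1_diffP; case: (dF t).
rewrite (@continuous_FTC2 _ f F 0 1 ltr01).
- by rewrite F10 subee.
- exact: continuous_subspaceT.
- split=> [t _||]; first by case: (dF t).
    exact/cvg_at_right_filter/cF.
  exact/cvg_at_left_filter/cF.
- by move=> t _; rewrite derive1E; apply: derive_val; exact: dF.
Qed.

Lemma cintegral_Eexp h : cintegral leb unitI (fun t => E t ^+ h) = (h == 0%N)%:R.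
Proof.
have [->|h0] := eqVneq h 0%N.
  under eq_fun do rewrite expr0; apply: cplxP => /=.
    rewrite Rintegral_cst; last exact: measurable_unitI.
    rewrite mul1r -[X in fine X]/(@lebesgue_measure R (unitI `&` unitI)) setIid.
    by rewrite /unitI lebesgue_measure_itv /= lte_fin ltr01 oppr0 adde0.
  by rewrite Rintegral_cst ?mul0r//; exact: measurable_unitI.
pose k : R := 2 * pi * h%:R.
have k0 : k != 0 by rewrite !mulf_neq0 ?pnatr_eq0// gt_eqF ?pi_gt0.
have kE : E 1 ^+ h = Complex (cos k) (sin k) by rewrite -expi_nat mulr1.
rewrite E1 expr1n in kE.
have ck : cos k = 1 by have := congr1 (@complex.Re R) kE.
have sk : sin k = 0 by have := congr1 (@complex.Im R) kE.
have cl : continuous (fun t : R => k * t) by move=> t; exact: cvgMr.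
have ds (t : R) : is_derive t (1 : R) (fun s : R => k^-1 * sin (k * s)) (cos (k * t)).
  have h1 := is_derive1_comp (f := @sin R) (g := fun s => k * s) (is_derive_sin (k * t)) (is_derive_linear k t).
  have := @is_deriveZ R R R _ k^-1 t 1 _ h1.
  by rewrite /GRing.scale /= mulrCA mulVf// mulr1.
have dc (t : R) : is_derive t (1 : R) (fun s : R => (- k^-1) * cos (k * s)) (sin (k * t)).
  have h1 := is_derive1_comp (f := @cos R) (g := fun s => k * s) (is_derive_cos (k * t)) (is_derive_linear k t).
  have := @is_deriveZ R R R _ (- k^-1) t 1 _ h1.
  by rewrite /GRing.scale /= mulNr mulNr mulrN opprK mulrCA mulVf// mulr1.
apply: cplxP => /=.
  rewrite -[RHS](integral_periodic_derivative ds); last 2 first.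
  - by move=> t; apply: continuous_comp; [exact: cl|exact: continuous_cos].
  - by rewrite mulr1 mulr0 sk sin0.
  by apply: eq_Rintegral => t _; rewrite -expi_nat.
rewrite -[RHS](integral_periodic_derivative dc).
- by apply: eq_Rintegral => t _; rewrite -expi_nat.
- by move=> t; apply: continuous_comp; [exact: cl|exact: continuous_sin].
- by rewrite mulr1 mulr0 ck cos0.
Qed.

(** The mean value property: without negative powers only the constant coefficient survives. Applied
    to [F ^+ 2] it compares the imaginary part of [F] with its real part. *)
Lemma cintegral_poly_circle (p : {poly R[i]}) : cintegral leb unitI (fun t => p.[E t]) = p.[0].
Proof.
have := cintegral_mul_poly measurable_unitI p (cintegrable1 leb measurable_unitI).
under eq_fun do rewrite mul1r.
move=> ->; rewrite horner_coef; apply: eq_bigr => i _; congr (_ * _).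
by under eq_fun do rewrite mul1r; rewrite cintegral_Eexp expr0n.
Qed.

End LebesgueCircle.

(** * A bump small for Lebesgue measure and full for a singular measure *)

Section SingularBump.
Context {R : realType}.
Local Notation RB := (measurableTypeR R).
Local Notation leb := (@lebesgue01 R).

Definition dist_to (C : set R) (t : R) : R := inf [set `|t - s| | s in C].

Section Distance.
Variables (C : set R) (c0 : R).
Hypothesis Cc0 : C c0.

Lemma has_inf_dist t : has_inf [set `|t - s| | s in C].
Proof.
by split; [exists `|t - c0|, c0|exists 0 => _ [s _ <-]].
Qed.
Lemma dist_to_ge0 t : 0 <= dist_to C t.
Proof. by apply: lb_le_inf => [|_ [s _ <-]//]; exact: (has_inf_dist t).1. Qed.
Lemma dist_to_le t s : C s -> dist_to C t <= `|t - s|.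
Proof. by move=> Cs; apply: ge_inf; [exact: (has_inf_dist t).2|exists s]. Qed.
Lemma dist_to_lip t s : `|dist_to C t - dist_to C s| <= `|t - s|.
Proof.
wlog: t s / dist_to C s <= dist_to C t.
  move=> H; have [/H//|/ltW/H] := leP (dist_to C s) (dist_to C t).
  by rewrite distrC [leRHS]distrC.
move=> st; rewrite ger0_norm ?subr_ge0// lerBlDl -lerBlDr.
apply: lb_le_inf => [|_ [c Cc <-]]; first exact: (has_inf_dist s).1.
rewrite lerBlDr (le_trans (dist_to_le t Cc))//.
have -> : t - c = (s - c) + (t - s) by ring.
exact: ler_normD.
Qed.
Lemma dist_to_ge t r : (forall s, C s -> r <= `|t - s|) -> r <= dist_to C t.
Proof. by move=> h; apply: lb_le_inf => [|_ [s Cs <-]]; [exact: (has_inf_dist t).1|exact: h]. Qed.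
Lemma dist_to_continuous : continuous (dist_to C).
Proof.
move=> t; apply/cvgrPdist_le => e e0.
apply: filterS (nbhsx_ballx t e e0) => s ts.
by rewrite (le_trans (dist_to_lip t s))// ltW.
Qed.
End Distance.

(** The symmetry of [u] and [1 - u] reduces to [u <= 1 / 2], where the cosine decreases. This bounds
    from below the chord between points whose parameters differ neither by nearly [0] nor by nearly
    [1]. *)
Lemma cos_gap (r u : R) : 0 < r -> r <= u <= 1 - r -> cos (2 * pi * u) <= cos (2 * pi * r).
Proof.
have p0 : 0 < pi :> R := pi_gt0 R.
wlog u2 : u / u <= 1 / 2.
  move=> H r0 /andP[h1 h2]; have [le|/ltW le] := leP u (1 / 2); first by apply: H => //; rewrite h1.
  have -> : cos (2 * pi * u) = cos (2 * pi * (1 - u)).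
    have -> : 2 * pi * (1 - u) = - (2 * pi * u) + pi *+ 2 by rewrite -[pi *+ 2]mulr_natl; ring.
    by rewrite cosD2pi cosN.
  by apply: H => //; lra.
move=> r0 /andP[h1 h2].
have pu (v : R) : 0 <= v -> v <= 1 / 2 -> 2 * pi * v \in `[0, pi].
  move=> v0 v1; have h : 0 <= pi * (1 - 2 * v) :> R by rewrite mulr_ge0 ?(ltW p0)//; lra.
  by rewrite in_itv /= mulr_ge0 ?mulr_ge0 ?(ltW p0)//=; lra.
have [->//|ne] := eqVneq u r.
have ru : r < u by rewrite lt_neqAle eq_sym ne.
rewrite ltW// ltr_cos ?pu//; try lra.
by rewrite ltr_pM2l// mulr_gt0.
Qed.

(** Outer regularity for the Lebesgue-null set that carries [mu]. The end points [0] and [1] are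
    added so that the bump can be made constant near both, hence continuous on the circle. *)
Lemma singular_cover (mu : {finite_measure set RB -> \bar R}) (d : R) :
  mu (~` unitI) = 0%E -> mutually_singular mu leb -> 0 < d ->
  exists U : set R, [/\ open U, U 0, U 1, (lebesgue_measure U <= d%:E)%E & mu (~` U) = 0%E].
Proof.
move=> mu0 [A [mA muA lA]] d0.
have mI : measurable (unitI : set RB) := measurable_unitI.
pose S : set RB := (~` A `&` unitI) `|` ([set 0] `|` [set 1]).
have mS1 : measurable (~` A `&` unitI) by apply: measurableI => //; exact: measurableC.
have mS : measurable S by apply: measurableU => //; exact: measurableU.
have lS : @lebesgue_measure R S = 0%E.
  apply/eqP; rewrite -measure_le0 (le_trans (measureU2 _ _ _))//; first exact: measurableU.
  rewrite [X in (X + _ <= _)%E](_ : _ = 0%E); last exact: lA.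
  have l1 (a : R) : lebesgue_measure ([set a] : set R) = 0%E := lebesgue_measure_set1 a.
  have l01 : (lebesgue_measure [set 0%R : R] + lebesgue_measure [set 1%R : R] <= 0)%E by rewrite !l1 adde0.
  by rewrite add0e; apply: le_trans l01; exact: measureU2.
have [|U [oU SU lU]] := @lebesgue_regularity_outer R S d mS _ d0; first by apply: (@le_lt_trans _ _ 0%E); rewrite ?ltry//; rewrite le_eqVlt; apply/orP; left; apply/eqP; exact: lS.
have mU : measurable (U : set RB) by exact: open_measurable.
exists U; split => //.
- by apply: SU; right; left.
- by apply: SU; right; right.
- rewrite (le_trans _ (ltW lU))//.
  have -> : lebesgue_measure U = lebesgue_measure (S `|` (U `\` S)).
    by rewrite setDUK.
  rewrite (le_trans (measureU2 _ _ _))//; first exact: measurableD.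
  rewrite -[leRHS]add0e; apply: leeD => //.
  by rewrite le_eqVlt; apply/orP; left; apply/eqP; exact: lS.
- apply/eqP; rewrite -measure_le0.
  apply: (@le_trans _ _ (mu (A `|` ~` unitI))).
    apply: le_measure; rewrite ?inE; [exact: measurableC|by apply: measurableU => //; exact: measurableC|].
    move=> t nU; have [At|nA] := pselect (A t); first by left.
    by right => It; apply: nU; apply: SU; left.
  rewrite (le_trans (measureU2 _ _ _))//; first exact: measurableC.
  rewrite -[leRHS]adde0; apply: leeD; rewrite le_eqVlt; apply/orP; left; apply/eqP.
    exact: muA.
  exact: mu0.
Qed.

(** [b] is [M] times the truncation at [1] of [n] times the distance to the complement of [U]. It
    vanishes off [U], which has small Lebesgue measure, and reaches [M] on sets that exhaust the
    part of [U] in [[0, 1]] as [n] grows. *)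
Lemma singular_bump (mu : {finite_measure set RB -> \bar R}) (M d k : R) :
  mu (~` unitI) = 0%E -> mutually_singular mu leb -> 0 < M -> 0 < d -> 0 < k ->
  exists b : R -> R, [/\ measurable_fun setT (b : RB -> R),
    forall t, 0 <= b t <= M,
    forall eps, 0 < eps -> exists2 c, 0 < c & forall t s, 0 <= t <= 1 -> 0 <= s <= 1 ->
      `|b t - b s| <= eps \/ c <= normc (E t - E s) ^+ 2,
    \int[leb]_(t in unitI) (b t ^+ 2) <= d &
    (mu (unitI `&` [set t | (b t < M)%R]) <= k%:E)%E].
Proof.
move=> mu0 sing M0 d0 k0.
have [|U [oU U0 U1 lU muU]] := @singular_cover mu (d / M ^+ 2) mu0 sing; first by rewrite divr_gt0 ?exprn_gt0.
(* The point [5] keeps [C] nonempty and is too far from [[0, 1]] to affect the estimates. *)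
pose C : set R := ~` U `|` [set 5].
have C5 : C 5 by right.
pose D := dist_to C.
have D0 t : 0 <= D t := dist_to_ge0 C5 t.
(* Near both end points the distance is at least [eta], so [b] equals [M] there as soon as
   [n * eta >= 1]. *)
have [eta [eta0 eta1 etaU]] : exists eta, [/\ 0 < eta, eta <= 1 & forall t, 0 <= t <= 1 -> (t <= eta) || (1 - eta <= t) -> eta <= D t].
  have /nbhs_ballP[e0 /= e00 h0] := open_nbhs_nbhs (conj oU U0).
  have /nbhs_ballP[e1 /= e10 h1] := open_nbhs_nbhs (conj oU U1).
  pose eta := Num.min 1 (Num.min (e0 / 4) (e1 / 4)).
  have le0 : eta <= e0 / 4 by rewrite /eta !ge_min lexx orbT.
  have le1 : eta <= e1 / 4 by rewrite /eta !ge_min lexx !orbT.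
  have eta1 : eta <= 1 by rewrite /eta ge_min lexx.
  have eta0 : 0 < eta by rewrite /eta !lt_min ltr01 !divr_gt0.
  exists eta; split => // t /andP[t0 t1] near01.
  apply: (dist_to_ge C5) => s [nU|->]; last by rewrite ler0_norm; lra.
  rewrite leNgt; apply/negP => lt; apply: nU.
  case/orP: near01 => near.
    apply: h0; rewrite /ball /= sub0r normrN.
    have -> : s = t - (t - s) by ring.
    rewrite (le_lt_trans (ler_normB _ _))// ger0_norm//; lra.
  apply: h1; rewrite /ball /=.
  have -> : 1 - s = (1 - t) + (t - s) by ring.
  by rewrite (le_lt_trans (ler_normD _ _))// ger0_norm ?subr_ge0//; lra.
have Dpos t : 0 <= t <= 1 -> U t -> 0 < D t.
  move=> /andP[t0 t1] Ut; have /nbhs_ballP[e /= e0 h] := open_nbhs_nbhs (conj oU Ut).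
  apply: (@lt_le_trans _ _ (Num.min e 1)); first by rewrite lt_min e0 ltr01.
  apply: (dist_to_ge C5) => s [nU|->]; last by rewrite ge_min; apply/orP; right; rewrite ler0_norm; lra.
  rewrite ge_min leNgt; apply/orP; left; apply/negP => lt; apply: nU; exact: h.
(* These sets decrease, and their intersection lies off [U], so it is null for [mu]. *)
pose Bad n : set RB := unitI `&` [set t | n%:R * D t < 1].
have mD n : measurable_fun setT ((fun t => n%:R * D t) : RB -> R).
  apply: measurable_funM => //; apply: continuous_measurable_fun; exact: (dist_to_continuous C5).
have mBad n : measurable (Bad n).
  apply: measurableI; first exact: measurable_unitI.
  have := mD n measurableT (`]-oo, 1[%classic) (measurable_itv _).
  by rewrite setTI; congr measurable; apply/seteqP; split => t /=; rewrite in_itv.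
have Bcap0 : mu (\bigcap_n Bad n) = 0%E.
  apply/eqP; rewrite -measure_le0 -muU; apply: le_measure; rewrite ?inE.
  - exact: bigcap_measurable.
  - by apply: measurableC; exact: open_measurable.
  move=> t Bt Ut; have [It _] := Bt 0%N I.
  have t01 : 0 <= t <= 1 by move: It; rewrite /unitI /= in_itv.
  have Dt := Dpos t t01 Ut.
  have [_ /=] := Bt (Num.truncn (D t)^-1).+1 I.
  by rewrite -ltr_pdivlMr// mul1r ltNge => /negP; apply; exact/ltW/truncnS_gt.
have [n hn nbig] : exists2 n, (mu (Bad n) <= k%:E)%E & 1 <= n%:R * eta.
  have cv : (mu \o Bad) @ \oo --> mu (\bigcap_n Bad n).
    apply: nonincreasing_cvg_mu => //.
    - by rewrite ltey_eq fin_num_measure.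
    - exact: bigcap_measurable.
    apply/nonincreasing_seqP => n; apply/subsetPset => t [It /= h]; split => //=.
    by apply: le_lt_trans h; rewrite ler_wpM2r// ler_nat.
  rewrite Bcap0 in cv.
  have ev : \forall n \near \oo, (mu (Bad n) <= k%:E)%E.
    have /fine_cvgP[fin cv'] := cv.
    have /cvgrPdist_le/(_ _ k0) h := cv'.
    apply: filterS2 fin h => n fn /=; rewrite sub0r normrN => h.
    have fn' : mu (Bad n) \is a fin_num := fn.
    by rewrite -(fineK fn') lee_fin (le_trans (ler_norm _)).
  case: ev => n0 _ hn0.
  pose n := maxn n0 (Num.truncn eta^-1).+1.
  exists n; first by apply: hn0; rewrite /= leq_maxl.
  rewrite -ler_pdivrMr// mul1r (le_trans (ltW (truncnS_gt _)))// ler_nat leq_maxr//.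
pose b t := M * Num.min 1 (n%:R * D t).
have nD0 t : 0 <= n%:R * D t by rewrite mulr_ge0.
have mb : measurable_fun setT (b : RB -> R).
  apply: measurable_funM => //; apply: measurable_minr => //; exact: mD.
have bM t : 0 <= b t <= M.
  rewrite /b mulr_ge0 ?(ltW M0)//=; last by rewrite le_min ler01 nD0.
  by rewrite -[leRHS]mulr1 ler_pM2l// ge_min lexx.
have bfull t : 1 <= n%:R * D t -> b t = M by move=> h; rewrite /b min_l// mulr1.
have blip t s : `|b t - b s| <= M * (n%:R * `|t - s|).
  rewrite /b -mulrBr normrM (ger0_norm (ltW M0)) ler_pM2l//.
  apply: (@le_trans _ _ `|n%:R * D t - n%:R * D s|).
    move: (n%:R * D t) (n%:R * D s) => x y.
    have aux (x' y' : R) : x' <= y' -> `|Num.min 1 x' - Num.min 1 y'| <= `|x' - y'|.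
      move=> xy; rewrite [leRHS]distrC [X in X <= _]distrC [leRHS]ger0_norm ?subr_ge0//.
      rewrite ger0_norm; last by rewrite subr_ge0 le_min ge_min lexx/= ge_min xy orbT.
      by case: (leP 1 x') => h1; case: (leP 1 y') => h2; lra.
    have [/aux//|/ltW/aux] := leP x y.
    by rewrite distrC [leRHS]distrC.
  by rewrite -mulrBr normrM normr_nat ler_wpM2l// (dist_to_lip C5).
exists b; split => //.
- move=> eps eps0.
  (* If [t - s <= r], the Lipschitz bound applies; if [r < t - s <= 1 - r], the chord is long;
     otherwise both points are within [eta] of an end and [b] is [M] at both. *)
  pose r := Num.min (Num.min eta (1 / 4)) (eps / (M * n.+1%:R)).
  have Mn0 : 0 < M * n.+1%:R by rewrite mulr_gt0.
  have r0 : 0 < r by rewrite /r !lt_min eta0 divr_gt0//= divr_gt0.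
  have reta : r <= eta by rewrite /r !ge_min lexx.
  have r4 : r <= 1 / 4 by rewrite /r !ge_min lexx orbT.
  have reps : r <= eps / (M * n.+1%:R) by rewrite /r ge_min lexx orbT.
  exists (2 - 2 * cos (2 * pi * r)).
    have := ltr_cos (R := R); suff : cos (2 * pi * r) < cos 0 by rewrite cos0; lra.
    have p0 : 0 < pi :> R := pi_gt0 R.
    rewrite ltr_cos ?in_itv /= ?lexx ?(ltW p0)//.
      by rewrite !mulr_gt0.
    have h : 0 <= pi * (1 - 2 * r) :> R by rewrite mulr_ge0 ?(ltW p0)//; lra.
    by rewrite !mulr_ge0 ?(ltW p0) ?(ltW r0)//=; lra.
  move=> t s t01 s01.
  wlog st : t s t01 s01 / s <= t.
    move=> H; have [st|/ltW st] := leP s t; first exact: H.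
    by rewrite distrC nrmBC; exact: H.
  have u0 : 0 <= t - s by rewrite subr_ge0.
  have [le|gt] := leP (t - s) r.
    left; rewrite (le_trans (blip t s))// ger0_norm//.
    have : (t - s) * (M * n.+1%:R) <= eps by rewrite -ler_pdivlMr// (le_trans le).
    apply: le_trans; rewrite mulrA mulrC ler_wpM2l// ler_pM2l// ler_nat//.
  have [le|gt'] := leP (t - s) (1 - r).
    right; rewrite nrm_EB lerD2l lerN2 ler_pM2l//; apply: cos_gap => //.
    by rewrite (ltW gt).
  left; have /andP[t0 t1] := t01; have /andP[s0 s1] := s01.
  have full v : 0 <= v <= 1 -> (v <= eta) || (1 - eta <= v) -> b v = M.
    move=> v01 h; apply: bfull; rewrite (le_trans nbig)// ler_wpM2l//; exact: etaU.
  rewrite !full ?subrr ?normr0 ?(ltW eps0)//.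
    by apply/orP; left; lra.
  by apply/orP; right; lra.
- have b2 t : b t ^+ 2 <= M ^+ 2 * \1_U t.
    have /andP[h0 h1] := bM t.
    have [Ut|nU] := pselect (U t).
      by rewrite indicE mem_set// mulr1 ler_pXn2r ?nnegrE// ltW.
    rewrite indicE memNset// mulr0 /b.
    have -> : D t = 0.
      by apply/eqP; rewrite eq_le D0 andbT -[leRHS](normr0 R) -(subrr t); apply: (dist_to_le C5); left.
    by rewrite mulr0 min_r// mulr0 expr0n.
  have mU : measurable (U : set RB) by exact: open_measurable.
  have mI : measurable (unitI : set RB) := measurable_unitI.
  have i1 : leb.-integrable unitI (EFin \o (fun t => b t ^+ 2)).
    apply: (bounded_integrable leb mI (M := M ^+ 2)); first exact: measurable_funX.
    move=> t _; have /andP[h0 h1] := bM t.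
    by rewrite ger0_norm ?sqr_ge0// ler_pXn2r ?nnegrE// ltW.
  have i2 : leb.-integrable unitI (EFin \o (fun t => M ^+ 2 * \1_U t)).
    apply: (bounded_integrable leb mI (M := M ^+ 2)).
      by apply: measurable_funM => //; exact: measurable_indic.
    by move=> t _; rewrite indicE; case: (t \in U); rewrite ?mulr1 ?mulr0 ?normr0 ?sqr_ge0// ger0_norm ?sqr_ge0.
  apply: (le_trans (le_Rintegral mI i1 i2 (fun t _ => b2 t))).
  rewrite RintegralZl//; last first.
    apply: (bounded_integrable leb mI (M := 1)); first exact: measurable_indic.
    by move=> t _; rewrite indicE; case: (t \in U); rewrite ?normr1 ?normr0.
  rewrite /Rintegral integral_indic//.
  have le1 : (leb (U `&` unitI) <= (d / M ^+ 2)%:E)%E.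
    rewrite (le_trans _ lU)//; apply: le_measure; rewrite ?inE//.
      by do 2 apply: measurableI => //.
    by move=> t [[]].
  have fin : leb (U `&` unitI) \is a fin_num.
    by rewrite fin_num_measure//; exact: measurableI.
  move: le1; rewrite -(fineK fin) lee_fin ler_pdivlMr ?exprn_gt0// mulrC.
  by [].
- rewrite (le_trans _ hn)//; apply: le_measure; rewrite ?inE//.
    apply: measurableI; first exact: measurable_unitI.
    have := mb measurableT (`]-oo, M[%classic) (measurable_itv _).
    by rewrite setTI; congr measurable; apply/seteqP; split => t /=; rewrite in_itv.
  move=> t [It /= h]; split => //=; rewrite ltNge; apply/negP => /bfull e.
  by rewrite e ltxx in h.
Qed.
End SingularBump.

(** * Polynomials that separate a singular measure from a density *)

Section SingularPolynomial.
Context {R : realType}.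
Local Notation RB := (measurableTypeR R).
Local Notation leb := (@lebesgue01 R).

(** Dominated convergence. As the density is only integrable, it must be truncated before being
    paired with a function that is small in mean square. *)
Lemma tail_integral (g : RB -> R) (e : R) : (forall t, 0 <= g t) ->
  leb.-integrable unitI (EFin \o g) -> 0 < e ->
  exists2 T : R, 0 < T & \int[leb]_(t in unitI) Num.max (g t - T) 0 <= e.
Proof.
move=> g0 ig e0; have mI : measurable (unitI : set RB) := measurable_unitI.
have mg : measurable_fun unitI g by have /integrableP[/measurable_EFinP] := ig.
pose f n t := (Num.max (g t - n%:R) 0)%:E.
have mf n : measurable_fun unitI (f n).
  apply/measurable_EFinP; apply: measurable_maxr => //; exact: measurable_funB.
have cv : ((\int[leb]_(t in unitI) f n t)%E @[n --> \oo] --> (\int[leb]_(t in unitI) 0)%E)%E.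
  have h1 : measurable_fun unitI (cst 0%E : RB -> \bar R) by exact: measurable_cst.
  have h2 : {ae leb, forall t, unitI t -> f n t @[n --> \oo] --> (cst 0%E : RB -> \bar R) t}.
    apply: aeW => t _; apply: cvg_near_cst; near=> n; rewrite /f max_r// subr_le0.
    by near: n; exact: nbhs_infty_ger.
  have h3 : {ae leb, forall t n, unitI t -> (`|f n t| <= (EFin \o g) t)%E}.
    apply: aeW => t n _ /=; rewrite lee_fin ger0_norm ?le_max ?lexx ?orbT//.
    by rewrite ge_max g0 andbT lerBlDr lerDl.
  by have [_ _ h] := dominated_convergence mI mf h1 h2 ig h3.
rewrite integral0 in cv.
have /fine_cvgP[fin /cvgrPdist_le/(_ _ e0) h] := cv.
case: (filterI fin h) => n _ /(_ n.+1 (leqnSn n)) [fn /=].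
rewrite sub0r normrN => hn; exists n.+1%:R => //.
exact: le_trans (ler_norm _) hn.
Unshelve. all: by end_near. Qed.

(** [p] nearly equals [F / (1 + F)], with [Re F] uniformly close to the bump [b]. In Lebesgue mean
    square [F] is small, so [p] is small against the truncated density; for [mu], outside a small
    set [Re F] is large and [p] is close to [1]. *)
Lemma singular_polynomial (mu : {finite_measure set RB -> \bar R}) (f : RB -> R[i]) (k : R) :
  mu (~` unitI) = 0%E -> mutually_singular mu leb -> cintegrable leb unitI f -> 0 < k ->
  exists p : {poly R[i]}, [/\ forall t, normc p.[E t] ^+ 2 <= Re p.[E t] + k,
    Re (cintegral leb unitI (fun t => f t * p.[E t])) <= k &
    \int[mu]_(t in unitI) (normc (1 - p.[E t]) ^+ 2) <= k].
Proof.
move=> mu0 sing fi k0.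
have mI : measurable (unitI : set RB) := measurable_unitI.
have [f1 f2] := fi.
pose g t := `|Re (f t)| + `|Im (f t)|.
have ig : leb.-integrable unitI (EFin \o g).
  have h1 : leb.-integrable unitI (EFin \o (fun t => `|Re (f t)|)) := integrable_norm f1.
  have h2 : leb.-integrable unitI (EFin \o (fun t => `|Im (f t)|)) := integrable_norm f2.
  by apply: eq_integrable (integrableD mI h1 h2) => // t _.
have mg : measurable_fun unitI g by have /integrableP[/measurable_EFinP] := ig.
have g0 t : 0 <= g t by rewrite addr_ge0.
set Ig := \int[leb]_(t in unitI) g t.
have Ig0 : 0 <= Ig by apply: Rintegral_ge0.
have k4 : 0 < k / 4 by rewrite divr_gt0.
have [T T0 hT] := tail_integral g0 ig k4.
set m0 := fine (mu unitI).
have m00 : 0 <= m0 by rewrite fine_ge0.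
(* [th] bounds [|1 - p|] where [b = M]; its square times the mass of [mu] is at most [k / 2]. *)
pose th := Num.min 1 (k / (2 * (m0 + 1))).
have m1 : 0 < 2 * (m0 + 1) by rewrite mulr_gt0// ltr_wpDl.
have th0 : 0 < th by rewrite lt_min ltr01 divr_gt0.
have th1 : th <= 1 by rewrite ge_min lexx.
have thm : th ^+ 2 * m0 <= k / 2.
  have h : th <= k / (2 * (m0 + 1)) by rewrite ge_min lexx orbT.
  have h2 : th * (2 * (m0 + 1)) <= k by rewrite -ler_pdivlMr.
  have h3 : th ^+ 2 <= th by rewrite expr2 ler_piMl// ltW.
  have h4 := ler_wpM2r m00 h3; nra.
pose k1 := Num.min (Num.min (th / 2) k) (k / (4 * (Ig + 1))).
have I1 : 0 < 4 * (Ig + 1) by rewrite mulr_gt0// ltr_wpDl.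
have k10 : 0 < k1 by rewrite !lt_min k0 !divr_gt0.
have k1th : k1 <= th / 2 by rewrite !ge_min lexx.
have k1k : k1 <= k by rewrite !ge_min lexx orbT.
have k1I : k1 * Ig <= k / 4.
  have h : k1 <= k / (4 * (Ig + 1)) by rewrite !ge_min lexx !orbT.
  have h2 : k1 * (4 * (Ig + 1)) <= k by rewrite -ler_pdivlMr.
  nra.
(* Where [1 + Re F >= M], the term [(1 + Re F)^-1] is at most [th / 2], which leaves [th / 2] for
   [k1]. *)
pose M := (th / 2)^-1.
have M0 : 0 < M by rewrite invr_gt0 divr_gt0.
(* [tau] and [beta] make both [T * tau] and [T * (2 * beta / tau)] equal to [k / 8]. *)
pose tau := k / (8 * T).
have tau0 : 0 < tau by rewrite divr_gt0 ?mulr_gt0.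
pose beta := k * tau / (16 * T).
have beta0 : 0 < beta by apply: divr_gt0; apply: mulr_gt0.
have b40 : 0 < beta / 4 by rewrite divr_gt0.
have k18 : 0 < k / 18 by rewrite divr_gt0.
have [b [mb bM bc bint bmu]] := singular_bump mu0 sing M0 b40 k18.
(* [eps <= 1 / 2] yields [Re F >= M - 1] where [b = M]; the other bound controls the error in
   [(Re F)^2 <= 2 b^2 + 8 eps^2]. *)
pose eps := Num.min (1 / 2) (beta / 16).
have b16 : 0 < beta / 16 by apply: divr_gt0.
have eps0 : 0 < eps by rewrite lt_min b16 andbT divr_gt0.
have eps2 : eps <= 1 / 2 by rewrite ge_min lexx.
have epsb : 8 * eps ^+ 2 <= beta / 2.
  have h : eps <= beta / 16 by rewrite ge_min lexx orbT.
  nra.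
have [c c0 hc] := bc eps eps0.
have [F [F0 Fb F00]] := fejer_approx eps0 c0 (fun t _ => bM t) hc.
have [p hp] := disc_polynomial F0 k10.
have [mRF mIF] := measurable_poly_circle F.
have [mRp mIp] := measurable_poly_circle p.
have nrm_meas (q : {poly R[i]}) : measurable_fun setT (fun t : RB => normc q.[E t]).
  have [m1' m2'] := measurable_poly_circle q.
  have -> : (fun t : RB => normc q.[E t]) = (fun t => Num.sqrt (Re q.[E t] ^+ 2 + Im q.[E t] ^+ 2)).
    by apply/funext => t; rewrite -sqr_nrm sqrtr_sqr ger0_norm// nrm_ge0.
  apply: measurableT_comp; first by apply: continuous_measurable_fun; exact: sqrt_continuous.
  by apply: measurable_funD; exact: measurable_funX.
have polyint (nu : {finite_measure set RB -> \bar R}) (h : RB -> R) (q : {poly R[i]}) : measurable_fun setT h ->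
    (forall t, `|h t| <= normc q.[E t] ^+ 2) -> nu.-integrable unitI (EFin \o h).
  move=> mh hq; apply: (bounded_integrable nu mI (M := (\sum_(i < size q) normc q`_i) ^+ 2) mh) => t _.
  apply: (le_trans (hq t)); rewrite ler_pXn2r ?nnegrE ?nrm_ge0//; first exact: nrm_poly_circle.
  by apply: sumr_ge0 => i _; exact: nrm_ge0.
exists p; split.
- by move=> t; have [h _ _ _] := hp t; rewrite (le_trans h)// lerD2l.
- have iRe : leb.-integrable unitI (EFin \o (fun t => Re F.[E t] ^+ 2)).
    apply: (polyint leb _ F) => [|t]; first exact: measurable_funX.
    by rewrite ger0_norm ?sqr_ge0// sqr_nrm lerDl sqr_ge0.
  have iIm : leb.-integrable unitI (EFin \o (fun t => Im F.[E t] ^+ 2)).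
    apply: (polyint leb _ F) => [|t]; first exact: measurable_funX.
    by rewrite ger0_norm ?sqr_ge0// sqr_nrm lerDr sqr_ge0.
  have iF : leb.-integrable unitI (EFin \o (fun t => normc F.[E t] ^+ 2)).
    apply: (polyint leb _ F) => [|t]; first exact: measurable_funX.
    by rewrite ger0_norm ?sqr_ge0.
  have ib : leb.-integrable unitI (EFin \o (fun t => b t ^+ 2)).
    apply: (bounded_integrable leb mI (M := M ^+ 2)); first exact: measurable_funX.
    move=> t _; have /andP[h0 h1] := bM t.
    by rewrite ger0_norm ?sqr_ge0// ler_pXn2r ?nnegrE// ltW.
  have l1 : fine (leb unitI) = 1.
    have -> : leb unitI = 1%E; last by [].
    rewrite -[LHS]/(@lebesgue_measure R (unitI `&` unitI)) setIid.
    by rewrite /unitI lebesgue_measure_itv /= lte_fin ltr01 oppr0 adde0.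
  have icst (a : R) : leb.-integrable unitI (EFin \o (fun=> a)).
    by apply: (bounded_integrable leb mI (M := `|a|)).
  have iZ (a : R) (h : RB -> R) : leb.-integrable unitI (EFin \o h) -> leb.-integrable unitI (EFin \o (fun t => a * h t)).
    by move=> ih; apply: eq_integrable (integrableZl mI a ih) => // t _; rewrite /= EFinM.
  have iD (h h' : RB -> R) : leb.-integrable unitI (EFin \o h) -> leb.-integrable unitI (EFin \o h') ->
      leb.-integrable unitI (EFin \o (fun t => h t + h' t)).
    by move=> ih ih'; apply: eq_integrable (integrableD mI ih ih') => // t _.
  have aint : \int[leb]_(t in unitI) (Re F.[E t] ^+ 2) <= beta.
    have h1 : \int[leb]_(t in unitI) (Re F.[E t] ^+ 2) <= \int[leb]_(t in unitI) (2 * b t ^+ 2 + 8 * eps ^+ 2).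
      apply: le_Rintegral => //; first by apply: iD => //; exact: iZ.
      move=> t It; have t01 : 0 <= t <= 1 by move: It; rewrite /unitI /= in_itv.
      have h := Fb t t01; set a := Re _ in h *.
      have h2 : (a - b t) ^+ 2 <= (2 * eps) ^+ 2.
        by rewrite -[leLHS]real_normK ?num_real// ler_pXn2r ?nnegrE// mulr_ge0// ltW.
      have := sqr_ge0 (a - 2 * b t); rewrite !expr2 in h2 *; nra.
    rewrite (le_trans h1)// RintegralD//; last exact: iZ.
    rewrite RintegralZl// Rintegral_cst// l1 mulr1.
    have aux (X e2 B : R) : X <= B / 4 -> 8 * e2 <= B / 2 -> 2 * X + 8 * e2 <= B by lra.
    exact: aux.
  (* The difference of the two integrals is the real part of the mean of [F ^+ 2], namely the square
     of the real number [F.[0]]. *)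
  have imint : \int[leb]_(t in unitI) (Im F.[E t] ^+ 2) <= \int[leb]_(t in unitI) (Re F.[E t] ^+ 2).
    rewrite -subr_ge0 -RintegralB//.
    have -> : \int[leb]_(t in unitI) (Re F.[E t] ^+ 2 - Im F.[E t] ^+ 2) = Re (F ^+ 2).[0].
      rewrite -cintegral_poly_circle /=; apply: eq_Rintegral => t _.
      by rewrite horner_exp expr2 cReM !expr2.
    by rewrite horner_exp F00 -rmorphXn cReC sqr_ge0.
  have Fint : \int[leb]_(t in unitI) (normc F.[E t] ^+ 2) <= 2 * beta.
    have -> : \int[leb]_(t in unitI) (normc F.[E t] ^+ 2) =
       \int[leb]_(t in unitI) (Re F.[E t] ^+ 2) + \int[leb]_(t in unitI) (Im F.[E t] ^+ 2).
      by rewrite -RintegralD//; apply: eq_Rintegral => t _; rewrite sqr_nrm.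
    by rewrite mulr2n mulrDl mul1r lerD// (le_trans imint).
  have [fp1 fp2] := cintegrable_mul_poly mI p fi.
  (* The part of the density above [T] meets [|p| <= 1 + k1]; the part below meets [|p| <= |F| + k1]
     with [|F| <= tau + |F|^2 / tau]; both errors [k1] are collected in the last term. *)
  pose U t := Num.max (g t - T) 0 + (T * (tau + tau^-1 * normc F.[E t] ^+ 2) + k1 * g t).
  have imax : leb.-integrable unitI (EFin \o (fun t => Num.max (g t - T) 0)).
    apply: (le_integrable mI _ _ ig).
      by apply/measurable_EFinP; apply: measurable_maxr => //; exact: measurable_funB.
    move=> t _ /=; rewrite lee_fin ger0_norm ?le_max ?lexx ?orbT// ger0_norm//.
    by rewrite ge_max g0 andbT lerBlDr lerDl ltW.
  have iU2 : leb.-integrable unitI (EFin \o (fun t => tau + tau^-1 * normc F.[E t] ^+ 2)).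
    by apply: iD => //; exact: iZ.
  have iU3 : leb.-integrable unitI (EFin \o (fun t => T * (tau + tau^-1 * normc F.[E t] ^+ 2) + k1 * g t)).
    by apply: iD; exact: iZ.
  have iU : leb.-integrable unitI (EFin \o U) by exact: iD.
  have -> : Re (cintegral leb unitI (fun t => f t * p.[E t])) = \int[leb]_(t in unitI) Re (f t * p.[E t]) by [].
  have pt t : Re (f t * p.[E t]) <= U t.
    have [_ p1 pF _] := hp t; set P := normc p.[E t] in p1 pF.
    have P0 : 0 <= P := nrm_ge0 _.
    have h1 : Re (f t * p.[E t]) <= g t * P.
      by rewrite (le_trans (cRe_le_nrm _))// nrmM ler_wpM2r// nrm_ReIm.
    apply: (le_trans h1); rewrite /U; set Fn := normc F.[E t] in pF *.
    have Fn0 : 0 <= Fn := nrm_ge0 _.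
    have amgm : Fn <= tau + tau^-1 * Fn ^+ 2.
      have [le|/ltW le] := leP Fn tau.
        by rewrite (le_trans le)// lerDl mulr_ge0 ?sqr_ge0// invr_ge0 ltW.
      rewrite (le_trans _ (_ : tau^-1 * Fn ^+ 2 <= _))//; last by rewrite lerDr ltW.
      by rewrite ler_pdivlMl// expr2 ler_wpM2r.
    have Q0 : 0 <= P - k1 \/ P < k1 by case: (leP k1 P) => h; [left; rewrite subr_ge0|right].
    have gT : g t <= Num.max (g t - T) 0 + T by rewrite -lerBlDr le_max lexx.
    have mx0 : 0 <= Num.max (g t - T) 0 by rewrite le_max lexx orbT.
    set mx := Num.max _ _ in gT mx0 *.
    have gk : g t * P <= g t * Num.max (P - k1) 0 + k1 * g t.
      rewrite [k1 * _]mulrC -mulrDr ler_wpM2l// -lerBlDr le_max lexx//.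
    apply: (le_trans gk); rewrite addrA lerD2r.
    set Q := Num.max _ _; have Q0' : 0 <= Q by rewrite le_max lexx orbT.
    have Q1 : Q <= 1 by rewrite ge_max ler01 andbT lerBlDr.
    have QF : Q <= Fn by rewrite ge_max Fn0 andbT lerBlDr.
    have h2 : g t * Q <= mx * Q + T * Q by rewrite -mulrDl ler_wpM2r.
    rewrite (le_trans h2)// lerD//.
      by rewrite -[leRHS]mulr1 ler_wpM2l.
    by rewrite ler_wpM2l ?(ltW T0)// (le_trans QF).
  rewrite (le_trans (le_Rintegral mI fp1 iU (fun t _ => pt t)))//.
  rewrite /U RintegralD// RintegralD//; [|exact: iZ|exact: iZ].
  rewrite (RintegralZl T mI iU2) (RintegralZl k1 mI ig) RintegralD//; last exact: iZ.
  rewrite Rintegral_cst// l1 mulr1 (RintegralZl (tau^-1) mI iF) -/Ig.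
  have h1 : T * tau = k / 8 by rewrite /tau; field; rewrite gt_eqF.
  have h2 : T * (tau^-1 * \int[leb]_(t in unitI) (normc F.[E t] ^+ 2)) <= k / 8.
    apply: (@le_trans _ _ (T * (tau^-1 * (2 * beta)))).
      by rewrite ler_wpM2l ?(ltW T0)// ler_wpM2l// invr_ge0 ltW.
    rewrite /beta le_eqVlt; apply/orP; left; apply/eqP; field.
    by rewrite !gt_eqF.
  rewrite mulrDr h1.
  have aux (a2 a3 a4 : R) : a2 <= k / 4 -> a3 <= k / 8 -> a4 <= k / 4 -> a2 + (k / 8 + a3 + a4) <= k.
    by move: k0; clear; lra.
  exact: aux.
- set B := unitI `&` [set t | (b t < M)%R] in bmu.
  have mB : measurable (B : set RB).
    apply: measurableI => //.
    have := mb measurableT (`]-oo, M[%classic) (measurable_itv _).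
    by rewrite setTI; congr measurable; apply/seteqP; split => t /=; rewrite in_itv.
  have pt t : unitI t -> normc (1 - p.[E t]) ^+ 2 <= 9 * \1_B t + th ^+ 2.
    move=> It; have t01 : 0 <= t <= 1 by move: It; rewrite /unitI /= in_itv.
    have [_ p1 _ p2] := hp t.
    have [Bt|nB] := pselect (B t).
      rewrite indicE mem_set// mulr1 (@le_trans _ _ 9)// ?lerDl ?sqr_ge0//.
      have -> : 9 = 3 ^+ 2 :> R by ring.
      rewrite ler_pXn2r ?nnegrE ?nrm_ge0// (le_trans (nrmB _ _))// nrm1.
      by lra.
    rewrite indicE memNset// mulr0 add0r ler_pXn2r ?nnegrE ?nrm_ge0 ?(ltW th0)//.
    have bt : M <= b t by rewrite leNgt; apply/negP => h; apply: nB.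
    have FM : M <= 1 + Re F.[E t].
      have := Fb t t01; rewrite ler_norml => /andP[h1 h2]; lra.
    rewrite (le_trans p2)//; have : (1 + Re F.[E t])^-1 <= th / 2.
      by rewrite -[leRHS]invrK lef_pV2 ?posrE ?invr_gt0 ?divr_gt0// (lt_le_trans M0).
    lra.
  have i1 : mu.-integrable unitI (EFin \o (fun t => normc (1 - p.[E t]) ^+ 2)).
    have -> : (fun t : RB => normc (1 - p.[E t]) ^+ 2) = (fun t => normc (1 - p).[E t] ^+ 2).
      by apply/funext => t; rewrite !hornerE.
    apply: (polyint mu _ (1 - p)) => [|t]; first exact: measurable_funX.
    by rewrite ger0_norm ?sqr_ge0.
  have iB : mu.-integrable unitI (EFin \o (\1_B : RB -> R)).
    apply: (bounded_integrable mu mI (M := 1)); first exact: measurable_indic.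
    by move=> t _; rewrite indicE; case: (t \in B); rewrite ?normr1 ?normr0.
  have i9B : mu.-integrable unitI (EFin \o (fun t => 9 * \1_B t)).
    by apply: eq_integrable (integrableZl mI 9 iB) => // t _; rewrite /= EFinM.
  have ith : mu.-integrable unitI (EFin \o (fun=> th ^+ 2)).
    by apply: (bounded_integrable mu mI (M := `|th ^+ 2|)).
  have i2 : mu.-integrable unitI (EFin \o (fun t => 9 * \1_B t + th ^+ 2)).
    by apply: eq_integrable (integrableD mI i9B ith) => // t _.
  rewrite (le_trans (le_Rintegral mI i1 i2 pt))//.
  rewrite RintegralD// RintegralZl// Rintegral_cst// -/m0.
  have hB : \int[mu]_(t in unitI) \1_B t <= k / 18.
    rewrite /Rintegral integral_indic//.
    have BI : B `&` unitI = B by apply/setIidl => t [].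
    rewrite BI.
    have fin : mu B \is a fin_num by rewrite fin_num_measure.
    by move: bmu; rewrite -/B -(fineK fin) lee_fin.
  have aux (a1 a2 : R) : a1 <= k / 18 -> a2 <= k / 2 -> 9 * a1 + a2 <= k by clear; lra.
  exact: aux.
Qed.
End SingularPolynomial.

(** With [U] the shift, [<u, w>] splits into [<p(U) u, w>] and [<u, (1 - p)(U)^* w>]. The disc
    inequality for [p] and [toeplitz_ge0] bound [|p(U) u|^2] by [k + k |u|^2], and the squared norm
    of [(1 - p)(U)^* w] is [\int |1 - p|^2] against [mu], at most [k]. Then [k] tends to [0]. *)
Lemma spectral_orthogonal {R : realType} (u w : nat -> R[i]) :
  spectrally_Lebesgue u -> spectrally_singular w ->
  (fun N => normc (average N (fun n => u n * conjc (w n)))) @ \oo --> (0 : R).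
Proof.
move=> [bu hu] [bw hw]; apply: orthogonality_criterion => // Nq L pN NqL.
have mL : mean L by case: NqL.
have pu := permissible_sub pN; have pw := permissible_sub (permissible_sym pN).
have [f fi hf] := hu _ pu; have [mu [mu0 sing hmu]] := hw _ pw.
have mI : measurable (unitI : set (measurableTypeR R)) := measurable_unitI.
pose U (x : nat -> R[i]) k := fun n => x (n + k)%N.
have bU x k : bounded_cseq x -> bounded_cseq (U x k) by move=> bx; exact: bdc_shift.
have cl (x : nat -> R[i]) (l1 l2 : R[i]) h : ((fun q => correlation x x h (Nq q) : R[i]^o) @ \oo --> (l1 : R[i]^o)) ->
    ((fun q => correlation x x h (Nq q) : R[i]^o) @ \oo --> (l2 : R[i]^o)) -> l1 = l2.
  by move=> /cvg_complex[h1 h2] /cvg_complex[h3 h4]; apply: cplxP;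
    [exact: (cvg_unique _ h1 h3)|exact: (cvg_unique _ h2 h4)].
have gu h : ip L (U u h) u = cintegral (@lebesgue01 R) unitI (fun t => f t * E t ^+ h).
  have := cl _ _ _ _ (@permissible_ip _ _ _ NqL _ _ h pu) (hf h) => ->.
  by congr cintegral; apply/funext => t; rewrite expi_nat.
have gw h : ip L (U w h) w = cintegral mu unitI (fun t => E t ^+ h).
  have := cl _ _ _ _ (@permissible_ip _ _ _ NqL _ _ h pw) (hmu h) => ->.
  by congr cintegral; apply/funext => t; rewrite expi_nat.
have gw2 i j : ip L (U w i) (U w j) = cintegral mu unitI (fun t => E t ^+ i * conjc (E t ^+ j)).
  have le a b : (b <= a)%N -> ip L (U w a) (U w b) = cintegral mu unitI (fun t => E t ^+ a * conjc (E t ^+ b)).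
    move=> ba; have -> : ip L (U w a) (U w b) = ip L (U w (a - b)%N) w.
      rewrite -(ip_shift mL b (bU w (a - b)%N bw) bw); congr (ip L _ _).
      by apply/funext => n; rewrite /U; congr w; lia.
    rewrite gw; congr cintegral; apply/funext => t.
    by rewrite -{2}(subnK ba) exprD -mulrA mulcJ nrmX nrmE !expr1n mulr1.
  have [/le//|/ltnW ij] := leqP j i.
  rewrite (ipC mL (bU w j bw) (bU w i bw)) (le _ _ ij) -(cintegralJ mI); last exact: cintegrable_EJ.
  by congr cintegral; apply/funext => t; rewrite conjcM conjcK mulrC.
apply/eqP; rewrite -nrm_eq0; apply/eqP.
have su := sqn_ge0 mL bu; have sw := sqn_ge0 mL bw.
have key k : 0 < k -> normc (ip L u w) ^+ 2 <= 2 * (sqn L u * k) + 2 * ((k + k * sqn L u) * sqn L w).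
  move=> k0; have [p [p1 p2 p3]] := singular_polynomial mu0 sing fi k0.
  (* Positive even for [p = 0], and large enough for the coefficients of [1 - p]. *)
  pose D := (size p).+1.
  have pD z : p.[z] = \sum_(h < D) p`_h * z ^+ h by apply: horner_coef_wide; rewrite /D.
  pose pu' n := \sum_(h < D) p`_h * U u h n.
  have bpu' : bounded_cseq pu' by apply: bdc_sum => h _; apply: bdcZ; exact: bU.
  have ippu x : bounded_cseq x -> ip L pu' x = \sum_(h < D) p`_h * ip L (U u h) x.
    by move=> bx; exact: (@ip_suml R L mL _ _ (fun h : 'I_D => p`_h) (fun h : 'I_D => U u h) x (fun h => bU u h bu) bx).
  have ippuu : ip L pu' u = cintegral (@lebesgue01 R) unitI (fun t => f t * p.[E t]).
    rewrite ippu// (cintegral_mul_poly mI)// /D big_ord_recr /= [p`_(size p)]nth_default// mul0r addr0.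
    by apply: eq_bigr => h _; rewrite gu.
  have sqpu : sqn L pu' <= k + k * sqn L u.
    (* The symbol of [A] is [p + k - |p|^2], with nonnegative real part; its form at [u] is
       [<p(U) u, u> + k |u|^2 - |p(U) u|^2]. *)
    pose A (i j : nat) : R[i] := p`_i * (j == 0%N)%:R + (k%:C)%C * ((i == 0%N)%:R * (j == 0%N)%:R) - p`_i * conjc p`_j.
    have delta (F : nat -> R[i]) : \sum_(j < D) (j == 0%N :> nat)%:R * F j = F 0%N.
      rewrite (bigD1 ord0) //= mul1r big1 ?addr0// => j j0.
      by rewrite -val_eqE /= in j0; rewrite (negbTE j0) mul0r.
    have AE (G : nat -> nat -> R[i]) : \sum_(i < D) \sum_(j < D) A i j * G i j =
       \sum_(i < D) p`_i * G i 0%N + (k%:C)%C * G 0%N 0%N - \sum_(i < D) \sum_(j < D) p`_i * conjc p`_j * G i j.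
      transitivity (\sum_(i < D) (p`_i * G i 0%N + (i == 0%N :> nat)%:R * ((k%:C)%C * G i 0%N) - \sum_(j < D) p`_i * conjc p`_j * G i j)).
        apply: eq_bigr => i _; rewrite -(delta (fun j => p`_i * G i j)) -(delta (fun j => (k%:C)%C * G i j)).
        rewrite mulr_sumr -big_split -sumrB; apply: eq_bigr => j _ /=; rewrite /A; ring.
      by rewrite !big_split /= sumrN (delta (fun i => (k%:C)%C * G i 0%N)).
    have := toeplitz_ge0 mL (D := D) (A := A) bu; rewrite (AE (fun i j => ip L (U u i) (U u j))).
    have U0 : U u 0%N = u by apply/funext => n; rewrite /U addn0.
    rewrite U0 -(ippu u bu) (ip_sqn mL u).
    have -> : \sum_(i < D) \sum_(j < D) p`_i * conjc p`_j * ip L (U u i) (U u j) = (sqn L pu')%:C%C.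
      rewrite -(ip_sqn mL) ippu//; apply: eq_bigr => i _.
      have -> : ip L (U u i) pu' = \sum_(j < D) conjc p`_j * ip L (U u i) (U u j).
        exact: (@ip_sumr R L mL _ _ (fun h : 'I_D => p`_h) (fun h : 'I_D => U u h) (U u i) (fun h => bU u h bu) (bU u i bu)).
      by rewrite mulr_sumr; apply: eq_bigr => j _; rewrite mulrA.
    rewrite ippuu => h.
    have {h} := h _; rewrite cReB cReD cReMC !cReC => h.
    have : 0 <= Re (cintegral (@lebesgue01 R) unitI (fun t => f t * p.[E t])) + k * sqn L u - sqn L pu'.
      apply: h => t; rewrite (AE (fun i j => E t ^+ i * conjc (E t ^+ j))) !expr0 conjc1 !mulr1.
      under eq_bigr do rewrite mulr1.
      rewrite -pD.
      have -> : \sum_(i < D) \sum_(j < D) p`_i * conjc p`_j * (E t ^+ i * conjc (E t ^+ j)) = p.[E t] * conjc p.[E t].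
        rewrite pD conjc_sum mulr_suml; apply: eq_bigr => i _; rewrite mulr_sumr; apply: eq_bigr => j _.
        by rewrite [conjc (p`_j * _)]conjcM; ring.
      by rewrite mulcJ cReB cReD !cReC subr_ge0.
    by rewrite subr_ge0 => /le_trans; apply; rewrite lerD2r.
  (* This is [U^D q(U)^* w]: the adjoint needs backward shifts, and the factor [U^D] makes all lags
     [D - h] nonnegative. *)
  pose qw (q : {poly R[i]}) n := \sum_(h < D) conjc q`_h * U w (D - h)%N n.
  have bqw (q : {poly R[i]}) : bounded_cseq (qw q) by apply: bdc_sum => h _; apply: bdcZ; exact: bU.
  have sqqw (q : {poly R[i]}) : (size q <= D)%N -> sqn L (qw q) = \int[mu]_(t in unitI) (normc q.[E t] ^+ 2).
    move=> qD; have qE z : q.[z] = \sum_(h < D) q`_h * z ^+ h by exact: horner_coef_wide.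
    have gsh (i j : 'I_D) : ip L (U w (D - i)%N) (U w (D - j)%N) = ip L (U w j) (U w i).
      rewrite -(ip_shift mL (i + j) (bU w (D - i)%N bw) (bU w (D - j)%N bw)) -(ip_shift mL D (bU w j bw) (bU w i bw)).
      have := ltn_ord i; have := ltn_ord j => h1 h2.
      by congr (ip L _ _); apply/funext => n; rewrite /U; congr w; lia.
    have e1 : ip L (qw q) (qw q) = \sum_(i < D) \sum_(j < D) conjc q`_i * q`_j * cintegral mu unitI (fun t => E t ^+ j * conjc (E t ^+ i)).
      rewrite [LHS](@ip_suml R L mL _ _ (fun h : 'I_D => conjc q`_h) (fun h : 'I_D => U w (D - h)%N) (qw q) (fun h => bU w _ bw) (bqw q)).
      apply: eq_bigr => i _.
      rewrite (@ip_sumr R L mL _ _ (fun h : 'I_D => conjc q`_h) (fun h : 'I_D => U w (D - h)%N) _ (fun h => bU w _ bw) (bU w _ bw)).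
      by rewrite mulr_sumr; apply: eq_bigr => j _; rewrite conjcK gsh gw2 mulrA.
    have cz i j : cintegrable mu unitI (fun t => conjc q`_i * q`_j * (E t ^+ j * conjc (E t ^+ i))).
      by apply: cintegrableZ => //; exact: cintegrable_EJ.
    have cs i := cintegrable_sum mI (index_enum 'I_D) (fun j : 'I_D => cz i j).
    have [_ css] := cintegrable_sum mI (index_enum 'I_D) (fun i : 'I_D => (cs i).1).
    rewrite -[LHS]cReC -(ip_sqn mL) e1.
    have -> : \sum_(i < D) \sum_(j < D) conjc q`_i * q`_j * cintegral mu unitI (fun t => E t ^+ j * conjc (E t ^+ i)) =
      \sum_(i < D) cintegral mu unitI (fun t => \sum_(j < D) conjc q`_i * q`_j * (E t ^+ j * conjc (E t ^+ i))).
      apply: eq_bigr => i _; rewrite (cs i).2; apply: eq_bigr => j _.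
      by rewrite cintegralZ//; exact: cintegrable_EJ.
    rewrite -css /=; apply: eq_Rintegral => t _.
    rewrite -[RHS]cReC -mulcJ qE conjc_sum mulr_suml exchange_big /=; congr Re.
    apply: eq_bigr => i _; rewrite mulr_sumr; apply: eq_bigr => j _.
    by rewrite conjcM; ring.
  have sq1 : sqn L (qw (1 - p)) <= k.
    rewrite sqqw; last first.
      rewrite (leq_trans (size_polyD _ _))// size_polyN size_polyC oner_eq0 /= /D.
      by rewrite geq_max leqnSn andbT.
    move: p3; congr (_ <= _); apply: eq_Rintegral => t _.
    by rewrite !hornerE.
  have diff : ip L u w - ip L pu' w = ip L (U u D) (qw (1 - p)).
    have qE : qw (1 - p) = fun n => U w D n - \sum_(h < D) conjc p`_h * U w (D - h)%N n.
      apply/funext => n; rewrite /qw.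
      transitivity (\sum_(h < D) ((h == 0%N :> nat)%:R * U w (D - h)%N n - conjc p`_h * U w (D - h)%N n)).
        apply: eq_bigr => h _; rewrite coefB coef1 conjcB mulrBl; congr (_ * _ - _).
        by case: eqP; rewrite ?conjc1 ?conjc0.
      rewrite sumrB; congr (_ - _); rewrite (bigD1 ord0) //= mul1r big1 ?addr0 ?subn0// => h h0.
      by rewrite -val_eqE /= in h0; rewrite (negbTE h0) mul0r.
    have bs : bounded_cseq (fun n => \sum_(h < D) conjc p`_h * U w (D - h)%N n).
      by apply: bdc_sum => h _; apply: bdcZ; exact: bU.
    rewrite qE (ipBr mL (bU w D bw) bs (bU u D bu)) (ip_shift mL D bu bw); congr (_ - _).
    rewrite ippu// (@ip_sumr R L mL _ _ (fun h : 'I_D => conjc p`_h) (fun h : 'I_D => U w (D - h)%N) _ (fun h => bU w _ bw) (bU u D bu)).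
    apply: eq_bigr => h _; rewrite conjcK; congr (_ * _).
    rewrite -(ip_shift mL (D - h) (bU u h bu) bw); congr (ip L _ _).
    by apply/funext => n; rewrite /U; congr u; have := ltn_ord h; lia.
  have c1 := cauchy_schwarz mL (bU u D bu) (bqw (1 - p)).
  rewrite -diff (sqn_shift mL D bu) in c1.
  have c2 := cauchy_schwarz mL bpu' bw.
  have c1' := le_trans c1 (ler_wpM2l su sq1).
  have c2' := le_trans c2 (ler_wpM2r sw sqpu).
  have tri : normc (ip L u w) <= normc (ip L u w - ip L pu' w) + normc (ip L pu' w).
    by rewrite -{1}[ip L u w](subrK (ip L pu' w)) nrmD.
  move: c1' c2' tri; move: (normc (ip L u w - _)) (normc (ip L pu' w)) (nrm_ge0 (ip L u w)) => a b z0 c1' c2' tri.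
  have h1 : normc (ip L u w) ^+ 2 <= (a + b) ^+ 2.
    by rewrite ler_pXn2r ?nnegrE// (le_trans z0).
  have h2 : (a + b) ^+ 2 <= 2 * a ^+ 2 + 2 * b ^+ 2.
    rewrite -subr_ge0 (_ : _ - _ = (a - b) ^+ 2) ?sqr_ge0//; ring.
  by rewrite (le_trans h1)// (le_trans h2)// lerD// ler_pM2l.
apply/eqP; rewrite -sqrf_eq0; apply/eqP/le_anti; rewrite sqr_ge0 andbT.
apply/ler_addgt0Pr => e e0; rewrite add0r.
pose K := 2 * sqn L u + 2 * ((1 + sqn L u) * sqn L w) + 1.
have K0 : 0 < K by rewrite ltr_wpDl// addr_ge0 ?mulr_ge0 ?addr_ge0.
have := key (e / K) (divr_gt0 e0 K0); move/le_trans; apply.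
have -> : 2 * (sqn L u * (e / K)) + 2 * ((e / K + e / K * sqn L u) * sqn L w) = (K - 1) * (e / K) by rewrite /K; ring.
by rewrite mulrBl mul1r mulrCA mulfV ?gt_eqF// mulr1 lerBlDr lerDl divr_ge0 ?ltW.
Qed.

(** * Volumes of boxes *)

Section CubeMeasure.
Context {R : realType}.
Local Notation RB := (measurableTypeR R).
Implicit Types (I : interval R).

Definition len I : R := fine (@lebesgue01 R [set` I]).

Lemma lebesgue01_fin (A : set RB) : measurable A -> (fine (@lebesgue01 R A))%:E = @lebesgue01 R A.
Proof. by move=> mA; rewrite fineK// fin_num_measure. Qed.

Lemma len_ge0 I : 0 <= len I.
Proof. exact: fine_ge0. Qed.

Lemma len_le1 I : len I <= 1.
Proof.
by rewrite -lee_fin lebesgue01_fin; [exact: probability_le1|]; exact: measurable_itv.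
Qed.

Lemma le_len I I' : [set` I] `<=` [set` I'] -> len I <= len I'.
Proof.
move=> II'; rewrite -lee_fin !lebesgue01_fin; [|exact: measurable_itv..].
by apply: le_measure => //; rewrite inE; exact: measurable_itv.
Qed.

Lemma len_itv (b c : bool) (l r : R) : 0 <= l -> r <= 1 ->
  len (Interval (BSide b l) (BSide c r)) = Num.max 0 (r - l).
Proof.
move=> l0 r1; have -> : len (Interval (BSide b l) (BSide c r)) =
    fine (@lebesgue_measure R [set` Interval (BSide b l) (BSide c r)]).
  rewrite /len; congr fine.
  rewrite -[LHS]/(@lebesgue_measure R ([set` Interval (BSide b l) (BSide c r)] `&` unitI)).
  rewrite setIidl// => t; rewrite /unitI /= !itv_boundlr /= => /andP[h1 h2].
  apply/andP; split.
    by apply: le_trans h1; case: (b); rewrite bnd_simp.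
  by apply: (le_trans h2); case: (c); rewrite bnd_simp.
rewrite lebesgue_measure_itv /= lte_fin; case: ltP => h /=.
  by rewrite max_r// subr_ge0 ltW.
by rewrite max_l// subr_le0.
Qed.

Lemma len_inner (l r e : R) : 0 <= l -> r <= 1 -> 0 < e -> r - l - 2 * e <= len `[l + e, r - e].
Proof.
by move=> l0 r1 e0; rewrite len_itv ?le_max; [apply/orP; right|..]; lra.
Qed.

(** Reduces open, closed and half-open sides to their end points. An unbounded interval meeting
    [[0, 1]] would contain [2] or [-1]. *)
Lemma interval01_ends I : [set` I] !=set0 -> [set` I] `<=` `[0, 1]%classic ->
  exists l r, [/\ [/\ 0 <= l, l <= r & r <= 1], len I = r - l,
    (forall t, l < t < r -> t \in I) & forall t, t \in I -> l <= t <= r].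
Proof.
move=> [t0 It0] I01.
have sub t : t \in I -> 0 <= t <= 1 by move=> /I01; rewrite /= in_itv.
have ends l r : 0 <= l -> l <= r -> r <= 1 -> (forall t, l < t < r -> t \in I) ->
   (forall t, t \in I -> l <= t <= r) -> len I = r - l.
  move=> l0 lr r1 h1 h2; apply/le_anti/andP; split.
    have -> : r - l = len `[l, r] by rewrite len_itv// max_r// subr_ge0.
    by apply: le_len => t /h2; rewrite /= in_itv.
  have -> : r - l = len `]l, r[ by rewrite len_itv// max_r// subr_ge0.
  by apply: le_len => t; rewrite /= in_itv /= => /h1.
case: I => -[b l|[]] [c r|[]] in It0 I01 sub ends *.
- have lr : l <= r.
    move: It0; rewrite /= itv_boundlr => /andP[+ +].
    by case: (b); case: (c); rewrite !bnd_simp => h1 h2; lra.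
  have [ltlr|] := boolP (l < r).
    have h1 t : l < t < r -> t \in Interval (BSide b l) (BSide c r).
      move=> /andP[? ?]; rewrite itv_boundlr; apply/andP.
      by split; [case: (b)|case: (c)]; rewrite bnd_simp// ltW.
    have h2 t : t \in Interval (BSide b l) (BSide c r) -> l <= t <= r.
      rewrite itv_boundlr => /andP[+ +].
      by case: (b); case: (c); rewrite !bnd_simp => ? ?; lra.
    have l0 : 0 <= l.
      rewrite leNgt; apply/negP => l0.
      pose t := Num.min (l / 2) ((l + r) / 2).
      have [q1 q2] : l < t < r /\ t < 0.
        by rewrite /t; case: (ltP (l / 2) ((l + r) / 2)) => h; split; lra.
      by have := sub t (h1 t q1); lra.
    have r1 : r <= 1.
      rewrite leNgt; apply/negP => r1.
      pose t := Num.max ((1 + r) / 2) ((l + r) / 2).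
      have [q1 q2] : l < t < r /\ 1 < t.
        by rewrite /t; case: (ltP ((1 + r) / 2) ((l + r) / 2)) => h; split; lra.
      by have := sub t (h1 t q1); lra.
    by exists l, r; split=> //; exact: ends.
  rewrite -leNgt => rl; have lt0 : l = t0 /\ r = t0.
    move: It0; rewrite /= itv_boundlr => /andP[+ +].
    by case: (b); case: (c); rewrite !bnd_simp => ? ?; lra.
  have := sub _ It0; move: lt0 => [lE rE] /andP[h0 h1].
  have h2 t : t0 < t < t0 -> t \in Interval (BSide b l) (BSide c r) by lra.
  have h3 t : t \in Interval (BSide b l) (BSide c r) -> t0 <= t <= t0.
    by rewrite itv_boundlr => /andP[+ +]; case: (b); case: (c); rewrite !bnd_simp => ? ?; lra.
  by exists t0, t0; split=> //; exact: ends.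
- by move: It0; rewrite /= itv_boundlr andbC.
- exfalso; have := sub 2 _; suff : (2 : R) \in Interval (BSide b l) +oo%O by move=> h /(_ h); lra.
  have := sub _ It0; move: It0; rewrite /= !itv_boundlr => /andP[+ _] t01; rewrite andbT.
  by case: (b); rewrite !bnd_simp => h; lra.
- exfalso; suff h : (-1 : R) \in Interval -oo%O (BSide c r) by have := sub _ h; lra.
  have := sub _ It0; move: It0; rewrite /= !itv_boundlr => /andP[_ +] t01 /=.
  by case: (c); rewrite !bnd_simp => h; lra.
- by move: It0; rewrite /= itv_boundlr andbC.
- by exfalso; have := sub 2 isT; lra.
- by move: It0; rewrite /= itv_boundlr.
- by move: It0; rewrite /= itv_boundlr.
- by move: It0; rewrite /= itv_boundlr.
Qed.

Lemma measurable_tuple_prod d (A : 'I_d -> set RB) : (forall i, measurable (A i)) ->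
  measurable [set t : d.-tuple RB | forall i, A i (tnth t i)].
Proof.
move=> mA; have -> : [set t : d.-tuple RB | forall i, A i (tnth t i)] =
    \big[setI/setT]_(i < d) ((@tnth d RB)^~ i @^-1` A i).
  rewrite -bigcap_seq; apply/seteqP; split=> [t h i _|t h i]; first exact: h.
  by apply: h; rewrite /= mem_index_enum.
apply: big_ind => [||i _]; [exact: measurableT|exact: measurableI|].
by rewrite -[X in measurable X]setTI; apply: measurable_tnth.
Qed.

Lemma cube_tuple_prod d (A : 'I_d -> set RB) : (forall i, measurable (A i)) ->
  lebesgue_cube_tuple R d [set t | forall i, A i (tnth t i)] =
  (\prod_i fine (@lebesgue01 R (A i)))%:E.
Proof.
elim: d A => [|d IH] A mA.
  by rewrite big_ord0 /= /dirac indicE mem_set//= => -[].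
have mS : measurable [set t : d.-tuple RB | forall i, A (lift ord0 i) (tnth t i)].
  exact: (@measurable_tuple_prod d (fun i => A (lift ord0 i))).
have -> : lebesgue_cube_tuple R d.+1 [set t | forall i, A i (tnth t i)] =
   (@lebesgue01 R \x lebesgue_cube_tuple R d)%E
     (A ord0 `*` [set t : d.-tuple RB | forall i, A (lift ord0 i) (tnth t i)]).
  rewrite /= /distribution /pushforward; congr (product_measure1 _ _ _).
  apply/seteqP; split=> [[a t] /= h|[a t] /= [h1 h2] i].
    split; first by have := h ord0; rewrite (tnth_nth a).
    by move=> i; have := h (lift ord0 i); rewrite !(tnth_nth a).
  case: (unliftP ord0 i) => [j ->|->]; last by rewrite (tnth_nth a).
  by have := h2 j; rewrite !(tnth_nth a).
rewrite product_measure1E// big_ord_recl EFinM; congr (_ * _)%E; first by rewrite lebesgue01_fin.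
by apply: (IH (fun i => A (lift ord0 i))) => i.
Qed.

Definition vol d (J : 'I_d -> interval R) : R := \prod_i len (J i).

Lemma vol_bounds d (J : 'I_d -> interval R) : 0 <= vol J <= 1.
Proof.
rewrite prodr_ge0 /=; last by move=> i _; exact: len_ge0.
by rewrite prodr_ile1// => i _; rewrite len_ge0 len_le1.
Qed.

Lemma row_of_tuple_box d (J : 'I_d -> interval R) :
  @row_of_tuple R d @^-1` box J = [set t : d.-tuple RB | forall i, [set` J i] (tnth t i)].
Proof.
by apply/seteqP; split=> t h i; have := h i; rewrite /= mxE.
Qed.

Lemma measurable_box d (J : 'I_d -> interval R) :
  measurable (@row_of_tuple R d @^-1` box J : set (d.-tuple RB)).
Proof.
rewrite row_of_tuple_box; apply: (@measurable_tuple_prod d (fun i => [set` J i])) => i.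
exact: measurable_itv.
Qed.

Lemma cube_tuple_box d (J : 'I_d -> interval R) :
  lebesgue_cube_tuple R d (@row_of_tuple R d @^-1` box J) = (vol J)%:E.
Proof.
by rewrite row_of_tuple_box (@cube_tuple_prod d (fun i => [set` J i])).
Qed.

Lemma lebesgue_cube_box d (J : 'I_d -> interval R) : fine (lebesgue_cube (box J)) = vol J.
Proof. by rewrite /lebesgue_cube cube_tuple_box. Qed.

Lemma cube_box d : @cube R d = box (fun=> `[0, 1] : interval R).
Proof. by apply/seteqP; split=> v h i; have := h i; rewrite /= in_itv. Qed.

Lemma len_unit : len `[0, 1] = 1.
Proof. by rewrite len_itv// subr0 max_r. Qed.

Lemma measurable_cube d : measurable (@row_of_tuple R d @^-1` @cube R d : set (d.-tuple RB)).
Proof. rewrite cube_box; exact: measurable_box. Qed.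

Lemma cube_tuple_cube d : lebesgue_cube_tuple R d (@row_of_tuple R d @^-1` @cube R d) = 1%E.
Proof. by rewrite cube_box cube_tuple_box /vol big1// => i _; exact: len_unit. Qed.

(** From [x A - y B = x (A - B) + (x - y) B], with all factors in [[0, 1]], each coordinate
    contributes at most [e]. *)
Lemma prod_dist d (a b : 'I_d -> R) (e : R) : (forall i, 0 <= a i <= 1) -> (forall i, 0 <= b i <= 1) ->
  (forall i, a i <= b i + e) -> 0 <= e -> \prod_i a i <= \prod_i b i + d%:R * e.
Proof.
elim: d a b => [|d IH] a b a1 b1 ab e0; first by rewrite !big_ord0 mul0r addr0.
rewrite !big_ord_recl.
have := IH (fun i => a (lift ord0 i)) (fun i => b (lift ord0 i)) (fun i => a1 _) (fun i => b1 _) (fun i => ab _) e0.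
have B1 : \prod_(i < d) b (lift ord0 i) <= 1 by exact: prodr_ile1.
have B0 : 0 <= \prod_(i < d) b (lift ord0 i).
  by apply: prodr_ge0 => i _; case/andP: (b1 (lift ord0 i)).
have := a1 ord0; have := b1 ord0; have := ab ord0; move: (e0) B0 B1.
set x := a ord0; set y := b ord0; set A := \prod_(i < d) a _; set B := \prod_(i < d) b _.
have : 0 <= d%:R * e by rewrite mulr_ge0.
rewrite -natr1 mulrDl mul1r; move: (d%:R * e) => z z0 _ B0 B1 xy /andP[y0 y1] /andP[x0 x1] AB.
have h1 : x * A <= x * B + x * z by rewrite -mulrDr ler_wpM2l.
have h2 : x * B - y * B <= e by rewrite -mulrBl; case: (leP x y) => h; nra.
have h3 : x * z <= z by rewrite ler_piMl.
lra.
Qed.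

End CubeMeasure.

(** * Grids, step functions and Riemann sums on the cube *)

Section CubeFunctions.
Context {R : realType} {d : nat}.
Local Notation RB := (measurableTypeR R).
Local Notation Q := (@cube R d).
Local Notation Leb := (lebesgue_cube_tuple R d).
Local Notation row := (@row_of_tuple R d).
Local Notation D := (row @^-1` Q).
Implicit Types (f : 'rV[R]_d -> R[i]) (v : 'rV[R]_d).

Lemma compact_cube : compact Q.
Proof.
have -> : Q = [set v : 'rV[R]_d | forall i, (fun=> `[0, 1]%classic : set R) i (v ord0 i)].
  by apply/seteqP; split=> v h i; have := h i; rewrite /= in_itv.
by apply: (@rV_compact R d (fun=> `[0, 1]%classic)) => i; exact: segment_compact.
Qed.

(** The near-covering form of compactness, with [\oo] as the parameter filter, gives one threshold
    beyond which every grid is fine enough. *)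
Lemma uniformly_continuous_cube f (e : R) : continuous_on_cube f -> 0 < e ->
  exists m, forall n, (m <= n)%N -> forall u v, Q u -> Q v ->
    (forall i, `|u ord0 i - v ord0 i| <= n.+1%:R^-1) -> normc (f u - f v) <= e.
Proof.
move=> /subspace_continuousP cf e0.
have /compact_near_coveringP/(_ nat \oo (fun n u => Q u -> forall v, Q v ->
    (forall i, `|u ord0 i - v ord0 i| <= n.+1%:R^-1) -> normc (f u - f v) <= e) _) := compact_cube.
case=> [x Qx|m _ hm]; last by exists m => n mn u v Qu Qv; exact: hm.
have c0 : (fun u => normc (f u - f x)) @ within Q (nbhs x) --> (0 : R).
  rewrite -(@nrm0 R) -(subrr (f x)); apply: cvg_nrm.
  by apply: (@cvgB _ (R[i]^o)); [exact: cf|exact: cvg_cst].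
have e20 : 0 < e / 2 by rewrite divr_gt0.
have /= := (cvgrPdist_le _ _).1 c0 _ e20.
rewrite near_withinE => hn; have [r /= r0 hr] := (@nbhs_ballP R 'rV[R]_d x _).1 (hn (within_filter _ _)).
have hQ u : ball x r u -> Q u -> normc (f u - f x) <= e / 2.
  by move=> /hr/[apply]; rewrite sub0r normrN ger0_norm// nrm_ge0.
have r20 : 0 < r / 2 by rewrite divr_gt0.
exists (ball x (r / 2), [set n : nat | n.+1%:R^-1 < r / 2]).
  split => /=; first exact: nbhsx_ballx.
  near=> n; rewrite /mkset invf_plt ?posrE//.
  apply: (@lt_trans _ _ n%:R); last by rewrite ltr_nat.
  by near: n; exact: nbhs_infty_gtr.
move=> [u n] /= [bu un] Qu v Qv uv.
have bu' : ball x r u.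
  by apply: le_ball bu; rewrite ler_pdivrMr// ler_peMr ?ler1n// ltW.
have bv : ball x r v.
  rewrite [r]splitr; apply: (ball_triangle bu); split => // i j.
  rewrite (ord1 i); apply: le_lt_trans un; exact: uv.
have := hQ _ bu' Qu; have := hQ _ bv Qv => h1 h2.
have -> : f u - f v = (f u - f x) - (f v - f x) by ring.
apply: (le_trans (nrmB _ _)); rewrite [e]splitr; exact: lerD.
Unshelve. all: by end_near. Qed.

Section Cells.
Variable n : nat.

(** Half-open except for the last side, so that the cells partition the closed cube. *)
Definition side (k : 'I_n.+1) : interval R :=
  if (k < n)%N then `[k%:R / n.+1%:R, k.+1%:R / n.+1%:R[ else `[k%:R / n.+1%:R, 1].

Definition side_of (t : R) : 'I_n.+1 := inord (minn n (Num.truncn (n.+1%:R * t))).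

Lemma mem_side t k : 0 <= t <= 1 -> (t \in side k) = (k == side_of t).
Proof.
move=> /andP[t0 t1]; have n0 : 0 < n.+1%:R :> R by rewrite ltr0n.
have y0 : 0 <= n.+1%:R * t by rewrite mulr_ge0// ltW.
have -> : (k == side_of t) = (minn n (Num.truncn (n.+1%:R * t)) == k :> nat).
  by rewrite -val_eqE /= inordK ?ltnS ?geq_minl// eq_sym.
rewrite /side; case: ltnP => kn; rewrite in_itv /=.
  rewrite ler_pdivrMr// ltr_pdivlMr// mulrC -truncn_ge_nat// -truncn_lt_nat//.
  by move: (Num.truncn _) => a; apply/idP/eqP; lia.
rewrite t1 andbT ler_pdivrMr// mulrC -truncn_ge_nat//.
by move: (Num.truncn _) (ltn_ord k) => a; lia.
Qed.

Lemma side_sub k : [set` side k] `<=` `[0, 1]%classic.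
Proof.
have n0 : 0 < n.+1%:R :> R by rewrite ltr0n.
move=> t; rewrite /side /=; case: ltnP => kn; rewrite !in_itv /= => /andP[h1 h2].
  rewrite (le_trans _ h1) ?divr_ge0//= (le_trans (ltW h2))//.
  by rewrite ler_pdivrMr// mul1r ler_nat ltnS ltnW.
by rewrite (le_trans _ h1) ?divr_ge0.
Qed.

Lemma len_side k : len (side k) = n.+1%:R^-1.
Proof.
have n0 : 0 < n.+1%:R :> R by rewrite ltr0n.
rewrite /side; case: ltnP => kn; rewrite len_itv ?divr_ge0//.
- by rewrite -mulrBl -natrB// subSnn mul1r max_r// invr_ge0.
- by rewrite ler_pdivrMr// mul1r ler_nat ltnW.
have -> : k = n :> nat by have := ltn_ord k; lia.
by rewrite -[X in X - _](divff (lt0r_neq0 n0)) -mulrBl -natrB// subSnn mul1r max_r// invr_ge0.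
Qed.

Definition cell (k : {ffun 'I_d -> 'I_n.+1}) : 'I_d -> interval R := fun i => side (k i).
Definition cell_of v : {ffun 'I_d -> 'I_n.+1} := [ffun i => side_of (v ord0 i)].
Definition corner (k : {ffun 'I_d -> 'I_n.+1}) : 'rV[R]_d := \row_i ((k i)%:R / n.+1%:R).

Lemma mem_cell v k : Q v -> (v \in box (cell k)) = (k == cell_of v).
Proof.
move=> Qv; apply/idP/eqP => [|->].
  rewrite inE => h; apply/ffunP => i; rewrite ffunE; apply/eqP.
  by rewrite -mem_side; [exact: h|exact: Qv].
rewrite inE => i; rewrite /cell mem_side; [by rewrite ffunE|exact: Qv].
Qed.

Lemma box_cell_sub k : box (cell k) `<=` Q.
Proof. by move=> v h i; have := side_sub (h i); rewrite /= in_itv. Qed.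

Lemma vol_cell k : vol (cell k) = (n.+1%:R^-1) ^+ d.
Proof.
rewrite /vol (eq_bigr (fun=> n.+1%:R^-1)) => [|i _]; last exact: len_side.
by rewrite prodr_const card_ord.
Qed.

Lemma corner_cube k : Q (corner k).
Proof.
move=> i; rewrite mxE divr_ge0//= ler_pdivrMr ?ltr0n// mul1r ler_nat.
exact: ltnW.
Qed.

Lemma corner_cell_of v i : Q v -> `|v ord0 i - corner (cell_of v) ord0 i| <= n.+1%:R^-1.
Proof.
move=> Qv; have n0 : 0 < n.+1%:R :> R by rewrite ltr0n.
have : v \in box (cell (cell_of v)) by rewrite mem_cell.
rewrite inE => /(_ i); rewrite /cell mxE; set k := cell_of v i.
have nV : k.+1%:R / n.+1%:R = k%:R / n.+1%:R + n.+1%:R^-1 :> R.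
  by rewrite -natr1 mulrDl mul1r.
rewrite /side; case: ltnP => kn; rewrite in_itv /= => /andP[h1 h2]; rewrite ger0_norm ?subr_ge0// lerBlDl -nV.
  exact: ltW.
rewrite (le_trans h2)// ler_pdivlMr// mul1r ler_nat; exact: kn.
Qed.

Definition step f v : R[i] := \sum_k f (corner k) * \1_(box (cell k)) v.

Lemma sum_cell v (g : {ffun 'I_d -> 'I_n.+1} -> R[i]) : Q v ->
  \sum_k g k * \1_(box (cell k)) v = g (cell_of v).
Proof.
move=> Qv; rewrite (bigD1 (cell_of v))//= indicE mem_cell// eqxx mulr1 big1 ?addr0// => k kv.
by rewrite indicE mem_cell// (negbTE kv) mulr0.
Qed.

End Cells.

Lemma step_approx f (e : R) : continuous_on_cube f -> 0 < e ->
  exists m, forall n, (m <= n)%N -> forall v, Q v -> normc (f v - step n f v) <= e.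
Proof.
move=> cf e0; have [m hm] := uniformly_continuous_cube cf e0.
exists m => n mn v Qv; rewrite /step sum_cell//; apply: (hm n) => //.
  exact: corner_cube.
by move=> i; exact: corner_cell_of.
Qed.

Lemma bounded_on_cube f : continuous_on_cube f -> exists M, forall v, Q v -> normc (f v) <= M.
Proof.
move=> cf; have [m hm] := step_approx cf ltr01.
exists (1 + \sum_k normc (f (corner (n := m) k))) => v Qv.
rewrite -[f v](subrK (step m f v)); apply: (le_trans (nrmD _ _)).
rewrite lerD ?hm// /step sum_cell// (bigD1 (cell_of m v))//= lerDl sumr_ge0// => k _.
exact: nrm_ge0.
Qed.

Lemma cintegrable_cell (n : nat) (c : R[i]) (k : {ffun 'I_d -> 'I_n.+1}) :
  cintegrable Leb D (fun t => c * \1_(box (cell k)) (row t)) /\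
  cintegral Leb D (fun t => c * \1_(box (cell k)) (row t)) = c * (vol (cell k))%:C%C.
Proof.
have eI : (fun t => \1_(box (cell k)) (row t)) = (fun t => ((\1_(row @^-1` box (cell k)) t : R)%:C%C)) :> (d.-tuple RB -> R[i]).
  by apply/funext => t; rewrite !indicE rmorph_nat.
have mi : measurable_fun setT (\1_(row @^-1` box (cell k)) : d.-tuple RB -> R).
  by apply: measurable_indic; exact: measurable_box.
have i1 : cintegrable Leb D (fun t => \1_(box (cell k)) (row t)).
  rewrite eI; split.
    apply: (@bounded_integrable R _ _ Leb D (@measurable_cube R d) (\1_(row @^-1` box (cell k))) 1) => // t _.
    by rewrite indicE normr_nat; case: (_ \in _).
  by apply: (@bounded_integrable R _ _ Leb D (@measurable_cube R d) (fun=> 0) 0) => // t _; rewrite normr0.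
split; first exact: (cintegrableZ (@measurable_cube R d)).
rewrite (cintegralZ (@measurable_cube R d))//; congr (_ * _); rewrite eI; apply: cplxP => /=.
  rewrite /Rintegral.
  rewrite integral_indic; [|exact: measurable_cube|exact: measurable_box].
  rewrite setIidl; first exact: (congr1 fine (cube_tuple_box (cell k))).
  by move=> t; exact: box_cell_sub.
by rewrite Rintegral_cst ?mul0r//; exact: measurable_cube.
Qed.

Lemma cintegral_step (n : nat) f :
  cintegrable Leb D (fun t => step n f (row t)) /\
  cintegral Leb D (fun t => step n f (row t)) =
    (\sum_k f (corner (n := n) k)) * ((n.+1%:R^-1) ^+ d)%:C%C.
Proof.
have [h1 h2] := cintegrable_sum (@measurable_cube R d) (index_enum _) (fun k : {ffun 'I_d -> 'I_n.+1} => (cintegrable_cell (f (corner k)) k).1).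
split; first exact: h1.
rewrite h2 mulr_suml; apply: eq_bigr => k _.
by rewrite (cintegrable_cell _ _).2 vol_cell.
Qed.

(** [f] is continuous on the cube only, so measurability is obtained there as that of a pointwise
    limit of step functions. *)
Lemma measurable_continuous_on_cube f : continuous_on_cube f ->
  measurable_fun D (fun t => Re (f (row t))) /\ measurable_fun D (fun t => Im (f (row t))).
Proof.
move=> cf.
have cv t : D t -> ((fun n => step n f (row t)) : nat -> R[i]^o) @ \oo --> (f (row t) : R[i]^o).
  move=> Dt; apply/cvg_complex.
  have aux (g : R[i] -> R) : {morph g : x y / x - y} -> (forall z, `|g z| <= normc z) ->
     (fun n => g (step n f (row t))) @ \oo --> g (f (row t)).
    move=> gB gn; apply/cvgrPdist_le => e e0; have [m hm] := step_approx cf e0.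
    by exists m => // n /= mn; rewrite -gB (le_trans (gn _))// hm.
  by split; apply: aux; [exact: cReB|exact: cRe_nrm|exact: cImB|exact: cIm_nrm].
have mst n : measurable_fun D (fun t => Re (step n f (row t))) /\ measurable_fun D (fun t => Im (step n f (row t))).
  by have [[h1 h2] _] := cintegral_step n f; split; apply/measurable_EFinP; [apply: (measurable_int Leb h1)|apply: (measurable_int Leb h2)].
split.
  apply: (@measurable_fun_cvg _ _ _ _ (fun n t => Re (step n f (row t)))).
    by move=> n; case: (mst n).
  by move=> t /cv/cvg_complex[].
apply: (@measurable_fun_cvg _ _ _ _ (fun n t => Im (step n f (row t)))).
  by move=> n; case: (mst n).
by move=> t /cv/cvg_complex[].
Qed.

Lemma cintegrable_continuous_on_cube f : continuous_on_cube f -> cintegrable Leb D (f \o row).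
Proof.
move=> cf; have [M hM] := bounded_on_cube cf; have [m1 m2] := measurable_continuous_on_cube cf.
have fD : (Leb D < +oo)%E by rewrite (_ : Leb D = 1%E) ?ltry//; exact: cube_tuple_cube.
have bD (g : R[i] -> R) : (forall z, `|g z| <= normc z) -> [bounded g (f (row t)) | t in D].
  move=> hg; exists M; split; first exact: num_real.
  by move=> x Mx t Dt; apply: (le_trans (hg _)); apply: (le_trans (hM _ Dt)); exact: ltW.
have mD := @measurable_cube R d.
split.
  by apply: (measurable_bounded_integrable mD fD m1); apply: bD; exact: cRe_nrm.
by apply: (measurable_bounded_integrable mD fD m2); apply: bD; exact: cIm_nrm.
Qed.

Lemma cintegral_bound (g : d.-tuple RB -> R[i]) (M : R) : cintegrable Leb D g ->
  (forall t, D t -> normc (g t) <= M) -> normc (cintegral Leb D g) <= 2 * M.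
Proof.
move=> [g1 g2] gM; apply: (le_trans (nrm_ReIm _)).
have aux (h : d.-tuple RB -> R) : Leb.-integrable D (EFin \o h) ->
    (forall t, D t -> `|h t| <= M) -> `|\int[Leb]_(t in D) h t| <= M.
  move=> ih hM; have mD := @measurable_cube R d.
  have cM : Leb.-integrable D (EFin \o (fun=> M)).
    by apply: (bounded_integrable Leb mD (M := `|M|)).
  apply: (le_trans (le_normr_Rintegral mD ih)).
  have <- : \int[Leb]_(t in D) M = M.
    by rewrite Rintegral_cst//= cube_tuple_cube mulr1.
  apply: le_Rintegral => //.
  have := integrable_abse ih; apply: eq_integrable => //.
have -> : 2 * M = M + M by ring.
apply: lerD; apply: aux => // t Dt; apply: le_trans (gM t Dt); [exact: cRe_nrm|exact: cIm_nrm].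
Qed.

Lemma cube_integral_approx f (e : R) : continuous_on_cube f -> 0 < e ->
  exists m, forall n, (m <= n)%N ->
    normc (cube_integral f - (\sum_k f (corner (n := n) k)) * ((n.+1%:R^-1) ^+ d)%:C%C) <= e.
Proof.
move=> cf e0; have [m hm] := step_approx cf (divr_gt0 e0 (ltr0n R 2)).
exists m => n mn; have [h1 h2] := cintegral_step n f.
have fi := cintegrable_continuous_on_cube cf; have mD := @measurable_cube R d.
rewrite -h2 /cube_integral -mulN1r -(cintegralZ mD)// -(cintegralD mD)//; last exact: cintegrableZ.
rewrite (_ : e = 2 * (e / 2)); last by field.
apply: cintegral_bound.
  by apply: cintegrableD => //; exact: cintegrableZ.
by move=> t Dt; rewrite mulN1r; exact: hm.
Qed.

Lemma cube_integral_shift f (c : R[i]) : continuous_on_cube f ->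
  cube_integral (fun v => f v - c) = cube_integral f - c.
Proof.
move=> cf; have mD := @measurable_cube R d; have fi := cintegrable_continuous_on_cube cf.
rewrite /cube_integral (_ : _ \o row = (fun t => (f \o row) t + (- c) * (fun=> 1) t)); last first.
  by apply/funext => t /=; rewrite mulr1.
have i1 := cintegrable1 Leb mD.
rewrite (cintegralD mD)//; last exact: cintegrableZ.
rewrite (cintegralZ mD)//; congr (_ + _); rewrite -[RHS]mulr1; congr (_ * _).
by apply: cplxP => /=; rewrite Rintegral_cst//= cube_tuple_cube ?mul1r ?mul0r.
Qed.

End CubeFunctions.

(** * Boxes between continuous functions, and weighted averages over boxes *)

Section Sandwich.
Context {R : realType} {d : nat}.
Local Notation RB := (measurableTypeR R).
Local Notation Q := (@cube R d).
Local Notation Leb := (lebesgue_cube_tuple R d).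
Local Notation row := (@row_of_tuple R d).
Local Notation D := (row @^-1` Q).
Local Notation cplx F := (fun v : 'rV[R]_d => (F v)%:C%C).
Implicit Types (F : 'rV[R]_d -> R) (v : 'rV[R]_d) (J : 'I_d -> interval R).

Lemma realCB (a b : R) : (a - b)%:C%C = a%:C%C - b%:C%C :> R[i].
Proof. by apply: cplxP; rewrite ?cReB ?cImB //= subr0. Qed.

Lemma continuous_real_on_cube F : continuous F -> continuous_on_cube (cplx F).
Proof.
move=> cF; apply/subspace_continuousP => v _; apply: cvg_within_filter.
by apply/cvg_complex; split; [exact: cF|exact: cvg_cst].
Qed.

Lemma cube_integral_real F : cube_integral (cplx F) = (Re (cube_integral (cplx F)))%:C%C.
Proof.
apply: cplxP => //=; rewrite Rintegral_cst ?mul0r//; exact: measurable_cube.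
Qed.

Lemma integrable_box J : Leb.-integrable D (fun t => (\1_(row @^-1` box J) t : R)%:E) /\
  \int[Leb]_(t in D) (\1_(row @^-1` box J) t) = fine (Leb (row @^-1` box J `&` D)).
Proof.
have mD := @measurable_cube R d; have mB := measurable_box J; split.
  apply: (@bounded_integrable R _ _ Leb D mD (\1_(row @^-1` box J)) 1); first exact: measurable_indic.
  by move=> t _; rewrite indicE normr_nat; case: (_ \in _).
by rewrite /Rintegral integral_indic.
Qed.

Lemma integrable_real F : continuous_on_cube (cplx F) -> Leb.-integrable D (fun t => (F (row t))%:E).
Proof. by case/cintegrable_continuous_on_cube. Qed.

Lemma cube_integral_le_box F J : continuous_on_cube (cplx F) ->
  (forall v, Q v -> F v <= \1_(box J) v) -> Re (cube_integral (cplx F)) <= vol J.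
Proof.
move=> cF FJ; have mD := @measurable_cube R d; have mB := measurable_box J.
have [i1 i2] := integrable_box J.
apply: (@le_trans _ _ (\int[Leb]_(t in D) (\1_(row @^-1` box J) t))).
  apply: (le_Rintegral mD (integrable_real cF) i1) => t Dt; exact: FJ.
rewrite i2 -lee_fin fineK; last by apply: fin_num_measure; exact: measurableI.
have <- := cube_tuple_box J; apply: le_measure; rewrite ?inE//; exact: measurableI.
Qed.

Lemma cube_integral_ge_box F J : continuous_on_cube (cplx F) -> box J `<=` Q ->
  (forall v, Q v -> \1_(box J) v <= F v) -> vol J <= Re (cube_integral (cplx F)).
Proof.
move=> cF JQ FJ; have mD := @measurable_cube R d; have mB := measurable_box J.
have [i1 i2] := integrable_box J.
apply: (@le_trans _ _ (\int[Leb]_(t in D) (\1_(row @^-1` box J) t))); last first.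
  apply: (le_Rintegral mD i1 (integrable_real cF)) => t Dt; exact: FJ.
rewrite i2 setIidl; last by move=> t; exact: JQ.
by rewrite (_ : Leb (row @^-1` box J) = (vol J)%:E)//; exact: cube_tuple_box.
Qed.

Definition trapezoid (a b e t : R) : R := Num.min 1 (Num.max 0 (1 + Num.min (t - a) (b - t) / e)).

Lemma trapezoid_bounds a b e t : 0 <= trapezoid a b e t <= 1.
Proof. by rewrite /trapezoid le_min ler01 le_max lexx ge_min lexx. Qed.

Lemma trapezoid1 a b e t : 0 < e -> a <= t <= b -> trapezoid a b e t = 1.
Proof.
move=> e0 /andP[h1 h2]; rewrite /trapezoid min_l// le_max; apply/orP; right.
by rewrite lerDl divr_ge0 ?(ltW e0)// le_min !subr_ge0 h1.
Qed.

Lemma trapezoid0 a b e t : 0 < e -> ~~ (a - e < t < b + e) -> trapezoid a b e t = 0.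
Proof.
move=> e0 h; suff le0 : 1 + Num.min (t - a) (b - t) / e <= 0.
  by rewrite /trapezoid max_l// min_r.
rewrite -lerBrDl sub0r ler_pdivrMr// mulN1r ge_min.
by move: h; rewrite negb_and -!leNgt => /orP[h|h]; apply/orP; [left|right]; lra.
Qed.

Lemma continuous_trapezoid a b e : continuous (trapezoid a b e).
Proof.
move=> t; apply: (@continuous_min R R^o (fun=> 1) (fun t => Num.max 0 (1 + Num.min (t - a) (b - t) / e))).
  exact: cvg_cst.
apply: (@continuous_max R R^o (fun=> 0) (fun t => 1 + Num.min (t - a) (b - t) / e)).
  exact: cvg_cst.
apply: cvgD; first exact: cvg_cst.
apply: cvgMl; apply: (@continuous_min R R^o (fun t => t - a) (fun t => b - t)).
  by apply: cvgB; [exact: cvg_id|exact: cvg_cst].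
by apply: cvgB; [exact: cvg_cst|exact: cvg_id].
Qed.

Definition bump (a b : 'I_d -> R) (e : R) v : R := \prod_i trapezoid (a i) (b i) e (v ord0 i).

Lemma continuous_bump a b e : continuous (bump a b e).
Proof.
rewrite /bump; apply: (@continuous_big R^o _ *%R 1 predT (@mul_continuous R)) => i _ v.
apply: continuous_comp; last exact: continuous_trapezoid.
exact: coord_continuous.
Qed.

Lemma bump_bounds a b e v : 0 <= bump a b e v <= 1.
Proof.
rewrite prodr_ge0 /=; last by move=> i _; case/andP: (trapezoid_bounds (a i) (b i) e (v ord0 i)).
by rewrite prodr_ile1// => i _; exact: trapezoid_bounds.
Qed.

Lemma indic_le_bump a b e J v : 0 < e -> (forall i t, t \in J i -> a i <= t <= b i) ->
  \1_(box J) v <= bump a b e v.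
Proof.
move=> e0 h; rewrite indicE; have [vJ|_] := boolP (v \in box J); last by case/andP: (bump_bounds a b e v).
rewrite /bump big1// => i _; apply: trapezoid1 => //; apply: h.
by move: vJ; rewrite inE; apply.
Qed.

Lemma bump_le_indic a b e J v : 0 < e ->
  (forall i, a i - e < v ord0 i < b i + e -> v ord0 i \in J i) ->
  bump a b e v <= \1_(box J) v.
Proof.
move=> e0 h; rewrite indicE; have [vJ|/negP vJ] := boolP (v \in box J); first by case/andP: (bump_bounds a b e v).
have [i hi] : exists i, ~ (v ord0 i \in J i).
  by apply/not_existsP => hh; apply: vJ; rewrite inE => i; exact: contrapT (hh i).
rewrite /bump (bigD1 i)//= trapezoid0 ?mul0r//.
by apply/negP => /h.
Qed.

(** Trapezoids are placed inside and around the sides. The larger box [Jp] bounds the upper function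
    by an indicator function, whose averages uniform distribution controls. *)
Lemma box_sandwich J (e : R) : box J `<=` Q -> 0 < e -> exists Fm Fp Jp,
  [/\ continuous_on_cube (cplx Fm), continuous_on_cube (cplx Fp), box Jp `<=` Q &
     forall v, Q v -> [/\ 0 <= Fm v, Fm v <= \1_(box J) v, \1_(box J) v <= Fp v & Fp v <= \1_(box Jp) v]] /\
  [/\ vol J - e <= Re (cube_integral (cplx Fm)), Re (cube_integral (cplx Fp)) <= vol J + e &
    vol Jp <= vol J + e].
Proof.
move=> JQ e0; have [[v0 Jv0]|J0] := pselect (box J !=set0); last first.
  have {}J0 : box J = set0 by apply/seteqP; split=> v // Jv; apply: J0; exists v.
  have vJ0 : vol J = 0.
    by apply/EFin_inj; rewrite -cube_tuple_box J0 preimage_set0 measure0.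
  have c0 : continuous_on_cube (cplx (fun=> 0)).
    by apply: (@continuous_real_on_cube (fun=> 0)); exact: cst_continuous.
  have I0 : Re (cube_integral (cplx (fun=> 0))) = 0.
    by rewrite /= Rintegral_cst ?mul0r//; exact: measurable_cube.
  exists (fun=> 0), (fun=> 0), J; rewrite I0 vJ0; split; split=> //; try lra.
  by move=> v _; rewrite indicE J0 in_set0.
have ends i : exists lr : R * R, [/\ [/\ 0 <= lr.1, lr.1 <= lr.2 & lr.2 <= 1], len (J i) = lr.2 - lr.1,
    (forall t, lr.1 < t < lr.2 -> t \in J i) & forall t, t \in J i -> lr.1 <= t <= lr.2].
  have [||l [r h]] := @interval01_ends R (J i); last by exists (l, r).
    by exists (v0 ord0 i); exact: Jv0.
  move=> t /= tJ; rewrite in_itv /=.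
  have := JQ (\row_j (if j == i then t else v0 ord0 j)) _ i; rewrite mxE eqxx; apply => j.
  by rewrite mxE; case: eqP => [->//|_]; exact: Jv0.
have {ends}[lr hlr] := choice ends.
pose l i := (lr i).1; pose r i := (lr i).2.
(* Each of the [d] lengths changes by at most [2 * e1]; the denominator [d.+1] covers [d = 0]. *)
pose e1 := e / (2 * d.+1%:R).
have e10 : 0 < e1 by rewrite divr_gt0// mulr_gt0.
have de1 : d%:R * (2 * e1) <= e.
  have -> : d%:R * (2 * e1) = e * (d%:R / d.+1%:R) by rewrite /e1; field; rewrite ?pnatr_eq0//= nat1r pnatr_eq0.
  by rewrite ler_piMr ?(ltW e0)// ler_pdivrMr ?ltr0n// mul1r ler_nat.
pose Jp i : interval R := `[Num.max 0 (l i - e1), Num.min 1 (r i + e1)].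
pose Jm i : interval R := `[l i + e1, r i - e1].
have JpQ : box Jp `<=` Q.
  move=> v h i; have := h i; rewrite in_itv /= ge_max le_min.
  by move=> /andP[/andP[-> _] /andP[-> _]].
have JmQ : box Jm `<=` Q.
  move=> v h i; have := h i; rewrite in_itv /=.
  by have [[]] := hlr i; rewrite -/(l i) -/(r i) => *; lra.
have vJp : vol Jp <= vol J + e.
  apply: le_trans (_ : vol J + d%:R * (2 * e1) <= _); last by rewrite lerD2l.
  apply: prod_dist; [|by move=> i; rewrite len_ge0 len_le1|..].
  - by move=> i; rewrite len_ge0 len_le1.
  - move=> i; have [[]] := hlr i; rewrite -/(l i) -/(r i) => l0 lr1 r1 -> _ _.
    rewrite len_itv ?le_max ?lexx// ?ge_min ?lexx//.
    rewrite ge_max; apply/andP; split; first lra.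
    have : Num.min 1 (r i + e1) <= r i + e1 by rewrite ge_min lexx orbT.
    have : l i - e1 <= Num.max 0 (l i - e1) by rewrite le_max lexx orbT.
    by move: (Num.min _ _) (Num.max _ _) => *; lra.
  - by rewrite mulr_ge0// ltW.
have vJm : vol J - e <= vol Jm.
  rewrite lerBlDr; apply: le_trans (_ : vol Jm + d%:R * (2 * e1) <= _); last by rewrite lerD2l.
  apply: prod_dist; [by move=> i; rewrite len_ge0 len_le1|by move=> i; rewrite len_ge0 len_le1|..].
  - move=> i; have [[]] := hlr i; rewrite -/(l i) -/(r i) => l0 lr1 r1 -> _ _.
    by have := len_inner l0 r1 e10; rewrite -/(Jm i); lra.
  - by rewrite mulr_ge0// ltW.
have cp := continuous_real_on_cube (continuous_bump (a := l) (b := r) (e := e1)).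
have cm := continuous_real_on_cube (continuous_bump (a := fun i => l i + e1) (b := fun i => r i - e1) (e := e1)).
have hp v : Q v -> bump l r e1 v <= \1_(box Jp) v.
  move=> Qv; apply: bump_le_indic => // i /andP[h1 h2]; rewrite in_itv /= ge_max le_min.
  by have := Qv i => /andP[-> ->]; rewrite (ltW h1) (ltW h2).
have hm v : \1_(box Jm) v <= bump (fun i => l i + e1) (fun i => r i - e1) e1 v.
  by apply: indic_le_bump => // i t; rewrite in_itv.
exists (bump (fun i => l i + e1) (fun i => r i - e1) e1), (bump l r e1), Jp.
split; split => //.
- move=> v Qv; split; [by case/andP: (bump_bounds (fun i => l i + e1) (fun i => r i - e1) e1 v)| | |exact: hp].
    apply: bump_le_indic => // i; rewrite addrK subrK; by case: (hlr i) => _ _ + _; apply.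
  by apply: indic_le_bump => // i t; case: (hlr i) => _ _ _; apply.
- by apply: (le_trans vJm); apply: cube_integral_ge_box.
- by apply: (le_trans (cube_integral_le_box cp hp)).
Qed.

Lemma nrm_average_le N (u : nat -> R[i]) (M : R) : 0 <= M ->
  (forall n, (0 < n)%N -> normc (u n) <= M) -> normc (average N u) <= M.
Proof.
move=> M0 uM; rewrite /average nrmM nrm_inv nrm_nat.
have [->|N0] := posnP N; first by rewrite invr0 mulr0.
rewrite ler_pdivrMr ?ltr0n//; apply: (le_trans (nrm_sum _ _ _)).
have -> : M * N%:R = \sum_(1 <= n < N.+1) M by rewrite sumr_const_nat subn1 mulr_natr.
by rewrite big_nat [leRHS]big_nat; apply: ler_sum => n /andP[n0 _]; exact: uM.
Qed.

(* The hypothesis is tested on a continuous function below and one above the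
   indicator function of the box. *)
Lemma weighted_box_average (x : nat -> 'rV[R]_d) (w : nat -> R) : in_cube x ->
  (forall n, (0 < n)%N -> 0 <= w n <= 1) ->
  (forall f, continuous_on_cube f -> cube_integral f = 0 ->
    (fun N => normc (average N (fun n => f (x n) * conjc (w n)%:C%C))) @ \oo --> (0 : R)) ->
  forall J, box J `<=` Q ->
    (fun N => average N (fun n => w n * (\1_(box J) (x n) - vol J))) @ \oo --> (0 : R).
Proof.
move=> xQ w01 hw J JQ.
have test F : continuous_on_cube (cplx F) ->
    (fun N => average N (fun n => w n * (F (x n) - Re (cube_integral (cplx F))))) @ \oo --> (0 : R).
  move=> cF; set c := Re _.
  have cF' : continuous_on_cube (cplx (fun v => F v - c)).
    apply/subspace_continuousP => v Qv.
    have h := (subspace_continuousP _ _).1 cF v Qv.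
    move/cvg_complex: h => [h1 h2]; apply/cvg_complex; split; last exact: h2.
    by apply: (@cvgB _ R^o); [exact: h1|exact: cvg_cst].
  have I0 : cube_integral (cplx (fun v => F v - c)) = 0.
    rewrite (_ : cplx (fun v => F v - c) = (fun v => (F v)%:C%C - c%:C%C)); last first.
      by apply/funext => v; exact: realCB.
    by rewrite cube_integral_shift// cube_integral_real subrr.
  apply/norm_cvg0P.
  have := hw _ cF' I0; apply: cvg_ext => N; rewrite -nrmC -average_realC; congr normc.
  apply: average_eq => n n0; rewrite rmorphM mulrC; congr (_ * _).
  by apply: cplxP; rewrite ?cReJ ?cImJ//= oppr0.
apply/cvgrPdist_le => e e0; have e4 : 0 < e / 4 by rewrite divr_gt0.
have [Fm [Fp [Jp [[cm cp JpQ hF] [h1 h2 h3]]]]] := box_sandwich JQ e4.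
have e2 : 0 < e / 2 by rewrite divr_gt0.
have /cvgrPdist_le/(_ _ e2) tm := test _ cm.
have /cvgrPdist_le/(_ _ e2) tp := test _ cp.
near=> N.
have N0 : (0 < N)%N by near: N; exact: nbhs_infty_gt.
have : `|0 - average N (fun n => w n * (Fm (x n) - Re (cube_integral (cplx Fm))))| <= e / 2 by near: N.
have : `|0 - average N (fun n => w n * (Fp (x n) - Re (cube_integral (cplx Fp))))| <= e / 2 by near: N.
have up : average N (fun n => w n * (\1_(box J) (x n) - vol J)) <=
    average N (fun n => w n * (Fp (x n) - Re (cube_integral (cplx Fp)))) + e / 4.
  rewrite -(average_cst (e / 4) N0) -averageD; apply: average_le => n n0.
  have [_ _ q1 q2] := hF _ (xQ n n0); have /andP[w0 w1] := w01 n n0.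
  move: h2 q1; move: (Re _) (\1__ _) (vol J) (Fp _) (w n) w0 w1 e4 => c i V F W; clear.
  by move: (e / 4) => k *; nra.
have lo : average N (fun n => w n * (Fm (x n) - Re (cube_integral (cplx Fm)))) - e / 4 <=
    average N (fun n => w n * (\1_(box J) (x n) - vol J)).
  rewrite -(average_cst (e / 4) N0) -averageB; apply: average_le => n n0.
  have [_ q1 _ _] := hF _ (xQ n n0); have /andP[w0 w1] := w01 n n0.
  move: h1 q1; move: (Re _) (\1__ _) (vol J) (Fm _) (w n) w0 w1 e4 => c i V F W; clear.
  by move: (e / 4) => k *; nra.
move: up lo; rewrite !sub0r !normrN !ler_norml.
move: (average _ _) (average _ _) (average _ _) e0; clear => a b c.
by move=> *; lra.
Unshelve. all: by end_near. Qed.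

Lemma cvg_sum0 (I : Type) (r : seq I) (a : I -> nat -> R) : (forall i, a i @ \oo --> (0 : R)) ->
  (fun N => \sum_(i <- r) a i N) @ \oo --> (0 : R).
Proof.
move=> ha; elim: r => [|i r IH].
  by apply: cvg_ext (cvg_cst (0 : R)) => N; rewrite big_nil.
have h := @cvgD _ R^o _ _ _ _ _ _ _ (ha i) IH; rewrite addr0 in h.
by apply: cvg_ext (h _) => N; rewrite big_cons.
Qed.

(** A uniformly close step function splits the average into three parts: the approximation error,
    the centred cell averages, and a Riemann sum that is close to the integral [0]. *)
Lemma cells_control (x : nat -> 'rV[R]_d) (w : nat -> R) : in_cube x ->
  (forall n, 0 <= w n <= 1) ->
  (forall n (k : {ffun 'I_d -> 'I_n.+1}),
    (fun N => average N (fun m => w m * (\1_(box (cell k)) (x m) - vol (cell (R := R) k)))) @ \oo --> (0 : R)) ->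
  forall f, continuous_on_cube f -> cube_integral f = 0 ->
    (fun N => normc (average N (fun n => (w n)%:C%C * f (x n)))) @ \oo --> (0 : R).
Proof.
move=> xQ w01 hw f cf f0; apply/cvgrPdist_le => e e0; have e3 : 0 < e / 3 by rewrite divr_gt0.
have [m1 hm1] := step_approx cf e3; have [m2 hm2] := cube_integral_approx cf e3.
pose n := maxn m1 m2.
have {}hm1 := hm1 n (leq_maxl _ _); have {}hm2 := hm2 n (leq_maxr _ _).
pose S := (\sum_k f (corner (n := n) k)) * ((n.+1%:R^-1) ^+ d)%:C%C.
have {}hm2 : normc S <= e / 3 by move: hm2; rewrite f0 sub0r nrmN.
pose a N k := average N (fun m => w m * (\1_(box (cell (n := n) k)) (x m) - vol (cell (R := R) k))).
have split N : average N (fun m => (w m)%:C%C * f (x m)) =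
    average N (fun m => (w m)%:C%C * (f (x m) - step n f (x m))) +
    (\sum_k f (corner k) * (a N k)%:C%C + S * (average N w)%:C%C).
  rewrite -average_realC -averageZ.
  under eq_bigr do rewrite /a -average_realC -averageZ.
  rewrite -average_sum -!averageD; congr average; apply/funext => m.
  have -> : \sum_k f (corner k) * (w m * (\1_(box (cell (n := n) k)) (x m) - vol (cell (R := R) k)))%:C%C =
      (w m)%:C%C * step n f (x m) - S * (w m)%:C%C.
    rewrite /step /S mulr_sumr -mulrA mulr_suml -sumrB; apply: eq_bigr => k _.
    by rewrite vol_cell rmorphM rmorphB /= !indicE rmorph_nat; ring.
  by ring.
have : (fun N => \sum_k normc (f (corner k)) * `|a N k|) @ \oo --> (0 : R).
  apply: (@cvg_sum0 _ _ (fun k N => normc (f (corner k)) * `|a N k|)) => k.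
  rewrite -[X in _ --> X](mulr0 (normc (f (corner k)))); apply: cvgMr.
  by apply/norm_cvg0P; exact: hw.
move=> /cvgrPdist_le/(_ _ e3) hs; near=> N.
have N0 : (0 < N)%N by near: N; exact: nbhs_infty_gt.
have : `|0 - \sum_k normc (f (corner k)) * `|a N k| | <= e / 3 by near: N.
rewrite !sub0r !normrN => /(le_trans (ler_norm _)) ha.
rewrite ger0_norm ?nrm_ge0// split.
have aw : `|average N w| <= 1.
  apply: average_bound => // m _; have /andP[? ?] := w01 m; by rewrite ger0_norm.
have h1 : normc (average N (fun m => (w m)%:C%C * (f (x m) - step n f (x m)))) <= e / 3.
  apply: nrm_average_le => [|m m0]; first exact: ltW.
  rewrite nrmM nrmC; have /andP[w0 w1] := w01 m.
  rewrite ger0_norm//; apply: le_trans (hm1 _ (xQ m m0)); rewrite ler_piMl//; exact: nrm_ge0.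
have h2 : normc (\sum_k f (corner k) * (a N k)%:C%C) <= e / 3.
  apply: le_trans (nrm_sum _ _ _) _; apply: le_trans ha; apply: ler_sum => k _.
  by rewrite nrmM nrmC.
have h3 : normc (S * (average N w)%:C%C) <= e / 3.
  rewrite nrmM nrmC; apply: le_trans hm2; rewrite ler_piMr//; exact: nrm_ge0.
apply: (le_trans (nrmD _ _)); have h4 := nrmD (\sum_k f (corner k) * (a N k)%:C%C) (S * (average N w)%:C%C).
move: h1 h2 h3 h4; move: (normc _) (normc _) (normc _) (normc _); clear => *; lra.
Unshelve. all: by end_near. Qed.

End Sandwich.

(** * Averages along subsequences and positive density *)

Section NaturalSubsequences.
Context {R : realType}.
Implicit Types (nk : nat -> nat) (g u v : nat -> R) (c : nat -> bool).

Lemma cvg_plus u v (l m : R) : u @ \oo --> l -> v @ \oo --> m -> (fun N => u N + v N) @ \oo --> l + m.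
Proof. by move=> hu hv; apply: (@cvgD _ R^o); [exact: hu|exact: hv]. Qed.

Lemma cvg_minus u v (l m : R) : u @ \oo --> l -> v @ \oo --> m -> (fun N => u N - v N) @ \oo --> l - m.
Proof. by move=> hu hv; apply: (@cvgB _ R^o); [exact: hu|exact: hv]. Qed.

Lemma cvg_eventually u v (l : R) : (forall N, (0 < N)%N -> u N = v N) -> u @ \oo --> l -> v @ \oo --> l.
Proof.
move=> uv; apply: cvg_trans; apply: near_eq_cvg; near=> N.
by apply: uv; near: N; exact: nbhs_infty_gt.
Unshelve. all: by end_near. Qed.

Lemma average_centered u (l : R) : ((fun N => average N u) @ \oo --> l) <->
  ((fun N => average N (fun n => u n - l)) @ \oo --> (0 : R)).
Proof.
have e N : (0 < N)%N -> average N (fun n => u n - l) = average N u - l.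
  by move=> N0; rewrite averageB average_cst.
split=> h.
  apply: (@cvg_eventually (fun N => average N u - l)) => [N N0|]; first by rewrite e.
  by rewrite -(subrr l); apply: cvg_minus => //; exact: cvg_cst.
apply: (@cvg_eventually (fun N => average N (fun n => u n - l) + l)) => [N N0|].
  by rewrite e// subrK.
by rewrite -[X in _ --> X](add0r l); apply: cvg_plus => //; exact: cvg_cst.
Qed.

(** The value [0] at index [0] lets the integers before the first term be located like those between
    two terms. *)
Definition from0 nk k := if k is 0 then 0%N else nk k.

Lemma pos_increasing_leq nk j k : pos_increasing nk -> (0 < j)%N -> (j <= k)%N -> (nk j <= nk k)%N.
Proof.
by move=> [_ h] j0; rewrite leq_eqVlt => /orP[/eqP->//|jk]; apply: ltnW; exact: h.
Qed.

Lemma locate nk N : pos_increasing nk -> exists k, (from0 nk k <= N < nk k.+1)%N.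
Proof.
move=> inc; elim: N => [|N [k /andP[h1 h2]]]; first by exists 0%N => /=; case: inc => ->.
have [lt|ge] := ltnP N.+1 (nk k.+1); first by exists k; rewrite lt andbT (leq_trans h1).
exists k.+1; rewrite /= ge /=; apply: leq_trans (_ : nk k.+1 < _)%N; first by [].
by case: inc => _; apply.
Qed.

Lemma sum_terms nk g N k : pos_increasing nk -> (from0 nk k <= N < nk k.+1)%N ->
  \sum_(1 <= n < N.+1) \1_(terms nk) n * g n = \sum_(1 <= j < k.+1) g (nk j).
Proof.
move=> inc; have [pos lt] := inc.
elim: N k => [|N IH] k /andP[h1 h2].
  case: k h1 h2 => [|k] /= h1 h2; first by rewrite !big_geq.
  by have := pos k.+1 isT; rewrite lt0n -leqn0 h1.
rewrite big_nat_recr//=; have [e|ne] := eqVneq (from0 nk k) N.+1.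
  case: k e h1 h2 => //= k e _ _.
  rewrite (IH k) ?e ?leqnn ?andbT; last first.
    by case: k e => //= k e; rewrite -ltnS -e; apply: lt.
  rewrite [RHS]big_nat_recr//= indicE mem_set ?mul1r ?e//.
  by exists k.+1.
rewrite (IH k); last by move: h1 ne h2; lia.
rewrite indicE memNset ?mul0r ?addr0// => -[j /= j0 jN].
have [jk|kj] := leqP j k.
  have := pos_increasing_leq inc j0 jk; rewrite jN.
  by case: k jk h1 ne {h2} => [|k] /= jk h1 ne; lia.
by have := pos_increasing_leq inc (ltn0Sn k) kj; rewrite jN; lia.
Qed.

Lemma average_terms nk g N k : pos_increasing nk -> (from0 nk k <= N < nk k.+1)%N ->
  average N (fun n => \1_(terms nk) n * g n) = average k (fun j => g (nk j)) * (k%:R / N%:R).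
Proof.
move=> inc kN; rewrite /average (sum_terms _ inc kN); have [->|k0] := posnP k.
  by rewrite big_geq// !mul0r.
by rewrite mulrA mulfVK// pnatr_eq0 -lt0n.
Qed.

Lemma at_term nk k : pos_increasing nk -> (0 < k)%N -> (from0 nk k <= nk k < nk k.+1)%N.
Proof. by move=> [_ lt]; case: k => //= k _; rewrite leqnn /= lt. Qed.

Lemma indic_average_bounds (A : set nat) N : 0 <= average N (\1_A : nat -> R) <= 1.
Proof.
apply/andP; split; first by apply: mulr_ge0; rewrite ?invr_ge0// sumr_ge0.
have := @average_bound R N (\1_A) 1 ler01 _; move=> h; apply: le_trans (h _); first exact: ler_norm.
by move=> n _; rewrite indicE normr_nat; case: (_ \in _).
Qed.

Lemma lower_densityE (A : set nat) : lower_density R A = sup (range (infs (fun N => average N (\1_A : nat -> R)))).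
Proof.
apply: limn_infE; exists 1; split; first exact: num_real.
move=> M M1 N _ /=; have /andP[h0 h1] := indic_average_bounds A N.
by rewrite ger0_norm// (le_trans h1)// ltW.
Qed.

Lemma infs_has_lbound (A : set nat) m : has_lbound (sdrop (fun N => average N (\1_A : nat -> R)) m).
Proof. by exists 0 => _ [N _ <-]; case/andP: (indic_average_bounds A N). Qed.

Lemma lower_density_gt0 (A : set nat) : 0 < lower_density R A ->
  exists2 e : R, 0 < e & exists m, forall N, (m <= N)%N -> e <= average N (\1_A : nat -> R).
Proof.
rewrite lower_densityE => h; set I := infs _ in h.
have [m Im] : exists m, 0 < I m.
  apply: contrapT => hn; move: h; rewrite ltNge => /negP; apply.
  apply: ge_sup; first by exists (I 0%N); exists 0%N.
  by move=> _ [m _ <-]; rewrite leNgt; apply/negP => h; apply: hn; exists m.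
exists (I m) => //; exists m => N mN; apply: ge_inf; first exact: infs_has_lbound.
by exists N.
Qed.

Lemma lower_density_ge (A : set nat) (e : R) m :
  (forall N, (m <= N)%N -> e <= average N (\1_A : nat -> R)) -> e <= lower_density R A.
Proof.
move=> h; rewrite lower_densityE; apply: le_trans (_ : infs (fun N => average N (\1_A : nat -> R)) m <= _).
  apply: lb_le_inf; first by exists (average m (\1_A : nat -> R)); exists m => /=.
  by move=> _ [N /= mN <-]; exact: h.
apply: ub_le_sup; last by exists m.
exists 1 => _ [k _ <-]; apply: le_trans (_ : average k (\1_A : nat -> R) <= _).
  by apply: ge_inf; [exact: infs_has_lbound|exists k => /=].
by case/andP: (indic_average_bounds A k).
Qed.

(** At [N = nk k] the average over integers is the average along the subsequence times [k / nk k],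
    and positive lower density allows division by this ratio. *)
Lemma average_along nk g : pos_density_seq R nk ->
  (fun N => average N (fun n => \1_(terms nk) n * g n)) @ \oo --> (0 : R) ->
  (fun k => average k (fun j => g (nk j))) @ \oo --> (0 : R).
Proof.
move=> [inc /lower_density_gt0[c c0 [m hc]]] h; apply/cvgrPdist_le => e e0.
have ce : 0 < c * e by rewrite mulr_gt0.
have /cvgrPdist_le/(_ _ ce)[M _ hM] := h; exists (maxn 1 (maxn m M)) => // k /=.
rewrite !geq_max => /and3P[k0 mk Mk].
have kn := pos_increasing_ge inc k0.
have := hM (nk k) (leq_trans Mk kn); rewrite /= !sub0r !normrN (average_terms _ inc (at_term inc k0)).
have d0 : c <= k%:R / (nk k)%:R :> R.
  have := hc (nk k) (leq_trans mk kn); have := average_terms (fun=> 1) inc (at_term inc k0).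
  by rewrite average_cst// mul1r => <-; under [X in _ <= X -> _]average_eq do rewrite -[\1__ _]mulr1.
have d1 := lt_le_trans c0 d0.
rewrite normrM (gtr0_norm d1) => h1.
rewrite -(ler_pM2l c0); apply: le_trans h1; rewrite mulrC ler_wpM2l//.
Qed.

Lemma average_on_terms nk g : pos_increasing nk ->
  (fun k => average k (fun j => g (nk j))) @ \oo --> (0 : R) ->
  (fun N => average N (fun n => \1_(terms nk) n * g n)) @ \oo --> (0 : R).
Proof.
move=> inc /cvgrPdist_le h; apply/cvgrPdist_le => e e0; have [K _ hK] := h e e0.
exists (nk K.+1) => // N /= KN; have [k kN] := locate N inc.
have Kk : (K < k)%N.
  rewrite ltnNge; apply/negP => kK; have := pos_increasing_leq inc (ltn0Sn k) (kK : k.+1 <= K.+1)%N.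
  by case/andP: kN; lia.
have := hK k (ltnW Kk); rewrite /= !sub0r !normrN (average_terms _ inc kN) => h1.
have k0 : (0 < k)%N by lia.
have kN' : (k <= N)%N.
  by apply: leq_trans (pos_increasing_ge inc k0) _; case: k k0 kN {Kk h1} => //= k _ /andP[].
rewrite normrM; apply: le_trans h1; rewrite ler_piMr// ger0_norm ?divr_ge0//.
by rewrite ler_pdivrMr ?ltr0n ?mul1r ?ler_nat// (leq_trans k0).
Qed.

(** The gaps are at most two, so iterating [next] reaches every element of the set. *)
Lemma enumerate c : (forall n, c n.+1 || c n.+2) -> exists nk, pos_density_seq R nk /\
  forall n, (0 < n)%N -> (n \in terms nk) = c n.
Proof.
move=> hc; pose next n := if c n.+1 then n.+1 else n.+2.
have nc n : c (next n) by rewrite /next; case: ifPn => // cn; have := hc n; rewrite (negbTE cn).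
have nlt n : (n < next n)%N by rewrite /next; case: ifP.
pose nk k := iter k next 0%N.
have lt : {homo nk : i j / (i < j)%N >-> (i < j)%N}.
  by apply: (homo_ltn ltn_trans) => i; exact: nlt.
have inc : pos_increasing nk.
  by split=> [k k0|j k _ jk]; [exact: (lt 0%N k k0)|exact: lt].
have mem n : (0 < n)%N -> (n \in terms nk) = c n.
  case: n => // n _; apply/idP/idP; rewrite inE; first by case=> -[//|k] _ <-; exact: nc.
  move=> cn; have [k kn] := locate n inc; exists k.+1 => //=.
  move: kn; have -> : from0 nk k = nk k by case: (k).
  rewrite [nk k.+1]/nk /= -/(nk k) /next; case: ifPn => ck /andP[h1 h2]; first lia.
  have [e|?] := eqVneq n (nk k); last lia.
  by move: cn; rewrite e (negbTE ck).
exists nk; split=> //; split=> //; apply: lt_le_trans (_ : 4%:R^-1 <= _); first by rewrite invr_gt0.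
apply: (@lower_density_ge _ _ 2) => N N2.
(* Of two consecutive integers one is in the set; since the induction advances by two, it carries
   [N] and [N.+1] together. *)
have cnt : (N <= 2 * \sum_(1 <= n < N.+1) c n + 1)%N.
  suff : (N <= 2 * \sum_(1 <= n < N.+1) c n + 1)%N /\ (N.+1 <= 2 * \sum_(1 <= n < N.+2) c n + 1)%N by case.
  elim: (N) => [|M [h1 h2]]; first by rewrite big_geq// big_nat1; lia.
  split=> //; rewrite big_nat_recr//= big_nat_recr//=; have := hc M.
  by case: (c M.+1); case: (c M.+2) => //= _; move: h1; move: (\sum_(1 <= n < M.+1) _)%N => s; lia.
have -> : average N (\1_(terms nk)) = (\sum_(1 <= n < N.+1) c n)%:R / N%:R :> R.
  rewrite /average natr_sum; congr (_ / _); rewrite [LHS]big_nat [RHS]big_nat.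
  by apply: eq_bigr => n /andP[n0 _]; rewrite indicE mem.
have Nr : 0 < N%:R :> R by rewrite ltr0n; lia.
rewrite ler_pdivlMr// mulrC ler_pdivrMr// -natrM ler_nat; lia.
Qed.

Lemma almost_periodic_ext (T : eqType) (b b' : nat -> T) : (forall n, (0 < n)%N -> b n = b' n) ->
  almost_periodic (R := R) b -> almost_periodic (R := R) b'.
Proof.
move=> bb' h e e0; have [C [col hc]] := h e e0; exists C, col => l l' /hc.
apply: filterS => N; congr (_ <= _); apply: average_eq => n n0.
by rewrite !bb' ?addn_gt0 ?n0.
Qed.

Lemma almost_periodic_natseq c : almost_periodic (R := R) c -> (forall n, c n.+1 || c n.+2) ->
  exists nk, compact_natseq R nk /\ forall n, (0 < n)%N -> (n \in terms nk) = c n.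
Proof.
move=> ap hc; have [nk [den mem]] := enumerate hc; exists nk; split=> //; split=> //.
have -> : (\1_(terms nk) : nat -> R[i]) = (fun n => (fun b : bool => b%:R) (n \in terms nk)).
  by apply/funext => n; rewrite indicE.
apply: (@almost_periodic_compact R _ _ (fun b : bool => b%:R) 1).
  by apply: almost_periodic_ext ap => n n0; rewrite mem.
by move=> n _; rewrite nrm_nat; case: (_ \in _).
Qed.

End NaturalSubsequences.

(** * Uniform distribution in both directions *)

Section Parts.
Context {R : realType}.

Lemma indic_ge0 (T : Type) (A : set T) (t : T) : 0 <= (\1_A t : R).
Proof. by rewrite indicE ler0n. Qed.

Lemma conjc_indic (A : set nat) n : conjc (\1_A n : R[i]) = conjc ((\1_A n : R)%:C%C).
Proof. by congr conjc; rewrite !indicE rmorph_nat. Qed.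

Lemma uniformly_distributed_along d (x : nat -> 'rV[R]_d) nk : in_cube x -> pos_density_seq R nk ->
  (forall f, continuous_on_cube f -> cube_integral f = 0 ->
    (fun N => normc (average N (fun n => f (x n) * conjc (\1_(terms nk) n)))) @ \oo --> (0 : R)) ->
  uniformly_distributed (x \o nk).
Proof.
move=> xQ den hf J JQ; rewrite lebesgue_cube_box; apply/average_centered.
apply: (average_along (g := fun n => \1_(box J) (x n) - vol J)) => //.
apply: weighted_box_average => // [n _|f cf f0].
  by rewrite indicE; case: (_ \in _); rewrite ?lexx ?ler01.
apply: cvg_ext (hf f cf f0) => N; congr normc; congr average; apply/funext => n.
by rewrite conjc_indic.
Qed.

(** The reduction shared by both converses: a failure of weak mixing is witnessed by an almost
    periodic set, and equidistribution in cells along that set excludes it. *)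
Lemma almost_periodic_cells_wm d (x : nat -> 'rV[R]_d) : in_cube x ->
  (forall b : nat -> bool, almost_periodic (R := R) b -> forall n (k : {ffun 'I_d -> 'I_n.+1}),
    (fun N => average N (fun m => (b m)%:R * (\1_(box (cell k)) (x m) - vol (cell (R := R) k)))) @ \oo --> (0 : R)) ->
  wm_sequence x.
Proof.
move=> xQ hb f cf f0; apply: contrapT => nwm.
have bf : bounded_cseq (f \o x).
  by have [M hM] := bounded_on_cube cf; exists M => n n0; apply: hM; exact: xQ.
have [b [ap nb]] := core_almost_periodic bf nwm; apply: nb.
have w01 n : 0 <= ((b n)%:R : R) <= 1 by case: (b n); rewrite ?lexx ?ler01.
have := cells_control xQ w01 (hb b ap) cf f0.
by apply: cvg_ext => N; congr normc; congr average; apply/funext => n; rewrite rmorph_nat.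
Qed.

(* Every indicator function of an almost periodic set is a combination of
   indicator functions of three almost periodic sets of positive density. *)
Lemma compact_natseq_wm d (x : nat -> 'rV[R]_d) : in_cube x ->
  (forall nk, compact_natseq R nk -> uniformly_distributed (x \o nk)) -> wm_sequence x.
Proof.
move=> xQ ud; apply: almost_periodic_cells_wm => // b ap m k.
pose h n : R := \1_(box (cell k)) (x n) - vol (cell k).
have dense c : almost_periodic (R := R) c -> (forall n, c n.+1 || c n.+2) ->
    (fun N => average N (fun n => (c n)%:R * h n)) @ \oo --> (0 : R).
  move=> apc hc; have [nk [cnk mem]] := almost_periodic_natseq apc hc.
  have := ud nk cnk (cell k) (@box_cell_sub R d m k); rewrite lebesgue_cube_box => /average_centered hu.
  have [[inc _] _] := cnk; have := average_on_terms (g := h) inc hu.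
  by apply: cvg_ext => N; apply: average_eq => n n0; rewrite indicE mem.
have apo : almost_periodic (R := R) odd.
  by apply: (@almost_periodic_periodic _ _ odd 2) => // n; rewrite addn2 /= negbK.
have app := almost_periodic_pair ap apo.
have h1 := dense _ (almost_periodic_image (fun p : bool * bool => p.1 || ~~ p.2) app) _.
have h2 := dense _ (almost_periodic_image (fun p : bool * bool => p.1 || p.2) app) _.
have h3 := dense (fun=> true) (@almost_periodic_periodic R _ (fun=> true) 1 isT (fun=> erefl)) (fun=> isT).
have {}h1 := h1 (fun n => _); have {}h2 := h2 (fun n => _).
(* The indicator function of [b] is that of [b] or even, plus that of [b] or odd, minus [1]; each of
   these sets meets every pair of consecutive integers. *)
have := cvg_minus (cvg_plus (h1 _) (h2 _)) h3; rewrite addr0 subr0 => hh.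
apply: cvg_ext (hh _ _) => [N|n|n] /=.
- rewrite -averageD -averageB; apply: average_eq => n _.
  by rewrite -/(h n); case: (b n); case: (odd n) => /=; ring.
- by case: (odd n) => /=; rewrite ?orbT.
- by case: (odd n) => /=; rewrite ?orbT.
Qed.

Lemma indic_row_mx d d1 (J : 'I_(d + d1) -> interval R) (u : 'rV[R]_d) (v : 'rV[R]_d1) :
  \1_(box J) (row_mx u v) =
  \1_(box (fun i => J (lshift d1 i))) u * \1_(box (fun i => J (rshift d i))) v :> R.
Proof.
rewrite !indicE -natrM mulnb; congr (nat_of_bool _)%:R; apply/idP/andP; rewrite !inE.
  move=> h; split=> i; first by have := h (lshift d1 i); rewrite row_mxEl.
  by have := h (rshift d i); rewrite row_mxEr.
by move=> [h1 h2] i; case: (split_ordP i) => j ->; rewrite ?row_mxEl ?row_mxEr; [exact: h1|exact: h2].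
Qed.

(** Orthogonality is available against continuous functions of [y] only, so the second factor of the
    box is replaced by a continuous [F] with [\1_J2 <= F <= \1_Jp]; uniform distribution of [y]
    shows that the two bounds nearly agree on average. *)
Lemma uniformly_distributed_pair d d1 (x : nat -> 'rV[R]_d) (y : nat -> 'rV[R]_d1) :
  in_cube x -> in_cube y -> uniformly_distributed y ->
  (forall f F, continuous_on_cube f -> cube_integral f = 0 -> continuous_on_cube F ->
    (fun N => normc (average N (fun n => f (x n) * conjc (F (y n))))) @ \oo --> (0 : R)) ->
  uniformly_distributed (fun n => row_mx (x n) (y n)).
Proof.
move=> xQ yQ udy orth J JQ; rewrite lebesgue_cube_box.
pose J1 i := J (lshift d1 i); pose J2 i := J (rshift d i).
have volJ : vol J = vol J1 * vol J2 by rewrite /vol big_split_ord.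
have [[z Jz]|J0] := pselect (box J !=set0); last first.
  have {}J0 : box J = set0 by apply/seteqP; split=> v // Jv; apply: J0; exists v.
  have -> : vol J = 0 by apply/EFin_inj; rewrite -cube_tuple_box J0 preimage_set0 measure0.
  apply: cvg_ext (cvg_cst (0 : R)) => N; rewrite /average big1 ?mul0r// => n _.
  by rewrite indicE J0 in_set0.
have J1Q : box J1 `<=` @cube R d.
  move=> u Ju i; have := JQ (row_mx u (\row_j z ord0 (rshift d j))) _ (lshift d1 i).
  rewrite row_mxEl; apply => j; case: (split_ordP j) => l ->; rewrite ?row_mxEl ?row_mxEr ?mxE.
    exact: Ju.
  exact: Jz.
have J2Q : box J2 `<=` @cube R d1.
  move=> u Ju i; have := JQ (row_mx (\row_j z ord0 (lshift d1 j)) u) _ (rshift d i).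
  rewrite row_mxEr; apply => j; case: (split_ordP j) => l ->; rewrite ?row_mxEl ?row_mxEr ?mxE.
    exact: Jz.
  exact: Ju.
apply/cvgrPdist_le => e e0; have e4 : 0 < e / 8 by rewrite divr_gt0.
have [Fm [F [Jp [[_ cF JpQ hF] [_ _ vJp]]]]] := box_sandwich J2Q e4.
pose w n := F (y n).
have hw n : (0 < n)%N -> [/\ 0 <= w n <= 1, \1_(box J2) (y n) <= w n & w n <= \1_(box Jp) (y n)].
  move=> n0; have [_ _ q1 q2] := hF _ (yQ n n0); split=> //; apply/andP; split.
    by apply: le_trans q1; exact: indic_ge0.
  by apply: (le_trans q2); rewrite indicE; case: (_ \in _); rewrite ?lexx ?ler01.
have := weighted_box_average xQ (fun n n0 => let: And3 q _ _ := hw n n0 in q)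
  (fun f cf f0 => orth f (fun v => (F v)%:C%C) cf f0 cF) J1Q.
move=> /cvgrPdist_le/(_ _ e4) ha.
have := udy J2 J2Q; rewrite lebesgue_cube_box => /cvgrPdist_le/(_ _ e4) hp.
have := udy Jp JpQ; rewrite lebesgue_cube_box => /cvgrPdist_le/(_ _ e4) hq.
near=> N; have N0 : (0 < N)%N by near: N; exact: nbhs_infty_gt.
have : `|0 - average N (fun n => w n * (\1_(box J1) (x n) - vol J1))| <= e / 8 by near: N.
have : `|vol J2 - average N (fun n => \1_(box J2) (y n))| <= e / 8 by near: N.
have : `|vol Jp - average N (fun n => \1_(box Jp) (y n))| <= e / 8 by near: N.
have /andP[v0 v1] := vol_bounds J1.
have up : average N (fun n => \1_(box J) (row_mx (x n) (y n))) <=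
    average N (fun n => w n * (\1_(box J1) (x n) - vol J1)) + vol J1 * average N (fun n => \1_(box Jp) (y n)).
  rewrite -averageZ -averageD; apply: average_le => n n0; rewrite indic_row_mx -/J1 -/J2.
  have [/andP[w0 w1] q1 q2] := hw n n0.
  have i0 := indic_ge0 (box J1) (x n).
  move: v0 i0 q1 q2; move: (vol J1) (\1_(box J1) _) (\1_(box J2) _) (\1_(box Jp) _) (w n); clear => V i j k W *.
  by nra.
(* Replacing [\1_J2] by [F] loses at most [F - \1_J2 <= \1_Jp - \1_J2], because the first factor is
   at most [1]. *)
have lo : average N (fun n => w n * (\1_(box J1) (x n) - vol J1)) + vol J1 * average N (fun n => \1_(box J2) (y n))
     - (average N (fun n => \1_(box Jp) (y n)) - average N (fun n => \1_(box J2) (y n))) <=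
    average N (fun n => \1_(box J) (row_mx (x n) (y n))).
  rewrite -averageZ -averageD -!averageB; apply: average_le => n n0; rewrite indic_row_mx -/J1 -/J2.
  have [/andP[w0 w1] q1 q2] := hw n n0.
  have i0 := indic_ge0 (box J1) (x n).
  have i1 : \1_(box J1) (x n) <= 1 :> R by rewrite indicE; case: (_ \in _); rewrite ?lexx ?ler01.
  move: v0 i0 i1 q1 q2; move: (vol J1) (\1_(box J1) _) (\1_(box J2) _) (\1_(box Jp) _) (w n); clear => V i j k W v0 i0 i1 q1 q2.
  have p1 : 0 <= V * (W - j) by rewrite mulr_ge0// subr_ge0.
  have p2 : 0 <= (1 - i) * (W - j) by rewrite mulr_ge0// subr_ge0.
  by nra.
move: vJp v0 v1 up lo e0; rewrite volJ !ler_norml.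
move: (average N (fun n => w n * (\1_(box J1) (x n) - vol J1))) (average N (fun n => \1_(box Jp) (y n)))
  (average N (fun n => \1_(box J2) (y n))) (average N (fun n => \1_(box J) (row_mx (x n) (y n)))) (vol J1) (vol J2) (vol Jp); clear => a q p A V v vp.
move=> vJp v0 v1 up lo e0 /andP[b1 b2] /andP[b3 b4] /andP[b5 b6].
have p1 : V * q <= V * v + e / 4 by have := ler_wpM2l v0 (_ : q <= v + e / 4); rewrite mulrDr; nra.
have p2 : V * v - e / 8 <= V * p by nra.
apply/andP; split; lra.
Unshelve. all: by end_near. Qed.

Lemma fract_part_bounds (t : R) : 0 <= fract_part t < 1.
Proof. exact: frac01. Qed.

Lemma fract_partD (y : R) (m : int) : 0 <= y < 1 -> fract_part (y + m%:~R) = y.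
Proof.
move=> y01; rewrite /fract_part (@floor_def _ _ m) ?addrK//.
have -> : (m + 1)%:~R = m%:~R + 1 :> R by rewrite intrD.
by move: (m%:~R : R) => r; lra.
Qed.

(** Rotation by [1 - q] carries [[q, q + h[] to [[0, h[]; it is used instead of [- q] because
    translations must stay in the cube. *)
Lemma fract_part_translate (s q h : R) : 0 <= q -> 0 < h -> q + h <= 1 ->
  (fract_part (s + (1 - q)) < h) = (q <= fract_part s < q + h).
Proof.
move=> q0 h0 qh; have := fract_part_bounds s; set a := fract_part s => /andP[a0 a1].
have sE : s + (1 - q) = a - q + (Num.floor s + 1)%:~R.
  by rewrite /a /fract_part intrD; ring.
rewrite sE; have [qa|aq] := leP q a.
  rewrite fract_partD; last by lra.
  by rewrite ltrBlDl.
have -> : a - q + (Num.floor s + 1)%:~R = (a - q + 1) + (Num.floor s)%:~R by rewrite intrD; ring.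
rewrite fract_partD; last by lra.
by apply/negbTE; rewrite -leNgt; lra.
Qed.

Lemma c_sequence_two_valued d (b : nat -> bool) (t : 'rV[R]_d) : almost_periodic (R := R) b ->
  c_sequence (fun n => if b n then t else 0).
Proof.
move=> ap f cf.
apply: (@almost_periodic_compact R _ b (fun e => f (if e then t else 0)) (normc (f t) + normc (f 0))) => // n _.
by case: (b n); rewrite ?lerDl ?lerDr nrm_ge0.
Qed.

(** Translating only along the almost periodic set and comparing with no translation shows that each
    cell is visited along it as often as the cell at the origin. As the cells partition the cube,
    these common frequencies are determined. *)
Lemma translates_wm d (x : nat -> 'rV[R]_d) : in_cube x ->
  (forall y, in_cube y -> c_sequence y -> uniformly_distributed (fun n => add_mod1 (x n) (y n))) ->
  wm_sequence x.
Proof.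
move=> xQ ud; apply: almost_periodic_cells_wm => // b ap m k.
pose z n := add_mod1 (x n) 0.
have zQ n : cube (z n).
  by move=> i; rewrite mxE; case/andP: (fract_part_bounds (x n ord0 i + (0 : 'rV[R]_d) ord0 i)) => -> /ltW ->.
have z1 n i : z n ord0 i < 1 by rewrite mxE; case/andP: (fract_part_bounds (x n ord0 i + (0 : 'rV[R]_d) ord0 i)).
have Q0 : @cube R d 0 by move=> i; rewrite mxE lexx ler01.
have udb t : cube t -> forall J, box J `<=` @cube R d ->
   (fun N => average N (fun n => \1_(box J) (add_mod1 (x n) (if b n then t else 0)))) @ \oo --> vol J.
  move=> Qt J JQ; rewrite -lebesgue_cube_box; apply: (ud (fun n => if b n then t else 0)) => //.
    by move=> n _; case: (b n).
  exact: c_sequence_two_valued.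
have udz J : box J `<=` @cube R d -> (fun N => average N (fun n => \1_(box J) (z n))) @ \oo --> vol J.
  by move=> JQ; apply: cvg_ext (udb 0 Q0 J JQ) => N; congr average; apply/funext => n; case: (b n).
have J0 : 0 < m.+1%:R :> R by rewrite ltr0n.
pose K0 (i : 'I_d) : interval R := `[0, m.+1%:R^-1[.
have Jinv : m.+1%:R^-1 <= 1 :> R by rewrite invf_le1// ler1n.
have K0Q : box K0 `<=` @cube R d.
  by move=> v h i; have := h i; rewrite in_itv /= => /andP[-> /ltW]/le_trans->.
pose D (k : {ffun 'I_d -> 'I_m.+1}) N := average N (fun n => (b n)%:R * (\1_(box (cell k)) (z n) - \1_(box K0) (z n)) : R).
(* Off the set the two translated sequences coincide; on it, adding [t] carries the cell [k'] to
   [K0]. Subtracting two instances of uniform distribution therefore leaves [D k']. *)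
have hD k' : D k' @ \oo --> (0 : R).
  pose t : 'rV[R]_d := \row_i (1 - (k' i)%:R / m.+1%:R).
  have kb i : 0 <= (k' i)%:R / m.+1%:R :> R /\ (k' i)%:R / m.+1%:R + m.+1%:R^-1 <= 1 :> R.
    split; first exact: divr_ge0.
    by rewrite -[X in _ + X]mul1r -mulrDl natr1 ler_pdivrMr// mul1r ler_nat ltn_ord.
  have Qt : cube t.
    move=> i; rewrite mxE; have [h1 h2] := kb i.
    have h3 : 0 < m.+1%:R^-1 :> R by rewrite invr_gt0.
    by move: h1 h2 h3; set p := _ / _; set q := m.+1%:R^-1; move: p q => p q; clear; lra.
  have := cvg_minus (udb t Qt K0 K0Q) (udz K0 K0Q); rewrite subrr.
  apply: cvg_ext => N; rewrite -averageB; congr average; apply/funext => n.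
  case bn: (b n); rewrite ?mul1r ?mul0r ?subrr//; congr (_ - _).
  rewrite !indicE; congr (nat_of_bool _)%:R.
  have eqi i : ((add_mod1 (x n) t) ord0 i \in K0 i) = (z n ord0 i \in cell k' i).
    have [h1 h2] := kb i.
    have -> : (z n ord0 i \in cell k' i) = ((k' i)%:R / m.+1%:R <= z n ord0 i < (k' i)%:R / m.+1%:R + m.+1%:R^-1).
      rewrite /cell /side; case: ltnP => km; rewrite in_itv /=.
        by rewrite -[X in _ = (_ <= _ < _ + X)]mul1r -mulrDl natr1.
      have -> : (k' i)%:R / m.+1%:R + m.+1%:R^-1 = 1 :> R.
        have -> : k' i = m :> nat by have := ltn_ord (k' i); lia.
        by rewrite -[X in _ + X]mul1r -mulrDl natr1 divff// lt0r_neq0.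
      by rewrite (z1 n i) (ltW (z1 n i)).
    rewrite in_itv /= [in LHS]mxE; have /andP[-> _] := fract_part_bounds (x n ord0 i + t ord0 i).
    rewrite [t _ _]mxE fract_part_translate ?invr_gt0//.
    by rewrite /z mxE [(0 : 'rV[R]_d) _ _]mxE addr0.
  by apply/idP/idP; rewrite !inE => h i; have := h i; rewrite eqi.
have sumz n : \sum_(k' : {ffun 'I_d -> 'I_m.+1}) \1_(box (cell k')) (z n) = 1 :> R.
  rewrite (bigD1 (cell_of m (z n)))//= indicE mem_cell// eqxx big1 ?addr0// => k' kv.
  by rewrite indicE mem_cell// (negbTE kv).
pose V : R := (m.+1%:R^-1) ^+ d.
have VJ : V * (m.+1 ^ d)%:R = 1.
  by rewrite natrX /V -exprMn mulVf ?expr1n// lt0r_neq0.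
(* Averaging [D] over all cells replaces the cell indicators by the constant [V]. *)
have hz : (fun N => average N (fun n => (b n)%:R * (\1_(box (cell k)) (z n) - V) : R)) @ \oo --> (0 : R).
  have hs : (fun N => V * \sum_(k' : {ffun 'I_d -> 'I_m.+1}) D k' N) @ \oo --> (0 : R).
    by rewrite -[X in _ --> X](mulr0 V); apply: cvgMr; exact: cvg_sum0.
  have := cvg_minus (hD k) hs; rewrite subrr; apply: cvg_ext => N.
  rewrite -average_sum -averageZ -averageB; congr average; apply/funext => n.
  rewrite -mulr_sumr sumrB sumz sumr_const card_ffun !card_ord -[_ *+ (m.+1 ^ d)]mulr_natr.
  move: VJ; move: ((m.+1 ^ d)%:R : R) (\1_(box K0) (z n) : R) (\1_(box (cell k)) (z n) : R) => P i j VP.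
  have -> : V * ((b n)%:R * (1 - i * P)) = (b n)%:R * (V - V * P * i) by ring.
  by rewrite VP; ring.
(* Reduction modulo [1] alters [x n] only if some coordinate is [1]. Then [z n] lies on a face of
   volume [0], which is visited with density [0]. *)
pose Z (i j : 'I_d) : interval R := if j == i then `[0, 0] else `[0, 1].
have ZQ i : box (Z i) `<=` @cube R d.
  move=> v h j; have := h j; rewrite /Z; case: eqP => _; rewrite in_itv//= => /andP[-> h1].
  by rewrite (le_trans h1).
have hZ : (fun N => \sum_i average N (fun n => \1_(box (Z i)) (z n) : R)) @ \oo --> (0 : R).
  apply: (@cvg_sum0 _ _ _ (fun i N => average N (fun n => \1_(box (Z i)) (z n) : R))) => i.
  have <- : vol (Z i) = 0.
    by rewrite /vol (bigD1 i)//= /Z eqxx len_itv// subrr maxxx mul0r.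
  exact: udz.
rewrite vol_cell -/V.
pose dif n : R := (b n)%:R * (\1_(box (cell k)) (x n) - \1_(box (cell k)) (z n)).
have hdif : (fun N => average N dif) @ \oo --> (0 : R).
  apply/cvgrPdist_le => e e0; have /cvgrPdist_le/(_ e e0) := hZ.
  apply: filterS => N; rewrite !sub0r !normrN => h; apply: le_trans h; apply: le_trans (ler_norm _).
  rewrite -average_sum.
  have bd n : (0 < n)%N -> `|dif n| <= \sum_i \1_(box (Z i)) (z n).
    move=> n0; have [[i xi]|ne] := pselect (exists i, x n ord0 i = 1).
      rewrite (bigD1 i)//= indicE mem_set; last first.
        move=> j; rewrite /Z; have [->|_] := eqVneq j i; rewrite in_itv /=; last first.
          by have := zQ n j => /andP[-> ->].
        have -> : z n ord0 i = 0; last by rewrite lexx.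
        by rewrite mxE xi mxE addr0 /fract_part floor1 subrr.
      apply: (@le_trans _ _ 1); last by rewrite lerDl sumr_ge0// => j _; exact: indic_ge0.
      rewrite /dif !indicE; case: (b n); case: (_ \in _); case: (_ \in _);
        by rewrite /= ?mul1r ?mul0r ?subrr ?subr0 ?sub0r ?normrN ?normr0 ?normr1 ?lexx ?ler01.
    have -> : dif n = 0.
      rewrite /dif; have -> : z n = x n; last by rewrite subrr mulr0.
      apply/rowP => i; have xi := xQ n n0 i; rewrite mxE [(0 : 'rV[R]_d) _ _]mxE.
      rewrite -[x n ord0 i + 0]/(x n ord0 i + 0%:~R) fract_partD//.
      have /andP[-> h1] := xi; rewrite lt_neqAle h1 andbT /=.
      by apply/eqP => h2; apply: ne; exists i.
    by rewrite normr0 sumr_ge0// => j _; exact: indic_ge0.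
  rewrite ler_norml -averageN; apply/andP; split; apply: average_le => n n0; have := bd n n0; rewrite ler_norml => /andP[h1 h2] //.
have := cvg_plus hz hdif; rewrite addr0; apply: cvg_ext => N.
rewrite -averageD; congr average; apply/funext => n; rewrite /dif; ring.
Qed.

End Parts.

Theorem theorem3p1 (R : realType) (d d1 : nat) (d_gt0 : (0 < d)%N)
    (d1_gt0 : (0 < d1)%N) (x : nat -> 'rV[R]_d) (x_cube : in_cube x) :
  ((sL_sequence x -> forall nk : nat -> nat, spectrally_singular_natseq R nk ->
      uniformly_distributed (x \o nk)) /\
   (wm_sequence x -> forall nk : nat -> nat, compact_natseq R nk ->
      uniformly_distributed (x \o nk))) /\
  ((forall nk : nat -> nat, compact_natseq R nk ->
      uniformly_distributed (x \o nk)) -> wm_sequence x) /\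
  ((sL_sequence x -> forall y : nat -> 'rV[R]_d1, in_cube y ->
      uniformly_distributed y -> ss_sequence y ->
      uniformly_distributed (fun n => row_mx (x n) (y n))) /\
   (wm_sequence x -> forall y : nat -> 'rV[R]_d1, in_cube y ->
      uniformly_distributed y -> c_sequence y ->
      uniformly_distributed (fun n => row_mx (x n) (y n)))) /\
  ((forall y : nat -> 'rV[R]_d, in_cube y -> c_sequence y ->
      uniformly_distributed (fun n => add_mod1 (x n) (y n))) -> wm_sequence x).
Proof.
split; [split|split; [exact: compact_natseq_wm|split; [split|exact: translates_wm]]].
- move=> sL nk [den ss]; apply: uniformly_distributed_along => // f cf f0.
  exact: spectral_orthogonal (sL f cf f0) ss.
- move=> wm nk [den cn]; apply: uniformly_distributed_along => // f cf f0.
  exact: wm_compact_orthogonal (wm f cf f0) cn.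
- move=> sL y yQ udy ss; apply: uniformly_distributed_pair => // f F cf f0 cF.
  exact: spectral_orthogonal (sL f cf f0) (ss F cF).
- move=> wm y yQ udy cs; apply: uniformly_distributed_pair => // f F cf f0 cF.
  exact: wm_compact_orthogonal (wm f cf f0) (cs F cF).
Qed.
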